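(* Let $\Omega\subset\mathbb{RP}^n$ be properly convex and let $\Gamma\subset\mathrm{PGL}(\Omega)$ be finitely generated, discrete and torsion free, containing no non-trivial normal abelian subgroup. Suppose either that $M=\Omega/\Gamma$ is closed, or that there is a subgroup $G\subset\Gamma$ with $G\cong\mathbb{Z}^{n-1}$ and $|\Gamma:G|=\infty$. Then $\Gamma$ does not preserve any proper projective subspace of $\mathbb{RP}^n$.
   Context: $\Omega\subset\mathbb{RP}^n$ is properly convex if its closure is a compact convex subset of some affine chart. $\mathrm{PGL}(\Omega)\subset\mathrm{PGL}(n+1,\mathbb{R})$ is the subgroup preserving $\Omega$.
   Formalization: Ω is taken to be a nonempty open convex subset of an affine chart, bounded there; without openness the claim fails, e.g. for Ω a single point with Γ trivial, where Γ preserves that point. *)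

(* Defs.v *)
From mathcomp Require Import all_boot all_order all_algebra.
From mathcomp Require Import reals.
Set Implicit Arguments. Unset Strict Implicit. Unset Printing Implicit Defensive.
Import Order.TTheory GRing.Theory Num.Theory.
Local Open Scope ring_scope.

(* Conventions.  RP^n is the set of lines of the row-vector space 'rV[R]_(n.+1);
   a subset Omega of RP^n is represented by its cone, a predicate on nonzero
   vectors stable under nonzero scaling.  Elements of PGL(n+1,R) are represented
   by invertible matrices acting on the right (v |-> v *m g), modulo nonzero
   scalars.  A subgroup of PGL(n+1,R) is represented by its full preimage in
   GL(n+1,R) (a set of invertible matrices containing all nonzero scalar
   matrices, closed under product and inverse). *)

Section Defs.
Variables (R : realType) (n : nat).
Local Notation vec := 'rV[R]_(n.+1).
Local Notation mat := 'M[R]_(n.+1).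

Definition pequiv (g h : mat) : Prop := exists c : R, c != 0 /\ g = c *: h.

Definition is_scalar (g : mat) : Prop := pequiv g 1%:M.

Definition proj_cone (Omega : vec -> Prop) : Prop :=
  (forall v, Omega v -> v != 0) /\
  (forall v (c : R), Omega v -> c != 0 -> Omega (c *: v)).

(* open (equivalently, the projectivised set is open in RP^n) *)
Definition open_cone (Omega : vec -> Prop) : Prop :=
  forall v, Omega v -> exists e : R, 0 < e /\
    forall w : vec, (forall i, `|w 0 i - v 0 i| < e) -> Omega w.

(* Omega is a properly convex domain: a nonempty open subset of RP^n which,
   for some affine chart {[v] : v *m a != 0}, lies in that chart and is a convex
   and bounded subset of it (so its closure is a compact convex subset of the
   chart).  The slice {v in Omega | v *m a = 1} is the affine picture of Omega. *)
Definition properly_convex_domain (Omega : vec -> Prop) : Prop :=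
  proj_cone Omega /\ (exists v, Omega v) /\ open_cone Omega /\
  exists a : 'cV[R]_(n.+1),
    (forall v, Omega v -> (v *m a) 0 0 != 0) /\
    (forall x y (t : R), Omega x -> Omega y -> (x *m a) 0 0 = 1 ->
        (y *m a) 0 0 = 1 -> 0 <= t -> t <= 1 ->
        Omega (t *: x + (1 - t) *: y)) /\
    (exists M : R, forall v, Omega v -> (v *m a) 0 0 = 1 ->
        forall i, `|v 0 i| <= M).

Definition preserves (Omega : vec -> Prop) (g : mat) : Prop :=
  g \in unitmx /\ forall v, Omega v <-> Omega (v *m g).

Definition pgl_subgroup (S : mat -> Prop) : Prop :=
  (forall g, S g -> g \in unitmx) /\
  (forall c : R, c != 0 -> S c%:M) /\
  (forall g h, S g -> S h -> S (g *m h)) /\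
  (forall g, S g -> S (invmx g)).

Definition finitely_generated (G : mat -> Prop) : Prop :=
  exists s : seq mat, (forall g, g \in s -> G g) /\
    forall S, pgl_subgroup S -> (forall g, g \in s -> S g) ->
      forall g, G g -> S g.

(* discrete in PGL(n+1,R) with its (quotient) topology: every point [h] of G
   has a neighbourhood (the image of an entrywise e-ball around h) containing
   no other point of G *)
Definition discrete_pgl (G : mat -> Prop) : Prop :=
  forall h, G h -> exists e : R, 0 < e /\
    forall g (c : R), G g -> c != 0 ->
      (forall i j, `|c * g i j - h i j| < e) -> pequiv g h.

Definition torsion_free_pgl (G : mat -> Prop) : Prop :=
  forall g (k : nat), G g -> (0 < k)%N -> is_scalar (g ^+ k) -> is_scalar g.

Definition nontrivial_normal_abelian (G N : mat -> Prop) : Prop :=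
  pgl_subgroup N /\ (forall g, N g -> G g) /\
  (forall g h, G g -> N h -> N (invmx g *m h *m g)) /\
  (forall a b, N a -> N b -> pequiv (a *m b) (b *m a)) /\
  (exists a, N a /\ ~ is_scalar a).

(* Omega / Gamma is compact: there is a compact subset K of Omega (a closed,
   bounded subset of the cone, avoiding 0) whose Gamma-translates cover Omega *)
Definition compact_quotient (Omega : vec -> Prop) (G : mat -> Prop) : Prop :=
  exists K : vec -> Prop,
    (forall v, K v -> Omega v) /\
    (exists M : R, forall v, K v -> forall i, `|v 0 i| <= M) /\
    (forall v : vec, (forall e : R, 0 < e ->
        exists w, K w /\ forall i, `|w 0 i - v 0 i| < e) -> K v) /\
    (forall v, Omega v -> exists g w (c : R),
        G g /\ K w /\ c != 0 /\ v = c *: (w *m g)).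

Definition iso_Zk (k : nat) (G : mat -> Prop) : Prop :=
  exists phi : 'rV[int]_k -> mat,
    (forall x, G (phi x)) /\
    (forall x y, pequiv (phi (x + y)) (phi x *m phi y)) /\
    (forall x, is_scalar (phi x) -> x = 0) /\
    (forall g, G g -> exists x, pequiv g (phi x)).

Definition infinite_index (Gamma G : mat -> Prop) : Prop :=
  forall s : seq mat, exists g, Gamma g /\
    forall h, h \in s -> ~ G (invmx h *m g).

End Defs.

(* Main.v *)
(* [Gamma] lifts to a discrete group [G] of matrices of determinant 1 or -1 that
   preserves a salient open convex cone [C] over [Omega].  Let [U] be an
   invariant subspace.  In each case below either the geometry is contradictory
   or [G] has a nontrivial normal abelian subgroup.

   A normal abelian subgroup appears in two ways.  If every generator has only
   finitely many conjugates by the elements of an infinite set, then two such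
   elements differ by a central one.  If infinitely many elements of [G] move the
   points of a sequence x_t by a fixed bounded amount, while every element moves
   them by an amount independent of t, then in coordinates adapted to x_t the
   elements of [G] have limits; as in the Margulis lemma, commutators of elements
   with limit near 1 are shorter, and this produces the subgroup.

   Closed quotient: every point of [C], however near the frontier, can be brought
   into a compact set.  This excludes that [U] meets [C], and that [U] meets the
   closure of [C] only at 0.  Otherwise take a point y of the closure of [C], interior to
   the face cut out by [U], and move along the ray x + t y: each g displaces this
   ray by a bounded amount, so bringing its points back to the compact set makes
   the conjugates of g finite in number.

   Subgroup Z^(n-1): let y be as above and let f be interior in the dual face of
   nonnegative functionals vanishing on [U].  Either infinitely many elements of
   [G] coarsely fix the rays of y and f, and the ray x + t y gives a normal abelian
   subgroup, or only finitely many do.  Then Z^(n-1), enlarged by scalings of the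
   two factors, acts properly on the product of the relative interiors of the face
   and the dual face, which has dimension at most the rank; a discrete action of
   Z^k on a salient cone of dimension at most k is cocompact, so that Z^(n-1) has
   finite index. *)

Require Import Defs.
From HB Require Import structures.
From mathcomp Require Import all_boot all_order all_algebra all_fingroup.
From mathcomp Require Import boolp classical_sets filter reals sequences exp.
From mathcomp Require Import lra ring zify.
Set Implicit Arguments. Unset Strict Implicit. Unset Printing Implicit Defensive.
Import Order.TTheory GRing.Theory Num.Theory.
Local Open Scope ring_scope.

(** * Matrix norm and ultralimits *)

(** The cocompactness of [Z^k] comes from the commutative matrix algebra [A] that the group spans.
    Down a chain of ideals of [A], the group is kept bounded modulo the ideal along a real subspace
    of directions. A factor that is a field costs one direction, since only the logarithm of an
    absolute value has to vanish; a square-zero factor costs at most its dimension. A discrete group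
    has no bounded direction, so [k] is at most [dim A]. If equality holds, complex factors are
    excluded by this count and nilpotent ones by the salience of the cone, so [A] is a product of
    copies of the reals, the cone is simplicial, and the logarithms of the characters map the group
    onto a lattice.

    The ranks match for the following reason: a face spanning [W] and the dual face of functionals
    vanishing on [W] have total dimension at most [n + 1], while the group has rank [n - 1]. Scaling
    the two factors by powers of 2 supplies the two missing ranks. If one factor is 0, the other has
    dimension at most [n] and one scaling is enough. *)

Section Norm.
Variable R : realType.
Implicit Types m n p q : nat.

Definition nrm m n (A : 'M[R]_(m, n)) : R := \sum_i \sum_j `|A i j|.

Lemma nrm_ge0 m n (A : 'M[R]_(m, n)) : 0 <= nrm A.
Proof. by apply: sumr_ge0 => i _; apply: sumr_ge0. Qed.

Lemma entry_le_nrm m n (A : 'M[R]_(m, n)) i j : `|A i j| <= nrm A.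
Proof.
rewrite /nrm (bigD1 i) //= (bigD1 j) //= -addrA lerDl.
by apply: addr_ge0; apply: sumr_ge0 => // k _; apply: sumr_ge0.
Qed.

Lemma nrm_le m n (A : 'M[R]_(m, n)) c :
  (forall i j, `|A i j| <= c) -> nrm A <= (m * n)%:R * c.
Proof.
move=> H; rewrite /nrm natrM -mulrA.
apply: (@le_trans _ _ (\sum_(i < m) n%:R * c)).
  apply: ler_sum => i _; apply: (@le_trans _ _ (\sum_(j < n) c)); first exact: ler_sum.
  by rewrite sumr_const card_ord !mulr_natl.
by rewrite sumr_const card_ord !mulr_natl.
Qed.

Lemma nrm_eq0 m n (A : 'M[R]_(m, n)) : nrm A = 0 -> A = 0.
Proof.
move=> H; apply/matrixP => i j; rewrite mxE; apply/eqP; rewrite -normr_le0.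
by rewrite -H entry_le_nrm.
Qed.

Lemma nrm0 m n : nrm (0 : 'M[R]_(m, n)) = 0.
Proof. by rewrite /nrm big1 // => i _; rewrite big1 // => j _; rewrite mxE normr0. Qed.

Lemma nrm_gt0 m n (A : 'M[R]_(m, n)) : A != 0 -> 0 < nrm A.
Proof.
move=> A0; rewrite lt_neqAle nrm_ge0 andbT eq_sym; apply: contra A0 => /eqP H.
by apply/eqP/nrm_eq0.
Qed.

Lemma nrmD m n (A B : 'M[R]_(m, n)) : nrm (A + B) <= nrm A + nrm B.
Proof.
rewrite /nrm -big_split; apply: ler_sum => i _ /=; rewrite -big_split.
by apply: ler_sum => j _ /=; rewrite mxE ler_normD.
Qed.

Lemma nrmN m n (A : 'M[R]_(m, n)) : nrm (- A) = nrm A.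
Proof. by apply: eq_bigr => i _; apply: eq_bigr => j _; rewrite mxE normrN. Qed.

Lemma nrmB m n (A B : 'M[R]_(m, n)) : nrm (A - B) <= nrm A + nrm B.
Proof. by rewrite -(nrmN B) nrmD. Qed.

Lemma nrmC m n (A B : 'M[R]_(m, n)) : nrm (A - B) = nrm (B - A).
Proof. by rewrite -nrmN opprB. Qed.

Lemma nrmZ m n c (A : 'M[R]_(m, n)) : nrm (c *: A) = `|c| * nrm A.
Proof.
rewrite /nrm mulr_sumr; apply: eq_bigr => i _; rewrite mulr_sumr.
by apply: eq_bigr => j _; rewrite mxE normrM.
Qed.

Lemma nrm_sum m n I (r : seq I) (F : I -> 'M[R]_(m, n)) :
  nrm (\sum_(i <- r) F i) <= \sum_(i <- r) nrm (F i).
Proof.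
elim: r => [|a r IH]; first by rewrite !big_nil nrm0.
by rewrite !big_cons; apply: (le_trans (nrmD _ _)); rewrite lerD2l.
Qed.

Lemma nrmM m n p (A : 'M[R]_(m, n)) (B : 'M[R]_(n, p)) :
  nrm (A *m B) <= nrm A * nrm B.
Proof.
rewrite /nrm mulr_suml; apply: ler_sum => i _.
apply: (@le_trans _ _ (\sum_(k < n) `|A i k| * \sum_j `|B k j|)).
  under [leRHS]eq_bigr => k _ do rewrite mulr_sumr.
  rewrite exchange_big /=; apply: ler_sum => j _; rewrite mxE.
  by apply: (le_trans (ler_norm_sum _ _ _)); apply: ler_sum => k _; rewrite normrM.
rewrite mulr_suml; apply: ler_sum => k _; apply: ler_wpM2l => //.
by rewrite [leRHS](bigD1 k) //= lerDl; apply: sumr_ge0 => l _; apply: sumr_ge0.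
Qed.

Lemma nrm1 n : nrm (1%:M : 'M[R]_n) = n%:R.
Proof.
rewrite /nrm (eq_bigr (fun=> 1)) ?sumr_const ?card_ord // => i _.
rewrite (bigD1 i) //= !mxE eqxx normr1 big1 ?addr0 // => j ji.
by rewrite mxE eq_sym (negPf ji) normr0.
Qed.

Lemma nrm_tr m n (A : 'M[R]_(m, n)) : nrm A^T = nrm A.
Proof.
rewrite /nrm exchange_big; apply: eq_bigr => i _; apply: eq_bigr => j _.
by rewrite mxE.
Qed.

Lemma nrm_linear m n p q (f : 'M[R]_(m, n) -> 'M[R]_(p, q)) :
  linear f -> exists2 c, 0 <= c & forall A, nrm (f A) <= c * nrm A.
Proof.
move=> fl; pose g := GRing.isLinear.Build R _ _ _ f fl.
pose F : {linear 'M[R]_(m, n) -> 'M[R]_(p, q)} := HB.pack f g.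
pose c := \sum_i \sum_j nrm (F (delta_mx i j)).
have c0 : 0 <= c by apply: sumr_ge0 => i _; apply: sumr_ge0 => j _; apply: nrm_ge0.
exists c => // A; rewrite -[f]/(F : _ -> _) {1}[A]matrix_sum_delta linear_sum.
apply: (le_trans (nrm_sum _ _)); rewrite /c mulr_suml; apply: ler_sum => i _.
rewrite linear_sum; apply: (le_trans (nrm_sum _ _)); rewrite mulr_suml.
apply: ler_sum => j _; rewrite linearZ nrmZ mulrC; apply: ler_wpM2l.
  exact: nrm_ge0.
exact: entry_le_nrm.
Qed.

Lemma sumr_gt0_entry m n (A : 'M[R]_(m, n)) : A != 0 -> exists i j, A i j != 0.
Proof.
move=> A0; apply: contrapT => H; move/eqP: A0; apply; apply/matrixP => i j.
rewrite mxE; apply: contrapT => /eqP Aij; apply: H; by exists i, j.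
Qed.

End Norm.

Section Ultra.

Lemma exists_nonprincipal : exists U : (nat -> Prop) -> Prop,
  [/\ forall P Q, U P -> U Q -> U (fun n => P n /\ Q n),
      forall P Q : nat -> Prop, (forall n, P n -> Q n) -> U P -> U Q,
      forall P, U P \/ U (fun n => ~ P n),
      forall P, U P -> exists n, P n
    & forall m, U (fun n => (m <= n)%N)].
Proof.
pose F := filter_from [set: nat]%classic (fun m => [set n | (m <= n)%N]%classic).
have F0 : Filter F.
  apply: filter_from_filter; first by exists 0%N.
  move=> i j _ _; exists (maxn i j) => // n /=; rewrite geq_max => /andP[a b].
  by split.
have FF : ProperFilter F by apply: filter_from_proper => i _; exists i => /=.
have [G [GU FG]] := ultraFilterLemma FF; exists G; split.
- by move=> P Q GP GQ; exact: filterI.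
- by move=> P Q PQ GP; apply: filterS GP.
- by move=> P; apply: (in_ultra_setVsetC (P : set nat) GU).
- by move=> P GP; exact: (filter_ex GP).
- by move=> m; apply: FG; exists m.
Qed.

(* [ev P]: P holds almost everywhere for a fixed nonprincipal ultrafilter. *)
Definition ev : (nat -> Prop) -> Prop := projT1 (cid exists_nonprincipal).

Let evP := projT2 (cid exists_nonprincipal).

Lemma ev_and P Q : ev P -> ev Q -> ev (fun n => P n /\ Q n).
Proof. by case: evP => H _ _ _ _; apply: H. Qed.
Lemma ev_sub (P Q : nat -> Prop) : (forall n, P n -> Q n) -> ev P -> ev Q.
Proof. by case: evP => _ H _ _ _; apply: H. Qed.
Lemma ev_dec P : ev P \/ ev (fun n => ~ P n).
Proof. by case: evP => _ _ H _ _; apply: H. Qed.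
Lemma ev_ex P : ev P -> exists n, P n.
Proof. by case: evP => _ _ _ H _; apply: H. Qed.
Lemma ev_ge m : ev (fun n => (m <= n)%N).
Proof. by case: evP => _ _ _ _ H; apply: H. Qed.
Lemma ev_true P : (forall n, P n) -> ev P.
Proof. by move=> H; apply: ev_sub (ev_ge 0) => n _. Qed.

Lemma ev_all (T : eqType) (s : seq T) (P : T -> nat -> Prop) :
  (forall x, x \in s -> ev (P x)) -> ev (fun n => forall x, x \in s -> P x n).
Proof.
elim: s => [|a s IH] H; first exact: ev_true.
apply: ev_sub (ev_and (H a (mem_head _ _)) (IH _)).
  by move=> n [h1 h2] x; rewrite inE => /predU1P[->|/h2].
by move=> x xs; apply: H; rewrite inE xs orbT.
Qed.

Variable R : realType.

Lemma ev_big (c : R) : ev (fun n => c <= n%:R).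
Proof.
have [n cn] : exists n, c <= n%:R.
  by exists (Num.bound `|c|); apply/ltW/(le_lt_trans (ler_norm _))/archi_boundP.
apply: ev_sub (ev_ge n) => m; rewrite -(ler_nat R); exact: le_trans.
Qed.

Lemma ev_small (e : R) : 0 < e -> ev (fun n => n.+1%:R^-1 < e).
Proof.
move=> e0; apply: ev_sub (ev_big e^-1) => n H.
rewrite invf_plt ?posrE //; apply: (le_lt_trans H); by rewrite ltr_nat.
Qed.

Definition mlim m n (f : nat -> 'M[R]_(m, n)) (L : 'M[R]_(m, n)) :=
  forall e, 0 < e -> ev (fun t => nrm (f t - L) < e).

(** The limit is the supremum of the numbers lying below [f] almost everywhere. The ultrafilter
    decides every comparison, so no subsequence is extracted. *)
Lemma rlim_ex (f : nat -> R) c : (forall t, `|f t| <= c) ->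
  exists l, forall e, 0 < e -> ev (fun t => `|f t - l| < e).
Proof.
move=> H; pose E := [set x | ev (fun t => x <= f t)]%classic.
have E0 : E (- c) by apply: ev_true => t; have := H t; rewrite ler_norml => /andP[].
have Eub : ubound E c.
  move=> x /ev_ex[t xt]; apply: (le_trans xt); apply: le_trans (H t); exact: ler_norm.
have hs : has_sup E by split; [exists (- c)|exists c].
exists (sup E) => e e0.
have [x Ex xs] := sup_adherent e0 hs.
have h2 : ev (fun t => f t < sup E + e).
  have [h|h] := ev_dec (fun t => sup E + e <= f t).
    have := ub_le_sup (proj2 hs) h; lra.
  by apply: ev_sub h => t /negP; rewrite -ltNge.
apply: ev_sub (ev_and Ex h2) => t [h3 h4]; rewrite ltr_norml; lra.
Qed.

Lemma mlim_ex m n (f : nat -> 'M[R]_(m, n)) c :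
  (forall t, nrm (f t) <= c) -> exists L, mlim f L.
Proof.
move=> H; have h i j : exists l, forall e, 0 < e -> ev (fun t => `|f t i j - l| < e).
  by apply: (@rlim_ex _ c) => t; apply: le_trans (H t); apply: entry_le_nrm.
pose l i j := projT1 (cid (h i j)).
have lP i j := projT2 (cid (h i j)).
exists (\matrix_(i, j) l i j) => e e0.
pose e' := e / (m * n).+1%:R.
have e'0 : 0 < e' by apply: divr_gt0.
have := @ev_all _ (enum [set: 'I_m * 'I_n])
  (fun p t => `|f t p.1 p.2 - l p.1 p.2| < e') (fun p _ => lP p.1 p.2 e' e'0).
apply: ev_sub => t H'.
apply: (@le_lt_trans _ _ ((m * n)%:R * e')).
  apply: nrm_le => i j; rewrite !mxE; apply/ltW/(H' (i, j)).
  by rewrite mem_enum inE.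
rewrite /e' mulrCA gtr_pMr // ltr_pdivrMr ?ltr0n // mul1r ltr_nat //.
Qed.

Lemma mlim_cst m n (A : 'M[R]_(m, n)) : mlim (fun=> A) A.
Proof. by move=> e e0; apply: ev_true => t; rewrite subrr nrm0. Qed.

Lemma mlim_ev m n (f g : nat -> 'M[R]_(m, n)) L :
  ev (fun t => f t = g t) -> mlim f L -> mlim g L.
Proof.
move=> fg fL e e0; apply: ev_sub (ev_and fg (fL e e0)) => t [-> //].
Qed.

Lemma mlimD m n (f g : nat -> 'M[R]_(m, n)) L M :
  mlim f L -> mlim g M -> mlim (fun t => f t + g t) (L + M).
Proof.
move=> fL gM e e0; have e2 : 0 < e / 2 by lra.
apply: ev_sub (ev_and (fL _ e2) (gM _ e2)) => t [h1 h2].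
rewrite opprD addrACA; apply: (le_lt_trans (nrmD _ _)); lra.
Qed.

Lemma mlim_bnd m n (f : nat -> 'M[R]_(m, n)) L c :
  mlim f L -> ev (fun t => nrm (f t) <= c) -> nrm L <= c.
Proof.
move=> fL H; rewrite leNgt; apply/negP => h.
have e0 : 0 < nrm L - c by lra.
have [t [h1 h2]] := ev_ex (ev_and (fL _ e0) H).
have := nrmD (L - f t) (f t); rewrite subrK nrmC; lra.
Qed.

Lemma mlim_lbnd m n (f : nat -> 'M[R]_(m, n)) L c :
  mlim f L -> ev (fun t => c <= nrm (f t)) -> c <= nrm L.
Proof.
move=> fL H; rewrite leNgt; apply/negP => h.
have e0 : 0 < c - nrm L by lra.
have [t [h1 h2]] := ev_ex (ev_and (fL _ e0) H).
have := nrmD (f t - L) L; rewrite subrK; lra.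
Qed.

Lemma mlim_ltb m n (f : nat -> 'M[R]_(m, n)) L c :
  mlim f L -> nrm L < c -> ev (fun t => nrm (f t) < c).
Proof.
move=> fL h; have e0 : 0 < c - nrm L by lra.
apply: ev_sub (fL _ e0) => t h1; have := nrmD (f t - L) L; rewrite subrK; lra.
Qed.

Lemma mlim_uniq m n (f : nat -> 'M[R]_(m, n)) L M : mlim f L -> mlim f M -> L = M.
Proof.
move=> fL fM; apply/eqP; rewrite -subr_eq0; apply/eqP/nrm_eq0/eqP.
rewrite eq_le nrm_ge0 andbT leNgt; apply/negP => h; have e2 : 0 < nrm (L - M) / 2 by lra.
have [t [h1 h2]] := ev_ex (ev_and (fL _ e2) (fM _ e2)).
have := nrmD (L - f t) (f t - M); rewrite addrA subrK nrmC; lra.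
Qed.

Lemma mlimM m n p (f : nat -> 'M[R]_(m, n)) (g : nat -> 'M[R]_(n, p)) L M :
  mlim f L -> mlim g M -> mlim (fun t => f t *m g t) (L *m M).
Proof.
move=> fL gM e e0.
pose c := nrm L + nrm M + 1.
have c0 : 1 <= c by rewrite /c; have := nrm_ge0 L; have := nrm_ge0 M; lra.
pose e' := Num.min 1 (e / (2 * c)).
have e'0 : 0 < e' by rewrite lt_min ltr01 divr_gt0 //; lra.
have e'1 : e' <= 1 by rewrite ge_min lexx.
have e'2 : e' * (2 * c) <= e.
  by rewrite -ler_pdivlMr; [rewrite ge_min lexx orbT|lra].
apply: ev_sub (ev_and (fL _ e'0) (gM _ e'0)) => t [h1 h2].
have -> : f t *m g t - L *m M = (f t - L) *m g t + L *m (g t - M).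
  by rewrite mulmxBl mulmxBr addrA subrK.
apply: (le_lt_trans (nrmD _ _)).
have a1 := nrmM (f t - L) (g t); have a2 := nrmM L (g t - M).
have a3 := nrmD (g t - M) M; rewrite subrK in a3.
have b1 : nrm (f t - L) * nrm (g t) <= nrm (f t - L) * c.
  by apply: ler_wpM2l; [exact: nrm_ge0|rewrite /c; have := nrm_ge0 L; lra].
have b2 : nrm (f t - L) * c < e' * c by rewrite ltr_pM2r //; lra.
have b3 : nrm L * nrm (g t - M) <= c * nrm (g t - M).
  by apply: ler_wpM2r; [exact: nrm_ge0|rewrite /c; have := nrm_ge0 M; lra].
have b4 : c * nrm (g t - M) < c * e' by rewrite ltr_pM2l //; lra.
lra.
Qed.

Lemma mlimN m n (f : nat -> 'M[R]_(m, n)) L :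
  mlim f L -> mlim (fun t => - f t) (- L).
Proof. by move=> fL e /fL; apply: ev_sub => t; rewrite -opprD nrmN. Qed.

Lemma mlim_lin m n p q (F : 'M[R]_(m, n) -> 'M[R]_(p, q)) f L :
  linear F -> mlim f L -> mlim (fun t => F (f t)) (F L).
Proof.
move=> Fl fL e e0; have [c c0 H] := nrm_linear Fl.
have Fs A B : F (A - B) = F A - F B.
  by rewrite -scaleN1r addrC Fl scaleN1r addrC.
have c1 : 0 < c + 1 by lra.
apply: ev_sub (fL _ (divr_gt0 e0 c1)) => t; rewrite ltr_pdivlMr // -Fs => h.
have h1 := H (f t - L); have h2 := nrm_ge0 (f t - L); lra.
Qed.

Lemma mlim_small m n (f : nat -> 'M[R]_(m, n)) c :
  0 <= c -> ev (fun t => nrm (f t) <= c * t.+1%:R^-1) -> mlim f 0.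
Proof.
move=> c0 H e e0; have c1 : 0 < c + 1 by lra.
apply: ev_sub (ev_and H (ev_small (divr_gt0 e0 c1))) => t [h1 h2].
rewrite subr0; rewrite ltr_pdivlMr // in h2.
have h0 : 0 < t.+1%:R^-1 :> R by rewrite invr_gt0 ltr0n.
apply: (le_lt_trans h1); set u := _^-1 in h2 h0 *; lra.
Qed.

End Ultra.

(** * Pigeonhole principles *)

Section Pigeonhole.
Variable R : realType.

Definition finite_pred (T : eqType) (P : T -> Prop) :=
  exists s : seq T, forall x, P x -> x \in s.

Lemma finite_predS (T : eqType) (P Q : T -> Prop) :
  (forall x, P x -> Q x) -> finite_pred Q -> finite_pred P.
Proof. by move=> H [s Hs]; exists s => x /H/Hs. Qed.

Lemma infinite_uniq (T : eqType) (P : T -> Prop) k :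
  ~ finite_pred P -> exists s : seq T, [/\ uniq s, size s = k & forall x, x \in s -> P x].
Proof.
move=> H; elim: k => [|k [s [us ss sP]]]; first by exists [::].
have [x [Px xs]] : exists x, P x /\ x \notin s.
  apply: contrapT => h; apply: H; exists s => x Px; apply: contrapT => /negP xs.
  by apply: h; exists x.
exists (x :: s); split => /=; rewrite ?us ?ss ?xs // => y.
by rewrite inE => /predU1P[->|/sP].
Qed.

Lemma pigeonhole_fin (T : eqType) (K : finType) (P : T -> Prop) (f : T -> K) :
  ~ finite_pred P -> exists x y, [/\ P x, P y, x != y & f x = f y].
Proof.
move=> /(infinite_uniq #|K|.+1)[s [us ss sP]].
have : ~~ uniq (map f s).
  by apply/negP => /card_uniqP; rewrite size_map ss => h; have := max_card (mem (map f s)); rewrite h ltnn.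
case: s us ss sP => // x0 s us ss sP.
move=> /(uniqPn (f x0))[i [j [ij js e]]].
rewrite size_map in js; have is_ := ltn_trans ij js.
rewrite !(nth_map x0) // in e.
exists (nth x0 (x0 :: s) i), (nth x0 (x0 :: s) j); split => //.
- by apply/sP/mem_nth.
- by apply/sP/mem_nth.
- by rewrite nth_uniq // neq_ltn ij.
Qed.

(** The cube of side [2c] is cut into cells of side [d]; two matrices in one cell differ by at most
    [d] in each of the [m * n] entries. *)
Lemma pigeonhole_mx (T : eqType) (P : T -> Prop) m n (f : T -> 'M[R]_(m, n)) c e :
  ~ finite_pred P -> (forall x, P x -> nrm (f x) <= c) -> 0 < e ->
  exists x y, [/\ P x, P y, x != y & nrm (f x - f y) < e].
Proof.
move=> H fc e0; pose d := e / (m * n).+1%:R.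
have d0 : 0 < d by apply: divr_gt0.
pose N := Num.truncn ((c + c) / d).
pose g x : {ffun 'I_m * 'I_n -> 'I_N.+1} :=
  [ffun p => inord (Num.truncn ((f x p.1 p.2 + c) / d))].
have [x [y [Px Py xy gxy]]] := pigeonhole_fin g H.
exists x, y; split => //.
apply: (@le_lt_trans _ _ ((m * n)%:R * d)); last first.
  by rewrite /d mulrCA gtr_pMr // ltr_pdivrMr ?ltr0n // mul1r ltr_nat.
apply: nrm_le => i j; rewrite !mxE.
have/ffunP/(_ (i, j)) := gxy; rewrite !ffunE /= => /(congr1 val) /=.
have tr z : P z -> [/\ 0 <= (f z i j + c) / d & (Num.truncn ((f z i j + c) / d) < N.+1)%N].
  move=> Pz; have := fc z Pz; have := entry_le_nrm (f z) i j; rewrite ler_norml.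
  move=> /andP[h1 h2] h3; split; first by apply: divr_ge0; lra.
  rewrite ltnS /N; apply: le_truncn; apply: ler_wpM2r; last lra.
  by rewrite invr_ge0 ltW.
have [x0 xN] := tr x Px; have [y0 yN] := tr y Py.
rewrite !inordK // => E.
have := truncn_itv x0; have := truncn_itv y0; rewrite E.
set k := Num.truncn _ => /andP[]; rewrite ler_pdivlMr // ltr_pdivrMr // => a1 a2.
move=> /andP[]; rewrite ler_pdivlMr // ltr_pdivrMr // => a3 a4.
rewrite -natr1 in a2 a4; rewrite ler_norml; lra.
Qed.

End Pigeonhole.

(** * Finite spanning families and common kernels *)

Section Spans.
Variables (R : realType) (vT : vectType R).

Lemma span_pred (P : vT -> Prop) :
  exists s : seq vT, (forall x, x \in s -> P x) /\ (forall x, P x -> x \in <<s>>%VS).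
Proof.
apply: contrapT => H.
suff K n : exists s : seq vT, [/\ size s = n, free s & forall x, x \in s -> P x].
  have [s [ss fs _]] := K (\dim {:vT}).+1.
  have := dimvS (subvf <<s>>%VS).
  by move: fs; rewrite /free ss => /eqP ->; rewrite ltnn.
elim: n => [|n [s [ss fs sP]]]; first by exists [::]; split => //; rewrite nil_free.
have [x [Px xs]] : exists x, P x /\ x \notin <<s>>%VS.
  apply: contrapT => h; apply: H; exists s; split => // x Px.
  by apply: contrapT => /negP xs; apply: h; exists x.
exists (x :: s); split; rewrite /= ?ss //; first by rewrite free_cons xs.
by move=> y; rewrite inE => /predU1P[->|/sP].
Qed.

Lemma span_lin (s : seq vT) (Q : vT -> Prop) :
  Q 0 -> (forall a x y, Q x -> Q y -> Q (a *: x + y)) ->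
  (forall x, x \in s -> Q x) -> forall x, x \in <<s>>%VS -> Q x.
Proof.
move=> Q0 QD Qs x /(@coord_span _ _ _ (in_tuple s)) ->.
apply: (@big_rec _ Q) => //= i y _ Qy; apply: QD => //; apply: Qs.
by apply: mem_nth.
Qed.

Lemma vspace_min (P : {vspace vT} -> Prop) V0 : P V0 ->
  exists2 V, P V & forall V', P V' -> (\dim V <= \dim V')%N.
Proof.
move=> PV0; pose Q n := `[< exists2 V, P V & \dim V = n >].
have exQ : exists n, Q n by exists (\dim V0); apply/asboolP; exists V0.
case: (ex_minnP exQ) => n /asboolP[V PV <-] H; exists V => // V' PV'.
by apply: H; apply/asboolP; exists V'.
Qed.

(* [L] need only be linear on [S]; extending it through a basis costs one dimension. *)
Lemma kernel_on (S : {vspace vT}) (L : vT -> R) :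
  (forall s s', s \in S -> s' \in S -> L (s + s') = L s + L s') ->
  (forall c s, s \in S -> L (c *: s) = c * L s) ->
  exists S' : {vspace vT}, [/\ (S' <= S)%VS, (\dim S <= \dim S' + 1)%N
    & forall s, s \in S' -> L s = 0].
Proof.
move=> LD LZ; pose B := vbasis S.
pose f (v : vT) : R^o := \sum_i coord B i v * L B`_i.
have fl : linear f.
  move=> c u v; rewrite /f scaler_sumr -big_split; apply: eq_bigr => i _ /=.
  by rewrite linearP /= mulrDl scalerAl.
pose F : {linear vT -> R^o} := HB.pack f (GRing.isLinear.Build R _ _ _ f fl).
pose g := linfun F.
have gE s : s \in S -> g s = L s.
  move=> sS; rewrite lfunE /= /f.
  rewrite {2}(coord_vbasis sS).
  have Bi (i : 'I_(\dim S)) : B`_i \in S by apply: vbasis_mem; apply: mem_nth; rewrite size_tuple.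
  suff K (r : seq 'I_(\dim S)) : \sum_(i <- r) coord B i s *: B`_i \in S /\
      L (\sum_(i <- r) coord B i s *: B`_i) = \sum_(i <- r) coord B i s * L B`_i.
    by rewrite (K _).2.
  elim: r => [|i r [IH1 IH2]].
    rewrite !big_nil mem0v; split => //.
    by have := LZ 0 0 (mem0v _); rewrite scale0r mul0r.
  rewrite !big_cons; split; first by rewrite memvD // memvZ.
  by rewrite LD ?memvZ // LZ // IH2.
exists (S :&: lker g)%VS; split; first exact: capvSl.
  have := limg_ker_dim g S; have := dimvS (subvf (g @: S)%VS).
  by rewrite dimvf /dim /= => h1 h2; rewrite -h2 leq_add2l.
by move=> s; rewrite memv_cap memv_ker => /andP[sS /eqP]; rewrite gE.
Qed.

Lemma kernels_on (S : {vspace vT}) i (L : 'I_i -> vT -> R) :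
  (forall j s s', s \in S -> s' \in S -> L j (s + s') = L j s + L j s') ->
  (forall j c s, s \in S -> L j (c *: s) = c * L j s) ->
  exists S' : {vspace vT}, [/\ (S' <= S)%VS, (\dim S <= \dim S' + i)%N
    & forall j s, s \in S' -> L j s = 0].
Proof.
move=> LD LZ; suff H n : (n <= i)%N -> exists S' : {vspace vT},
    [/\ (S' <= S)%VS, (\dim S <= \dim S' + n)%N
      & forall j : 'I_i, (j < n)%N -> forall s, s \in S' -> L j s = 0].
  have [S' [h1 h2 h3]] := H i (leqnn i).
  by exists S'; split => // j s; apply: h3.
elim: n => [|n IH] ni; first by exists S; split; rewrite ?subvv ?addn0.
have [S1 [h1 h2 h3]] := IH (ltnW ni).
have sub s : s \in S1 -> s \in S by move/subvP: h1; apply.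
have [||S2 [k1 k2 k3]] := @kernel_on S1 (L (Ordinal ni)).
- by move=> s s' /sub a /sub b; apply: LD.
- by move=> c s /sub a; apply: LZ.
exists S2; split; first exact: subv_trans k1 h1.
  by rewrite addnS -addSn (leq_trans h2) // leq_add2r -addn1.
move=> j; rewrite ltnS leq_eqVlt => /orP[/eqP jn|jn] s sS2; last first.
  by apply: h3 => //; move/subvP: k1; apply.
by rewrite -(k3 s sS2); congr (L _ _); apply: val_inj.
Qed.

End Spans.

(** * Rounding real vectors to integer vectors *)

Section Floors.
Variables (R : realType) (k : nat).
Implicit Types (s : 'rV[R]_k) (z r : 'rV[int]_k).

Definition fl s : 'rV[int]_k := map_mx Num.floor s.
Definition box (B : nat) r := forall i, (`|r 0 i| <= B%:Z).

Lemma flP s i : (fl s 0 i)%:~R <= s 0 i < (fl s 0 i)%:~R + 1.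
Proof. by rewrite mxE; have := floor_itv (s 0 i); rewrite intrD. Qed.

Lemma box_finite B : exists l : seq 'rV[int]_k, forall r, box B r -> r \in l.
Proof.
pose g (f : {ffun 'I_k -> 'I_(B + B).+1}) : 'rV[int]_k := \row_i ((f i)%:Z - B%:Z).
exists (map g (enum {: {ffun 'I_k -> 'I_(B + B).+1}})) => r rB.
apply/mapP; exists [ffun i : 'I_k => inord (absz (r 0 i + B%:Z))]; first by rewrite mem_enum.
apply/rowP => i; rewrite mxE ffunE inordK; last by have := rB i; lia.
rewrite gez0_abs ?addrK //; have := rB i; lia.
Qed.

Lemma box_bound (F : 'rV[int]_k -> R) B : exists c, forall r, box B r -> F r <= c.
Proof.
have [l lP] := box_finite B; exists (\sum_(r <- l) `|F r|) => r /lP rl.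
rewrite (big_rem r) //= (le_trans (ler_norm _)) // lerDl.
by apply: sumr_ge0.
Qed.

Lemma box_of s z B : (forall i, `|s 0 i - (z 0 i)%:~R| <= B%:R) ->
  box B.+1 (fl s - z).
Proof.
move=> H i; have := H i; have := flP s i; rewrite !mxE.
set f := Num.floor _ => /andP[h1 h2]; rewrite ler_norml => /andP[h3 h4].
have E : (B%:Z)%:~R = B%:R :> R by [].
have k1 : (- B%:Z - 1)%:~R < (f - z 0 i)%:~R :> R by rewrite !intrD !intrN E; lra.
have k2 : (f - z 0 i)%:~R < (B%:Z + 1)%:~R :> R by rewrite !intrD !intrN E; lra.
move: k1 k2; rewrite !ltr_int; move: (f - z 0 i) => x; clear; lia.
Qed.

Lemma fl_add s s' : box 2 (fl (s + s') - (fl s + fl s')).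
Proof.
move=> i; have := flP (s + s') i; have := flP s i; have := flP s' i; rewrite !mxE.
set a := Num.floor _; set b := Num.floor (s 0 i); set c := Num.floor _.
move=> /andP[h1 h2] /andP[h3 h4] /andP[h5 h6].
have k1 : (- 2)%:~R < (c - (b + a))%:~R :> R by rewrite !intrD !intrN !intrD; lra.
have k2 : (c - (b + a))%:~R < 2%:~R :> R by rewrite !intrD !intrN !intrD; lra.
move: k1 k2; rewrite !ltr_int; move: (c - _) => x; clear; lia.
Qed.

(** The bound is uniform in [c] and [N]: replacing the real factor [N c] by its floor moves the
    vector by less than one multiple of [s]. *)
Lemma box_scale s : exists B, forall (c : R) (N : int),
  box B (fl (N%:~R *: (c *: s)) - fl ((Num.floor (N%:~R * c))%:~R *: s)).
Proof.
pose B := Num.bound (nrm s).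
have HB i : `|s 0 i| <= B%:R.
  apply: (le_trans (entry_le_nrm _ _ _)); apply/ltW/archi_boundP/nrm_ge0.
exists B.+2 => c N; apply: box_of => i; set f := Num.floor _.
have h := flP (f%:~R *: s) i.
have hf := floor_itv (N%:~R * c); rewrite -/f intrD in hf.
have h2 : `|(N%:~R * c - f%:~R) * s 0 i| <= 1 * B%:R.
  by rewrite normrM; apply: ler_pM => //; rewrite ler_norml; lra.
rewrite -natr1; move: h; set g := (fl _ 0 i)%:~R; rewrite !mxE.
by move: h2; rewrite !ler_norml mulrBl mulrA; lra.
Qed.

Lemma fl0 : fl 0 = 0.
Proof. by apply/rowP => i; rewrite !mxE floor0. Qed.

End Floors.

(** * Quasimorphisms of lattices *)

Section Quasi.
Variable R : realType.

(** Induction gives [(m + 1) D] for a multiplier [m >= 0]; passing to [- m] costs one more defect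
    and the value at 0, each at most [D]. *)
Lemma quasi_mul (b : int -> R) D (M x : int) :
  (forall N M, `|b (N + M) - b N - b M| <= D) ->
  `|b (M * x) - M%:~R * b x| <= ((absz M)%:R + 3) * D.
Proof.
move=> H; have b0 : `|b 0| <= D by have := H 0 0; rewrite addr0 subrr sub0r normrN.
have D0 : 0 <= D by apply: le_trans b0.
have pos (m : nat) : `|b (m%:Z * x) - m%:R * b x| <= (m%:R + 1) * D.
  elim: m => [|m IH]; first by rewrite !mul0r subr0 add0r mul1r.
  have := H (m%:Z * x) x; have -> : m%:Z * x + x = m.+1%:Z * x by rewrite -addn1 PoszD; ring.
  move: IH; rewrite -natr1 !ler_norml; lra.
case: M => m.
  have := pos m; rewrite -pmulrn /=.
  rewrite !ler_norml; lra.
rewrite NegzE; have := pos m.+1; have := H (m.+1%:Z * x) (- m.+1%:Z * x).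
rewrite mulNr subrr intrN -pmulrn abszN /=.
move: b0; rewrite !ler_norml; lra.
Qed.

(** The slope is a limit of [b N / N]. The value of [b] at [N M] is close both to [N (b M)] and to
    [M (b N)]; dividing by an [N] large compared with [M] leaves an error independent of [M]. *)
Lemma quasi_int (b : int -> R) D : (forall N M, `|b (N + M) - b N - b M| <= D) ->
  exists l, forall M : int, `|b M - M%:~R * l| <= 5 * D + 1.
Proof.
move=> H; have D0 : 0 <= D by apply: le_trans (H 0 0).
pose f (t : nat) := b t.+1 / t.+1%:R.
have [|l lP] := @rlim_ex _ f (`|b 1| + 4 * D).
  move=> t; rewrite /f normrM normfV normr_nat ler_pdivrMr ?ltr0n //.
  have := quasi_mul t.+1%:Z 1 H; rewrite mulr1.
  rewrite -pmulrn /=.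
  move=> h; have := ler_normD (b t.+1 - t.+1%:R * b 1) (t.+1%:R * b 1).
  rewrite subrK normrM normr_nat => h2.
  have t1 : 1 <= t.+1%:R :> R by rewrite ler1n.
  have : 3 * D <= 3 * D * t.+1%:R by rewrite ler_peMr //; lra.
  lra.
exists l => M; set m : R := (absz M)%:R.
have m0 : 0 <= m by [].
have Mm : `|M%:~R| = m :> R by rewrite /m [RHS]pmulrn abszE intr_norm.
have e0 : 0 < (m + 1)^-1 by rewrite invr_gt0; lra.
have [t [h1 h2]] := ev_ex (ev_and (lP _ e0) (ev_big (m + 3))).
pose N : R := t.+1%:R; have N1 : 1 <= N by rewrite /N ler1n.
have Nm : m + 3 <= N by rewrite /N -natr1; lra.
have bN : `|b t.+1 - N * l| <= N * (m + 1)^-1.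
  have -> : b t.+1 - N * l = N * (f t - l).
    by rewrite mulrBr /f mulrCA divff ?mulr1 // pnatr_eq0.
  by rewrite normrM (ger0_norm (_ : 0 <= N)) // ler_wpM2l // ltW.
have q1 := quasi_mul t.+1%:Z M H; have q2 := quasi_mul M t.+1%:Z H.
rewrite -/m -?pmulrn /= -/N in q1 q2.
rewrite [t.+1%:Z * M]mulrC in q1.
have q3 : `|M%:~R * (b t.+1 - N * l)| <= N.
  rewrite normrM Mm; apply: (le_trans (ler_wpM2l m0 bN)).
  rewrite mulrCA ger_pMr; [|lra]; rewrite ler_pdivrMr; lra.
rewrite -(ler_pM2l (x := N)); last lra.
have -> : N * `|b M - M%:~R * l| = `|N * (b M - M%:~R * l)|.
  by rewrite normrM ger0_norm //; lra.
(* The two defects are at most [4 N D] and [N D], and the error of the slope is at most [N]; this is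
   the origin of [5 D + 1]. *)
have a1 : (N + 3) * D <= 4 * N * D by apply: ler_wpM2r => //; lra.
have a2 : (m + 3) * D <= N * D by apply: ler_wpM2r.
move: q1 q2 q3; rewrite !ler_norml; lra.
Qed.

Lemma int_slope (b : int -> R) D D' l l' :
  (forall N : int, `|b N - N%:~R * l| <= D) ->
  (forall N : int, `|b N - N%:~R * l'| <= D') -> l = l'.
Proof.
move=> H H'; apply: contrapT => /eqP ll'.
have d0 : 0 < `|l - l'| by rewrite normr_gt0 subr_eq0.
pose n := Num.bound ((D + D') / `|l - l'|).
have DD : 0 <= D + D' by apply: addr_ge0; [apply: le_trans (H 0)|apply: le_trans (H' 0)].
have : (D + D') / `|l - l'| < n%:R by apply: archi_boundP; apply: divr_ge0.
rewrite ltr_pdivrMr // => h.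
have : `|n%:R * (l - l')| <= D + D'.
  have := H n; have := H' n; rewrite -pmulrn !ler_norml; lra.
rewrite normrM normr_nat; lra.
Qed.

Variable k : nat.

(** The bounded summand [r] absorbs rounding errors, since a sum of rounded vectors is not the
    rounding of the sum. *)
Definition quasi_additive_on (S : {vspace 'rV[R]_k}) (beta : 'rV[int]_k -> R) :=
  forall s s', s \in S -> s' \in S -> forall B, exists D, forall (N N' : int) r,
    box B r -> `|beta (fl (N%:~R *: s) + fl (N'%:~R *: s') + r)
                 - beta (fl (N%:~R *: s)) - beta (fl (N'%:~R *: s'))| <= D.

(** On each line [beta] is a quasimorphism of the integers and has a slope. Slopes are unique, so
    comparing two functions at bounded distance yields additivity and homogeneity. *)
Lemma homogenize (S : {vspace 'rV[R]_k}) beta : quasi_additive_on S beta ->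
  exists L : 'rV[R]_k -> R,
  [/\ forall s s', s \in S -> s' \in S -> L (s + s') = L s + L s',
      forall c s, s \in S -> L (c *: s) = c * L s
    & forall s, s \in S -> exists D, forall N : int,
        `|beta (fl (N%:~R *: s)) - N%:~R * L s| <= D].
Proof.
move=> H.
have slope s : exists l, s \in S -> exists D, forall N : int,
    `|beta (fl (N%:~R *: s)) - N%:~R * l| <= D.
  case: (boolP (s \in S)) => sS; last by exists 0.
  have [D DP] := H s s sS sS 2.
  have [|l lP] := @quasi_int (fun N => beta (fl (N%:~R *: s))) D.
    move=> N M; have := fl_add (N%:~R *: s) (M%:~R *: s).
    rewrite -scalerDl -intrD => /(DP N M).
    by rewrite [_ + (_ - _)]addrC subrK.
  by exists l => _; exists (5 * D + 1).
pose L s := projT1 (cid (slope s)).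
have LP s : s \in S -> exists D, forall N : int,
    `|beta (fl (N%:~R *: s)) - N%:~R * L s| <= D := projT2 (cid (slope s)).
exists L; split => //.
- move=> s s' sS s'S; have ss' : s + s' \in S by rewrite memvD.
  have [D1 P1] := LP _ ss'; have [D2 P2] := LP _ sS; have [D3 P3] := LP _ s'S.
  have [D DP] := H s s' sS s'S 2.
  apply: (int_slope P1 (D' := D + D2 + D3)) => N.
  have := fl_add (N%:~R *: s) (N%:~R *: s'); rewrite -scalerDr => /(DP N N).
  rewrite [_ + (_ - _)]addrC subrK; have := P2 N; have := P3 N.
  rewrite !ler_norml; lra.
- move=> c s sS; have cs : c *: s \in S by rewrite memvZ.
  have [D1 P1] := LP _ cs; have [D2 P2] := LP _ sS.
  have [B hB] := box_scale s; have [D DP] := H s 0 sS (mem0v _) B.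
  apply: (int_slope P1 (D' := D + `|beta 0| + D2 + `|L s|)) => N.
  have := DP (Num.floor (N%:~R * c)) 0 _ (hB c N).
  rewrite scale0r fl0 addr0 [_ + (_ - _)]addrC subrK.
  have := P2 (Num.floor (N%:~R * c)).
  have hf := floor_itv (N%:~R * c); rewrite intrD in hf.
  set f : R := (Num.floor _)%:~R in hf *.
  have h2 : `|(N%:~R * c - f) * L s| <= 1 * `|L s|.
    by rewrite normrM ler_wpM2r // ler_norml; lra.
  have := ler_norm (beta 0); have := ler_norm (- beta 0); rewrite normrN.
  move: h2; rewrite mulrBl [in X in _ -> _ -> _ -> _ -> X]mulrA !ler_norml; lra.
Qed.

End Quasi.

(** * Quotients by subspaces of matrices *)

Section ModSubspace.
Variables (R : realType) (d : nat).
Implicit Types (J V : {vspace 'M[R]_d}) (a b : 'M[R]_d).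

Definition resid J : 'End('M[R]_d) := (\1 - projv J)%VF.

Lemma residE J a : resid J a = a - projv J a.
Proof. by rewrite add_lfunE opp_lfunE id_lfunE. Qed.

(** A norm on the quotient by [J], which is identified with the complement chosen by [projv J]. *)
Definition dst J a : R := nrm (resid J a).

Lemma resid_linear J : linear (resid J).
Proof. by move=> c u v; rewrite linearP. Qed.

Lemma residD J a b : resid J (a + b) = resid J a + resid J b.
Proof. by rewrite linearD. Qed.

Lemma residZ J c a : resid J (c *: a) = c *: resid J a.
Proof. by rewrite linearZ. Qed.

Lemma residB J a b : resid J (a - b) = resid J a - resid J b.
Proof. by rewrite linearB. Qed.

Lemma resid_diff J a : a - resid J a \in J.
Proof. by rewrite residE opprB addrC subrK memv_proj. Qed.

Lemma resid_eq0 J a : (resid J a == 0) = (a \in J).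
Proof.
apply/eqP/idP => [h|aJ]; first by have := resid_diff J a; rewrite h subr0.
by rewrite residE projv_id // subrr.
Qed.

Lemma resid_mod J a b : a - b \in J -> resid J a = resid J b.
Proof. by rewrite -resid_eq0 residB subr_eq0 => /eqP. Qed.

Lemma resid_id J a : resid J (resid J a) = resid J a.
Proof. by apply/esym/resid_mod/resid_diff. Qed.

Lemma dst_ge0 J a : 0 <= dst J a. Proof. exact: nrm_ge0. Qed.

Lemma dst_eq0 J a : (dst J a == 0) = (a \in J).
Proof.
rewrite -resid_eq0 /dst; apply/eqP/eqP => [/nrm_eq0 //|->]; exact: nrm0.
Qed.

Lemma dst_gt0 J a : (0 < dst J a) = (a \notin J).
Proof. by rewrite lt_neqAle dst_ge0 andbT eq_sym dst_eq0. Qed.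

Lemma dstD J a b : dst J (a + b) <= dst J a + dst J b.
Proof. by rewrite /dst residD nrmD. Qed.

Lemma dstZ J c a : dst J (c *: a) = `|c| * dst J a.
Proof. by rewrite /dst residZ nrmZ. Qed.

Lemma dst_le J : exists2 c, 0 <= c & forall a, dst J a <= c * nrm a.
Proof. exact: nrm_linear (resid_linear J). Qed.

Lemma vspace_closed V (f : nat -> 'M[R]_d) L :
  mlim f L -> ev (fun t => f t \in V) -> L \in V.
Proof.
move=> fL H; rewrite -resid_eq0; apply/eqP.
apply: (@mlim_uniq _ _ _ (fun t => resid V (f t))).
  exact: mlim_lin (resid_linear V) fL.
apply: mlim_ev (mlim_cst 0); apply: ev_sub H => t.
by rewrite -resid_eq0 => /eqP.
Qed.

End ModSubspace.

(** * Commuting lattices in matrix algebras *)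

Section Ideals.
Variables (R : realType) (d k : nat) (A : {vspace 'M[R]_d}).
Variable phi : 'rV[int]_k -> 'M[R]_d.
Hypothesis A1 : 1%:M \in A.
Hypothesis AM : forall a b, a \in A -> b \in A -> a *m b \in A.
Hypothesis AC : forall a b, a \in A -> b \in A -> a *m b = b *m a.
Hypothesis phiA : forall z, phi z \in A.
Hypothesis phiD : forall x y, phi (x + y) = phi x *m phi y.
Hypothesis phi0 : phi 0 = 1%:M.

Definition ideal (J : {vspace 'M[R]_d}) :=
  (J <= A)%VS /\ forall a j, a \in A -> j \in J -> a *m j \in J.

Implicit Types J I : {vspace 'M[R]_d}.

Lemma idealA J j : ideal J -> j \in J -> j \in A.
Proof. by case=> /subvP H _ /H. Qed.

Lemma idealr J a j : ideal J -> a \in A -> j \in J -> j *m a \in J.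
Proof. by move=> iJ aA jJ; rewrite (AC (idealA iJ jJ) aA); apply: iJ.2. Qed.

Lemma residA J a : ideal J -> a \in A -> resid J a \in A.
Proof.
move=> iJ aA; rewrite -[resid J a](subKr a) memvB //.
by apply: (idealA iJ); apply: resid_diff.
Qed.

Lemma resid_sub J J1 a : (J <= J1)%VS -> a \in J1 -> resid J a \in J1.
Proof.
move=> /subvP sJ aJ; rewrite -[resid J a](subKr a) memvB //.
by apply: sJ; apply: resid_diff.
Qed.

Lemma residM J a b : ideal J -> a \in A -> b \in A ->
  resid J (a *m b) = resid J (resid J a *m resid J b).
Proof.
move=> iJ aA bA; apply: resid_mod.
have -> : a *m b - resid J a *m resid J b =
    a *m (b - resid J b) + (a - resid J a) *m resid J b.
  by rewrite mulmxBr mulmxBl addrA subrK.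
apply: memvD; first by apply: iJ.2 => //; apply: resid_diff.
by apply: idealr => //; [apply: residA|apply: resid_diff].
Qed.

Lemma dstM J : ideal J -> exists2 c, 0 <= c & forall a b, a \in A -> b \in A ->
  dst J (a *m b) <= c * (dst J a * dst J b).
Proof.
move=> iJ; have [c c0 H] := dst_le J; exists c => // a b aA bA.
rewrite /dst residM //; apply: le_trans (H _) _; rewrite ler_wpM2l //.
exact: nrmM.
Qed.

(* [phi] is only defined on integer points, hence the rounding *)
Definition bounded_dir J (s : 'rV[R]_k) :=
  exists c, forall N : int, dst J (phi (fl (N%:~R *: s))) <= c.

Lemma phiN z : phi z *m phi (- z) = 1%:M.
Proof. by rewrite -phiD subrr phi0. Qed.

Lemma phi_box J B : exists c, forall r, box B r -> dst J (phi r) <= c.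
Proof. exact: box_bound. Qed.

Lemma bounded_pair J s s' B : ideal J -> bounded_dir J s -> bounded_dir J s' ->
  exists c, forall (N N' : int) r, box B r ->
    dst J (phi (fl (N%:~R *: s) + fl (N'%:~R *: s') + r)) <= c.
Proof.
move=> iJ [c1 H1] [c2 H2]; have [c3 H3] := phi_box J B.
have [c c0 H] := dstM iJ; exists (c * (c * (c1 * c2) * c3)) => N N' r rB.
rewrite !phiD; apply: le_trans (H _ _ _ _) _; rewrite ?AM //.
apply: ler_wpM2l => //; apply: ler_pM; rewrite ?dst_ge0 //; last exact: H3.
apply: le_trans (H _ _ _ _) _ => //; apply: ler_wpM2l => //.
by apply: ler_pM; rewrite ?dst_ge0.
Qed.

(** [- fl (N s)] differs from [fl (- N s)] by a bounded vector, so the inverses are bounded too. *)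
Lemma bounded_opp J s B : ideal J -> bounded_dir J s ->
  exists c, forall (N : int) r, box B r -> dst J (phi (- fl (N%:~R *: s) + r)) <= c.
Proof.
move=> iJ bs; have [c H] := bounded_pair (B + 2) iJ bs bs.
exists c => N r rB; have := fl_add (N%:~R *: s) ((- N)%:~R *: s).
rewrite -scalerDl -intrD subrr scale0r fl0 sub0r => b2.
pose t := - (fl (N%:~R *: s) + fl ((- N)%:~R *: s)) + r.
have bt : box (B + 2) t.
  move=> i; rewrite mxE; apply: le_trans (ler_normD _ _) _.
  by rewrite PoszD addrC lerD.
have -> : - fl (N%:~R *: s) + r = fl (0%:~R *: s) + fl ((- N)%:~R *: s) + t.
  by rewrite scale0r fl0 add0r /t opprD addrA addrCA subrr addr0.
exact: H.
Qed.

Definition minimal_over J J1 := [/\ ideal J1, (J <= J1)%VS, J1 != J &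
  forall I, ideal I -> (J <= I)%VS -> (I <= J1)%VS -> I <> J -> I = J1].

Lemma minimal_over_ex J I0 : ideal J -> ideal I0 -> (J <= I0)%VS -> I0 != J ->
  exists2 J1, minimal_over J J1 & (J1 <= I0)%VS.
Proof.
move=> iJ iI0 s0 n0.
pose P I := [/\ ideal I, (J <= I)%VS, (I <= I0)%VS & I != J].
have P0 : P I0 by split.
have [J1 [iJ1 s1 s2 n1] Hmin] := vspace_min P0.
exists J1 => //; split => // I iI JI IJ1 nI.
apply/eqP; rewrite eqEdim IJ1 /=; apply: Hmin; split => //; last exact/eqP.
exact: subv_trans IJ1 s2.
Qed.

Lemma ideal_add J u : ideal J -> u \in A -> forall J1, ideal J1 ->
  ideal (linfun (mulmx u) @: J1 + J)%VS.
Proof.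
move=> iJ uA J1 iJ1; split.
  rewrite subv_add iJ.1 andbT; apply/subvP => _ /memv_imgP[w wJ ->].
  by rewrite lfunE /= AM // (idealA iJ1).
move=> a _ aA /memv_addP[_ /memv_imgP[w wJ ->] [j jJ ->]].
rewrite lfunE /= mulmxDr mulmxA (AC aA uA) -mulmxA; apply: memv_add.
  have := memv_img (linfun (mulmx u)) (iJ1.2 _ _ aA wJ); by rewrite lfunE.
exact: iJ.2.
Qed.

Lemma addP J u J1 v : v \in (linfun (mulmx u) @: J1 + J)%VS ->
  exists w j, [/\ w \in J1, j \in J & v = u *m w + j].
Proof.
by move=> /memv_addP[_ /memv_imgP[w wJ ->] [j jJ ->]]; exists w, j; rewrite lfunE.
Qed.

Lemma add_mem J u J1 w : w \in J1 -> u *m w \in (linfun (mulmx u) @: J1 + J)%VS.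
Proof.
move=> wJ; rewrite -[u *m w]addr0 memv_add ?mem0v //.
by have := memv_img (linfun (mulmx u)) wJ; rewrite lfunE.
Qed.

(** By minimality, multiplication by [b] is onto [J1 / J]. An [e] with [b e = b] modulo [J] is then
    neutral on every multiple of [b], that is on all of [J1 / J]. *)
Lemma minimal_unit J J1 b j : ideal J -> minimal_over J J1 ->
  b \in J1 -> j \in J1 -> b *m j \notin J ->
  exists2 e, e \in J1 & forall m, m \in J1 -> e *m m - m \in J.
Proof.
move=> iJ [iJ1 s1 n1 H] bJ jJ bj.
pose I := (linfun (mulmx b) @: J1 + J)%VS.
have bA := idealA iJ1 bJ.
have IE : I = J1.
  apply: H; [exact: ideal_add|exact: addvSr| |].
    rewrite subv_add s1 andbT; apply/subvP => _ /memv_imgP[w wJ ->].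
    by rewrite lfunE /=; apply: iJ1.2.
  by move=> h; move: bj; rewrite -h add_mem.
have := bJ; rewrite -{1}IE => /addP[e [j0 [eJ j0J be]]].
exists e => // m; rewrite -{1}IE => /addP[m' [j1 [m'J j1J ->]]].
have eA := idealA iJ1 eJ; have m'A := idealA iJ1 m'J.
rewrite mulmxDr opprD addrACA memvD //; last first.
  by rewrite memvB //; apply: iJ.2.
rewrite mulmxA (AC eA bA) -mulmxBl.
have -> : b *m e - b = - j0 by rewrite [X in _ - X]be opprD addrA subrr sub0r.
by apply: idealr => //; rewrite memvN.
Qed.

(** Modulo [J] the element [u] generates [J1], so the unit is a multiple of [u], and multiplying it
    by [v] gives a multiple of [u v]. *)
Lemma minimal_domain J J1 e u v : ideal J -> minimal_over J J1 ->
  e \in J1 -> (forall m, m \in J1 -> e *m m - m \in J) ->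
  u \in J1 -> v \in J1 -> u *m v \in J -> u \notin J -> v \in J.
Proof.
move=> iJ [iJ1 s1 n1 H] eJ eP uJ vJ uv uN.
have uA := idealA iJ1 uJ; have vA := idealA iJ1 vJ.
have iA : ideal A by split; [exact: subvv|move=> a j; apply: AM].
have IE : (linfun (mulmx u) @: A + J)%VS = J1.
  apply: H; [exact: ideal_add|exact: addvSr| |].
    rewrite subv_add s1 andbT; apply/subvP => _ /memv_imgP[w wJ ->].
    by rewrite lfunE /=; apply: idealr.
  by move=> h; move: uN; rewrite -h -[u in u \in _]mulmx1 add_mem.
move: (eJ); rewrite -{1}IE => /addP[a [j [aA jJ ee]]].
rewrite -[v](subKr (e *m v)) memvB ?eP // ee mulmxDl memvD //; last exact: idealr.
by rewrite -mulmxA (AC aA vA) mulmxA idealr.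
Qed.

(* [J1 / J] is a field, so its norm is multiplicative up to a constant *)
Lemma minimal_conformal J J1 e : ideal J -> minimal_over J J1 ->
  e \in J1 -> (forall m, m \in J1 -> e *m m - m \in J) ->
  exists2 c, 0 < c & forall u v, u \in J1 -> v \in J1 ->
    c * (dst J u * dst J v) <= dst J (u *m v).
Proof.
move=> iJ mJ eJ eP; have [iJ1 s1 n1 Hm] := mJ.
apply: contrapT => H.
(* If no constant worked, normalized pairs with ever smaller products would have limits outside [J]
   whose product lies in [J], against the absence of zero divisors. *)
have K (n : nat) : exists p : 'M[R]_d * 'M[R]_d, [/\ p.1 \in J1, p.2 \in J1,
   resid J p.1 = p.1, resid J p.2 = p.2 &
   nrm p.1 = 1 /\ nrm p.2 = 1 /\ dst J (p.1 *m p.2) <= 1 * n.+1%:R^-1].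
  apply: contrapT => h; apply: H; exists n.+1%:R^-1; first by rewrite invr_gt0.
  move=> u v uJ vJ; rewrite leNgt; apply/negP => h2; apply: h.
  have uA := idealA iJ1 uJ; have vA := idealA iJ1 vJ.
  have u0 : 0 < dst J u.
    rewrite lt_neqAle dst_ge0 andbT eq_sym; apply/negP => /eqP h0.
    by move: h2; rewrite h0 mul0r mulr0 ltNge dst_ge0.
  have v0 : 0 < dst J v.
    rewrite lt_neqAle dst_ge0 andbT eq_sym; apply/negP => /eqP h0.
    by move: h2; rewrite h0 mulr0 mulr0 ltNge dst_ge0.
  exists ((dst J u)^-1 *: resid J u, (dst J v)^-1 *: resid J v) => /=.
  split; rewrite ?memvZ ?resid_sub // ?residZ ?resid_id //; split; last split.
  - by rewrite nrmZ normfV ger0_norm ?dst_ge0 // mulVf // gt_eqF.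
  - by rewrite nrmZ normfV ger0_norm ?dst_ge0 // mulVf // gt_eqF.
  rewrite -scalemxAl -scalemxAr scalerA dstZ.
  have -> : dst J (resid J u *m resid J v) = dst J (u *m v) by rewrite /dst -residM.
  rewrite ger0_norm ?mulr_ge0 ?invr_ge0 ?dst_ge0 // mul1r -invfM.
  by rewrite ler_pdivrMl ?mulr_gt0 // mulrC; apply: ltW.
pose u n := (projT1 (cid (K n))).1; pose v n := (projT1 (cid (K n))).2.
have P n := projT2 (cid (K n)).
have [|U UL] := @mlim_ex _ _ _ u 1; first by move=> n; have [_ _ _ _ [->]] := P n.
have [|V VL] := @mlim_ex _ _ _ v 1; first by move=> n; have [_ _ _ _ [_ [->]]] := P n.
have U1 : 1 <= nrm U.
  by apply: (mlim_lbnd UL); apply: ev_true => n; have [_ _ _ _ [->]] := P n.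
have V1 : 1 <= nrm V.
  by apply: (mlim_lbnd VL); apply: ev_true => n; have [_ _ _ _ [_ [->]]] := P n.
have UJ : U \in J1 by apply: (vspace_closed UL); apply: ev_true => n; have [] := P n.
have VJ : V \in J1 by apply: (vspace_closed VL); apply: ev_true => n; have [] := P n.
have Ur : resid J U = U.
  apply: (mlim_uniq _ UL); apply: mlim_ev (mlim_lin (resid_linear J) UL).
  by apply: ev_true => n; have [] := P n.
have Vr : resid J V = V.
  apply: (mlim_uniq _ VL); apply: mlim_ev (mlim_lin (resid_linear J) VL).
  by apply: ev_true => n; have [] := P n.
have UV : U *m V \in J.
  rewrite -resid_eq0; apply/eqP.
  apply: (mlim_uniq (mlim_lin (resid_linear J) (mlimM UL VL))).
  apply: (@mlim_small _ _ _ _ 1) => //; apply: ev_true => n.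
  by have [_ _ _ _ [_ [_]]] := P n.
have UnJ : U \notin J.
  by rewrite -resid_eq0 Ur; apply/eqP => h; move: U1; rewrite h nrm0; lra.
have := minimal_domain iJ mJ eJ eP UJ VJ UV UnJ.
by rewrite -resid_eq0 Vr => /eqP h; move: V1; rewrite h nrm0; lra.
Qed.

End Ideals.

Lemma mx_defect (R : comRingType) m n (o x y z p q : 'M[R]_(m, n)) :
  x - y - z - q = o - z - (y - p) - (o - x) - q - p.
Proof.
by apply/matrixP => i j; rewrite !mxE; ring.
Qed.

(** * Directions in which a lattice is bounded modulo an ideal *)

Section Directions.
Variables (R : realType) (d k : nat) (A : {vspace 'M[R]_d}).
Variable phi : 'rV[int]_k -> 'M[R]_d.
Hypothesis A1 : 1%:M \in A.
Hypothesis AM : forall a b, a \in A -> b \in A -> a *m b \in A.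
Hypothesis AC : forall a b, a \in A -> b \in A -> a *m b = b *m a.
Hypothesis phiA : forall z, phi z \in A.
Hypothesis phiD : forall x y, phi (x + y) = phi x *m phi y.
Hypothesis phi0 : phi 0 = 1%:M.
Implicit Types J I : {vspace 'M[R]_d}.
Implicit Types S : {vspace 'rV[R]_k}.
Local Notation ideal := (ideal A).
Local Notation minimal_over := (minimal_over A).
Local Notation bounded_dir := (bounded_dir phi).

(** The logarithm of [dst J (e *m phi z)] is a quasimorphism, the norm of the field [J1 / J] being
    multiplicative up to constants. Its slope is a single linear form, and where it vanishes the
    component of [phi] along [e] stays bounded. *)
Lemma step_field J J1 S b j : ideal J -> minimal_over J J1 ->
  b \in J1 -> j \in J1 -> b *m j \notin J ->
  (forall s, s \in S -> bounded_dir J1 s) ->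
  exists S', [/\ (S' <= S)%VS, (\dim S <= \dim S' + 1)%N &
    forall s, s \in S' -> bounded_dir J s].
Proof.
move=> iJ mJ bJ jJ bj HS; have [iJ1 s1 n1 Hm] := mJ.
have [e eJ eP] := minimal_unit AM AC iJ mJ bJ jJ bj.
have [c c0 conf] := minimal_conformal A1 AM AC iJ mJ eJ eP.
have [kp kp0 Hk] := dstM AC iJ.
have eA := idealA iJ1 eJ.
have eN : e \notin J.
  apply/negP => h; move: bj; have := eP b bJ => hb.
  have bJ' : b \in J.
    by rewrite -[b](subKr (e *m b)) memvB // (idealr AC iJ (idealA iJ1 bJ)).
  by rewrite (idealr AC iJ (idealA iJ1 jJ)).
have ephi z : e *m phi z \in J1 by rewrite (idealr AC iJ1 (phiA z)).
have pos z : 0 < dst J (e *m phi z).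
  rewrite dst_gt0; apply: contra eN => h.
  by rewrite -[e]mulmx1 -(phiN phiD phi0 z) mulmxA (idealr AC iJ (phiA _)).
have epp z z' : dst J (e *m phi (z + z')) = dst J ((e *m phi z) *m (e *m phi z')).
  rewrite /dst phiD; congr nrm; apply: resid_mod.
  rewrite -memvN opprB -mulmxA (mulmxA (phi z)) (AC (phiA z) eA) !mulmxA.
  by rewrite -!mulmxA eP // mulmxA (idealr AC iJ1 (phiA _)).
pose beta z := ln (dst J (e *m phi z)).
have kpp : 0 < kp.
  rewrite lt_neqAle kp0 andbT; apply/eqP => h.
  have := Hk _ _ eA (phiA 0); rewrite -h mul0r leNgt => /negP; apply.
  by apply: pos.
pose D0 := `|ln c| + `|ln kp|.
have q z z' : `|beta (z + z') - beta z - beta z'| <= D0.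
  have h1 := conf _ _ (ephi z) (ephi z'); rewrite -epp in h1.
  have h2 := Hk _ _ (idealA iJ1 (ephi z)) (idealA iJ1 (ephi z')); rewrite -epp in h2.
  have p1 := mulr_gt0 (pos z) (pos z').
  have h3 : ln c + (beta z + beta z') <= beta (z + z').
    by rewrite /beta -lnM ?posrE // -lnM ?posrE // ler_ln ?posrE // mulr_gt0.
  have h4 : beta (z + z') <= ln kp + (beta z + beta z').
    by rewrite /beta -lnM ?posrE // -lnM ?posrE // ler_ln ?posrE // mulr_gt0.
  have := ler_norm (- ln c); have := ler_norm (ln kp); rewrite normrN.
  have := normr_ge0 (ln c); have := normr_ge0 (ln kp).
  by rewrite ler_norml /D0; lra.
have QA : quasi_additive_on S beta.
  move=> s s' _ _ B; have [E HE] := box_bound (fun r => `|beta r|) B.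
  exists (D0 + D0 + E) => N N' r /HE.
  have := q (fl (N%:~R *: s) + fl (N'%:~R *: s')) r.
  have := q (fl (N%:~R *: s)) (fl (N'%:~R *: s')).
  by rewrite !ler_norml; lra.
have [L [LD LZ LB]] := homogenize QA.
have [S' [S'S dS KS]] := kernel_on LD LZ.
exists S'; split => // s sS'.
have sS : s \in S by move/subvP: S'S; apply.
have [D HD] := LB s sS; have [w Hw] := HS s sS.
have [kJ kJ0 HJ] := dst_le J.
exists (expR D + kJ * (nrm (1%:M - e) * w)) => N.
set z := fl _.
(* The component along [1 - e] is bounded by hypothesis: [1 - e] sends [J1] into [J], so only the
   class of [phi z] modulo [J1] matters. *)
have -> : phi z = e *m phi z + (1%:M - e) *m phi z.
  by rewrite mulmxBl mul1mx addrC subrK.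
apply: le_trans (dstD _ _ _) _; apply: lerD.
  have := HD N; rewrite KS // mulr0 subr0 -/z => h.
  by rewrite -[leLHS]lnK ?posrE // ler_expR (le_trans (ler_norm _)).
have -> : dst J ((1%:M - e) *m phi z) = dst J ((1%:M - e) *m resid J1 (phi z)).
  rewrite /dst; congr nrm; apply: resid_mod; rewrite -mulmxBr mulmxBl mul1mx.
  by rewrite -memvN opprB eP // resid_diff.
apply: le_trans (HJ _) _; apply: ler_wpM2l => //.
apply: le_trans (nrmM _ _) _; apply: ler_wpM2l; first exact: nrm_ge0.
exact: Hw.
Qed.

(** Write [phi z] as [w z], bounded along [S], plus [jj z] in [J1]. Since [J1] has square zero
    modulo [J], the map [be z = phi (- z) *m jj z] turns products into sums modulo [J] up to a
    bounded error, so it is governed by as many linear forms as [J1 / J] has dimensions. *)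
Lemma step_nil J J1 S : ideal J -> ideal J1 -> (J <= J1)%VS ->
  (forall b j, b \in J1 -> j \in J1 -> b *m j \in J) ->
  (forall s, s \in S -> bounded_dir J1 s) ->
  exists S', [/\ (S' <= S)%VS, (\dim S <= \dim S' + (\dim J1 - \dim J))%N &
    forall s, s \in S' -> bounded_dir J s].
Proof.
move=> iJ iJ1 s1 nil HS; have [kp kp0 Hk] := dstM AC iJ.
have [kJ kJ0 HJ] := dst_le J.
pose w z := resid J1 (phi z); pose jj z := phi z - w z.
have wA z : w z \in A by apply: (residA iJ1).
have jJ z : jj z \in J1 by apply: resid_diff.
pose be z := phi (- z) *m jj z.
have beJ z : be z \in J1 by apply: iJ1.2.
have phiNl z : phi (- z) *m phi z = 1%:M by rewrite -phiD addNr phi0.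
have beE z : be z = 1%:M - phi (- z) *m w z by rewrite /be mulmxBr phiNl.
pose T := (resid J @: J1)%VS.
have dT : \dim T = (\dim J1 - \dim J)%N.
  have := limg_ker_dim (resid J) J1; rewrite -/T => <-.
  suff -> : (J1 :&: lker (resid J))%VS = J by rewrite addKn.
  apply/vspaceP => v; rewrite memv_cap memv_ker resid_eq0.
  by apply: andb_idl; move/subvP: s1; apply.
pose bt i z : R := coord (vbasis T) i (resid J (be z)).
have TB z : resid J (be z) \in T by apply: memv_img.
(* additivity defect of [be] modulo [J], bounded because [J1] acts trivially on itself *)
have defect s s' B : s \in S -> s' \in S -> exists D, forall (N N' : int) r, box B r ->
    dst J (be (fl (N%:~R *: s) + fl (N'%:~R *: s') + r)
           - be (fl (N%:~R *: s)) - be (fl (N'%:~R *: s'))) <= D.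
  move=> sS s'S; have [c1 H1] := HS s sS; have [c2 H2] := HS s' s'S.
  have [c3 H3] := box_bound (fun r => nrm (phi r)) B.
  have [c4 H4] := bounded_pair AM AC phiA phiD B iJ1 (HS s sS) (HS s' s'S).
  have [c5 H5] : exists c, forall (N N' : int) r, box B r ->
      dst J1 (phi (- (fl (N%:~R *: s) + fl (N'%:~R *: s') + r))) <= c.
    have [a Ha] := bounded_opp AM AC phiA phiD 0 iJ1 (HS s sS).
    have [b Hb] := bounded_opp AM AC phiA phiD 0 iJ1 (HS s' s'S).
    have [c Hc] := phi_box phi J1 B; have [kk k0 HH] := dstM AC iJ1.
    exists (kk * (kk * (a * b) * c)) => N N' r rB.
    rewrite !opprD phiD phiD; apply: le_trans (HH _ _ _ _) _; rewrite ?AM //.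
    apply: ler_wpM2l => //; apply: ler_pM; rewrite ?dst_ge0 //; last first.
      by apply: Hc => i; rewrite mxE normrN.
    apply: le_trans (HH _ _ _ _) _ => //; apply: ler_wpM2l => //.
    apply: ler_pM; rewrite ?dst_ge0 //.
      by have := Ha N 0; rewrite addr0; apply => i; rewrite mxE.
    by have := Hb N' 0; rewrite addr0; apply => i; rewrite mxE.
  exists (kJ * (c5 * (c1 * c2 * c3 + c4))) => N N' r rB.
  set z := fl (N%:~R *: s); set z' := fl (N'%:~R *: s'); set z2 := z + z' + r.
  pose g := w z *m w z' *m phi r - w z2.
  have gJ : g \in J1.
    rewrite -resid_eq0 /g linearB subr_eq0 /= {2}/w resid_id; apply/eqP.
    apply: resid_mod; rewrite -(subrK (phi z *m phi z' *m phi r) (w z *m _ *m _)) -addrA.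
    rewrite [phi z2]phiD [phi (z + z')]phiD subrr addr0.
    rewrite -mulmxBl; apply: (idealr AC iJ1) => //.
    have -> : w z *m w z' - phi z *m phi z' = - (w z *m jj z' + jj z *m phi z').
      by rewrite /jj mulmxBr mulmxBl opprD !opprB addrA subrK.
    rewrite memvN memvD //; first exact: iJ1.2.
    exact: (idealr AC iJ1).
  (* [1 - be z] equals [phi (- z) *m w z], so its failure to be multiplicative is [phi (- z2) *m g]
     with [g] in [J1]. Products of two elements of [J1] drop out modulo [J], which also allows
     [phi (- z2)] to be replaced by its bounded residue. *)
  have E : be z2 - be z - be z' - resid J1 (phi (- z2)) *m g \in J.
    have P1 : be z *m be z' \in J by apply: nil.
    have P2 : (phi (- z2) - resid J1 (phi (- z2))) *m g \in J.
      by apply: nil => //; apply: resid_diff.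
    have -> : be z2 - be z - be z' - resid J1 (phi (- z2)) *m g =
       (phi (- z2) - resid J1 (phi (- z2))) *m g - be z *m be z'.
      have hh : phi (- z2) *m g = (1%:M - be z) *m (1%:M - be z') - (1%:M - be z2).
        rewrite !beE !subKr /g mulmxBr; congr (_ - _).
        rewrite (AC (AM (wA z) (wA z')) (phiA r)) (mulmxA (phi (- z2))) -phiD.
        have -> : - z2 + r = - z - z' by rewrite /z2 [in LHS]opprD addrNK opprD.
        by rewrite phiD -!mulmxA; congr (_ *m _); rewrite !mulmxA (AC (phiA _) (wA z)).
      rewrite mulmxBl hh (mulmxBl 1%:M) mul1mx (mulmxBr (be z)) mulmx1; apply: mx_defect.
    by rewrite memvB.
  rewrite /dst (resid_mod E) -/(dst _ _); apply: le_trans (HJ _) _.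
  apply: ler_wpM2l => //; apply: le_trans (nrmM _ _) _.
  apply: ler_pM; rewrite ?nrm_ge0 ?H5 //.
  rewrite /g; apply: le_trans (nrmB _ _) _; apply: lerD; last exact: H4.
  apply: le_trans (nrmM _ _) _; apply: ler_pM; rewrite ?nrm_ge0 ?H3 //.
  by apply: le_trans (nrmM _ _) _; apply: ler_pM; rewrite ?nrm_ge0 ?H1 ?H2.
have cb i : exists2 c, 0 <= c & forall m, `|coord (vbasis T) i m| <= c * nrm m.
  pose f (m : 'M[R]_d) : 'M[R]_1 := (coord (vbasis T) i m)%:M.
  have fl : linear f by move=> c u v; rewrite /f linearP /= raddfD /= scale_scalar_mx.
  have [c c0 H] := nrm_linear fl; exists c => // m; apply: le_trans (H m).
  by have := entry_le_nrm (f m) 0 0; rewrite mxE eqxx mulr1n.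
have QA i : quasi_additive_on S (bt i).
  move=> s s' sS s'S B; have [D HD] := defect s s' B sS s'S; have [c c0 Hc] := cb i.
  exists (c * D) => N N' r rB; rewrite /bt -!linearB /=.
  by apply: le_trans (Hc _) _; rewrite ler_wpM2l //; apply: HD.
pose L i := projT1 (cid (homogenize (QA i))).
have LP i := projT2 (cid (homogenize (QA i))).
have [||S' [S'S dS KS]] := @kernels_on R _ S _ L.
- by move=> i; have [h _ _] := LP i.
- by move=> i; have [_ h _] := LP i.
exists S'; split => //; first by rewrite -dT.
move=> s sS'; have sS : s \in S by move/subvP: S'S; apply.
have LB i : exists D, forall N : int, `|bt i (fl (N%:~R *: s))| <= D.
  have [_ _ /(_ s sS)[D HD]] := LP i; exists D => N.
  by have := HD N; rewrite [projT1 _ _]KS // mulr0 subr0.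
pose D i := projT1 (cid (LB i)); have DP i := projT2 (cid (LB i)).
pose bb := \sum_i D i * nrm (vbasis T)`_i.
have beB N : dst J (be (fl (N%:~R *: s))) <= bb.
  rewrite /dst (coord_vbasis (TB _)); apply: le_trans (nrm_sum _ _) _.
  by apply: ler_sum => i _; rewrite nrmZ ler_wpM2r ?nrm_ge0 //; apply: DP.
have [c Hc] := HS s sS.
exists (kJ * c + kp * (kJ * c * bb)) => N; set z := fl _.
have wB : dst J (w z) <= kJ * c by apply: le_trans (HJ _) _; rewrite ler_wpM2l //; apply: Hc.
have -> : phi z = w z + jj z by rewrite addrC subrK.
(* [jj z] is [phi z *m be z]; replacing [phi z] by [w z] changes this by a product of two elements
   of [J1]. *)
have -> : dst J (w z + jj z) = dst J (w z + w z *m be z).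
  rewrite /dst; congr nrm; apply: resid_mod; rewrite opprD addrACA subrr add0r.
  rewrite /be mulmxA.
  rewrite -{1}[jj z]mul1mx -(phiN phiD phi0 z) -!mulmxBl.
  by apply: nil => //; apply: (idealr AC iJ1) => //; exact: jJ.
apply: le_trans (dstD _ _ _) _; apply: lerD => //.
apply: le_trans (Hk _ _ _ _) _ => //; first exact: (idealA iJ1).
apply: ler_wpM2l => //; apply: ler_pM; rewrite ?dst_ge0 //; exact: beB.
Qed.

(** Modulo [A] every direction is bounded, and each step down to a smaller ideal loses at most the
    drop in dimension. *)
Lemma bounded_directions J : ideal J ->
  exists S, (k <= \dim S + (\dim A - \dim J))%N /\ forall s, s \in S -> bounded_dir J s.
Proof.
have iA : ideal A by split; [exact: subvv|move=> a j; apply: AM].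
move: {2}(\dim A - \dim J)%N (leqnn (\dim A - \dim J)) => n.
elim: n J => [|n IH] J hn iJ.
  have JA : J = A by apply/eqP; rewrite eqEdim iJ.1 -subn_eq0 -leqn0.
  exists fullv; split; first by rewrite dimvf /dim /= mul1n leq_addr.
  by move=> s _; exists 0 => N; rewrite JA le_eqVlt dst_eq0 phiA.
have [->|nJ] := eqVneq J A.
  exists fullv; split; first by rewrite dimvf /dim /= mul1n leq_addr.
  by move=> s _; exists 0 => N; rewrite le_eqVlt dst_eq0 phiA.
have [J1 mJ _] := minimal_over_ex iJ iA iJ.1 (contra_neq (@esym _ _ _) nJ).
have [iJ1 s1 n1 _] := mJ.
have dlt : (\dim J < \dim J1)%N.
  by rewrite ltnNge; apply: contra n1 => h; rewrite eq_sym eqEdim s1.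
have d1 := dimvS iJ1.1; have d2 := dimvS s1.
have [|S1 [k1 H1]] := IH J1 _ iJ1; first by lia.
have [nil|nn] := pselect (forall b j, b \in J1 -> j \in J1 -> b *m j \in J).
  have [S2 [k2 k3 k4]] := step_nil iJ iJ1 s1 nil H1.
  by exists S2; split => //; lia.
have [b [j [bJ jJ bj]]] : exists b j, [/\ b \in J1, j \in J1 & b *m j \notin J].
  apply: contrapT => h; apply: nn => b j bJ jJ; apply: contrapT => /negP bj.
  by apply: h; exists b, j.
have [S2 [k2 k3 k4]] := step_field iJ mJ bJ jJ bj H1.
by exists S2; split => //; lia.
Qed.

End Directions.

(** * Lattices acting properly on cones *)

Section Cones.
Variables (R : realType) (d : nat).
Implicit Types (K : 'rV[R]_d -> Prop) (u v w x y : 'rV[R]_d).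

(* closure of a convex open cone *)
Definition cl K v := forall z, K z -> K (v + z).

Definition salient_cone K :=
  [/\ forall x y, K x -> K y -> K (x + y),
      forall c x, 0 < c -> K x -> K (c *: x),
      forall x, K x -> exists2 e, 0 < e & forall w, nrm (w - x) < e -> K w
    & forall v, cl K v -> cl K (- v) -> v = 0].

Variable K : 'rV[R]_d -> Prop.
Hypothesis cK : salient_cone K.

Lemma cone_add x y : K x -> K y -> K (x + y). Proof. by case: cK => H _ _ _; apply: H. Qed.
Lemma cone_scale c x : 0 < c -> K x -> K (c *: x). Proof. by case: cK => _ H _ _; apply: H. Qed.
Lemma cone_open x : K x -> exists2 e, 0 < e & forall w, nrm (w - x) < e -> K w.
Proof. by case: cK => _ _ H _; apply: H. Qed.
Lemma cone_salient v : cl K v -> cl K (- v) -> v = 0.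
Proof. by case: cK => _ _ _ H; apply: H. Qed.

Lemma cl_cone x : K x -> cl K x.
Proof. by move=> Kx z Kz; apply: cone_add. Qed.

Lemma cl0 : cl K 0. Proof. by move=> z; rewrite add0r. Qed.

Lemma cl_add u v : cl K u -> cl K v -> cl K (u + v).
Proof. by move=> hu hv z Kz; rewrite -addrA; apply/hu/hv. Qed.

Lemma cl_scale c v : 0 <= c -> cl K v -> cl K (c *: v).
Proof.
rewrite le_eqVlt => /predU1P[<-|c0] hv; first by rewrite scale0r; apply: cl0.
move=> z Kz; have -> : c *: v + z = c *: (v + c^-1 *: z).
  by rewrite scalerDr scalerA divff ?scale1r // gt_eqF.
by apply: cone_scale => //; apply: hv; apply: cone_scale => //; rewrite invr_gt0.
Qed.

Lemma cl_lim (f : nat -> 'rV[R]_d) v : mlim f v -> ev (fun t => cl K (f t)) -> cl K v.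
Proof.
move=> fv H z Kz; have [e e0 he] := cone_open Kz.
have [t [h1 h2]] := ev_ex (ev_and (fv _ e0) H).
have -> : v + z = f t + (z + (v - f t)) by rewrite addrCA (addrC (f t)) subrK addrC.
by apply: h2; apply: he; rewrite addrC addKr nrmC.
Qed.

Lemma order_unit x : K x -> exists2 c, 0 < c &
  forall v m, 0 < m -> nrm v <= m -> K ((c * m) *: x - v).
Proof.
move=> Kx; have [e e0 he] := cone_open Kx; exists (2 / e); first exact: divr_gt0.
move=> v m m0 vm; have cm : 0 < 2 / e * m by rewrite mulr_gt0 ?divr_gt0.
have -> : (2 / e * m) *: x - v = (2 / e * m) *: (x - (2 / e * m)^-1 *: v).
  by rewrite scalerBr scalerA divff ?scale1r // gt_eqF.
apply: cone_scale => //; apply: he; rewrite addrC addKr nrmN nrmZ.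
rewrite gtr0_norm ?invr_gt0 // mulrC ltr_pdivrMr // mulrA mulrCA divff ?gt_eqF //.
by rewrite mulr1; lra.
Qed.

End Cones.

(** * Discrete abelian groups of maximal rank *)

Section DiscreteAbelian.
Variables (R : realType) (d k : nat) (A : {vspace 'M[R]_d}).
Variable phi : 'rV[int]_k -> 'M[R]_d.
Hypothesis A1 : 1%:M \in A.
Hypothesis AM : forall a b, a \in A -> b \in A -> a *m b \in A.
Hypothesis AC : forall a b, a \in A -> b \in A -> a *m b = b *m a.
Hypothesis phiA : forall z, phi z \in A.
Hypothesis phiD : forall x y, phi (x + y) = phi x *m phi y.
Hypothesis phi0 : phi 0 = 1%:M.
Variables (K : 'rV[R]_d -> Prop) (x : 'rV[R]_d).
Hypothesis cK : salient_cone K.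
Hypothesis Kx : K x.
Hypothesis Kphi : forall z v, K v -> K (v *m phi z).
Hypothesis proper : forall l, finite_pred (fun z =>
  K (l *: x - x *m phi z) /\ K (l *: (x *m phi z) - x)).
Hypothesis cyclic : forall v, exists2 a, a \in A & v = x *m a.

Local Notation ideal := (ideal A).
Local Notation bounded_dir := (bounded_dir phi).

Let phiNr z : phi z *m phi (- z) = 1%:M. Proof. exact: phiN. Qed.
Let phiNl z : phi (- z) *m phi z = 1%:M. Proof. by rewrite -phiD addNr. Qed.

Lemma cl_phi z v : cl K v -> cl K (v *m phi z).
Proof.
move=> hv y Ky; have -> : v *m phi z + y = (v + y *m phi (- z)) *m phi z.
  by rewrite mulmxDl -mulmxA phiNl mulmx1.
by apply: Kphi; apply: hv; apply: Kphi.
Qed.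

(** Every vector is [x *m b] with [b] commuting with [a], so [a] kills all vectors once it kills
    [x]. *)
Lemma eval_inj a : a \in A -> x *m a = 0 -> a = 0.
Proof.
move=> aA xa; apply/row_matrixP => i; rewrite row0 rowE.
have [b bA ->] := cyclic (delta_mx 0 i).
by rewrite -mulmxA (AC bA aA) mulmxA xa mul0mx.
Qed.

Lemma ideal0 : ideal 0%VS.
Proof.
split; first exact: sub0v.
by move=> a j _; rewrite memv0 => /eqP ->; rewrite mulmx0 mem0v.
Qed.

Lemma dst0 (a : 'M[R]_d) : dst 0%VS a = nrm a.
Proof.
by rewrite /dst residE; have := memv_proj 0%VS a; rewrite memv0 => /eqP ->; rewrite subr0.
Qed.

(** Along a bounded direction both [phi z] and its inverse are bounded, so properness leaves
    finitely many roundings of multiples of [s]; but these are unbounded. *)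
Lemma no_bounded_dir s : s != 0 -> ~ bounded_dir 0%VS s.
Proof.
move=> s0 bs; have [c Hc] := bs.
have [c' Hc'] := bounded_opp AM AC phiA phiD 0 ideal0 bs.
have [u u0 Hu] := order_unit cK Kx.
pose m := `|nrm x * c| + `|nrm x * c'| + 1.
have m0 : 0 < m.
  by have := normr_ge0 (nrm x * c); have := normr_ge0 (nrm x * c'); rewrite /m; lra.
have [l lP] := proper (u * m).
have zl N : fl (N%:~R *: s) \in l.
  set z := fl _; apply: lP; split.
    apply: Hu => //; apply: le_trans (nrmM _ _) _.
    have := Hc N; rewrite dst0 -/z => h; have := ler_wpM2l (nrm_ge0 x) h.
    have := ler_norm (nrm x * c); have := normr_ge0 (nrm x * c'); rewrite /m; lra.
  have -> : (u * m) *: (x *m phi z) - x = ((u * m) *: x - x *m phi (- z)) *m phi z.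
    by rewrite mulmxBl -scalemxAl -mulmxA phiNl mulmx1.
  apply/Kphi/Hu => //; apply: le_trans (nrmM _ _) _.
  have := Hc' N 0; rewrite addr0 dst0 -/z => h.
  have b0 : box 0 (0 : 'rV[int]_k) by move=> i; rewrite mxE.
  have := ler_wpM2l (nrm_ge0 x) (h b0).
  have := ler_norm (nrm x * c'); have := normr_ge0 (nrm x * c); rewrite /m; lra.
have [i [j sij]] := sumr_gt0_entry s0; rewrite (ord1 i) in sij.
pose B := \sum_(z <- l) `|(z 0 j)%:~R : R|.
have zB N : `|(fl (N%:~R *: s) 0 j)%:~R : R| <= B.
  by rewrite /B (big_rem _ (zl N)) /= lerDl; apply: sumr_ge0.
have B0 : 0 <= B by apply: sumr_ge0.
have sp : 0 < `|s 0 j| by rewrite normr_gt0.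
pose n := Num.bound ((B + 1) / `|s 0 j|).
have : (B + 1) / `|s 0 j| < n%:R by apply: archi_boundP; apply: divr_ge0; lra.
rewrite ltr_pdivrMr //; have := zB n; have := flP (n%:~R *: s) j.
set f := (fl _ 0 j)%:~R; rewrite mxE -pmulrn => h1 h2 h3.
have : `|n%:R * s 0 j| <= B + 1.
  by move: h1 h2; rewrite !ler_norml; lra.
by rewrite normrM normr_nat; lra.
Qed.

Lemma nonzero_dir (S : {vspace 'rV[R]_k}) : (0 < \dim S)%N ->
  (forall s, s \in S -> bounded_dir 0%VS s) -> False.
Proof.
move=> dS HS; apply: (@no_bounded_dir (vpick S)); last exact/HS/memv_pick.
by rewrite vpick0 -dimv_eq0 -lt0n.
Qed.

Lemma discrete_rank : (k <= \dim A)%N.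
Proof.
have [S [h1 h2]] := bounded_directions A1 AM AC phiA phiD phi0 ideal0.
rewrite dimv0 subn0 in h1; rewrite leqNgt; apply/negP => h.
by apply: (nonzero_dir _ h2); lia.
Qed.

Hypothesis full_rank : (\dim A <= k)%N.

(** Full rank provides a direction bounded modulo [I], hence one in which the group grows inside
    [I]. Such a shear pushes [x] in opposite directions under [phi z] and [phi (- z)], which a
    salient cone forbids. *)
Lemma no_nil_ideal I : ideal I -> I != 0%VS ->
  ~ (forall b j, b \in I -> j \in I -> b *m j = 0).
Proof.
move=> iI I0 nil.
have [S [h1 h2]] := bounded_directions A1 AM AC phiA phiD phi0 iI.
have dI : (0 < \dim I)%N by rewrite lt0n dimv_eq0.
have dIA := dimvS iI.1.
have [s sS s0] : exists2 s, s \in S & s != 0.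
  exists (vpick S); first exact: memv_pick.
  by rewrite vpick0 -dimv_eq0 -lt0n; lia.
have [c Hc] := h2 s sS; have [c' Hc'] := bounded_opp AM AC phiA phiD 0 iI (h2 s sS).
apply: (no_bounded_dir s0); apply: contrapT => unb.
have unb' (n : nat) : exists N, n.+1%:R <= nrm (phi (fl (N%:~R *: s))).
  apply: contrapT => h; apply: unb; exists n.+1%:R => N; rewrite dst0 leNgt.
  by apply/negP => h'; apply: h; exists N; apply: ltW.
pose z n := fl ((projT1 (cid (unb' n)))%:~R *: s).
pose rho n := nrm (phi (z n)).
have rhoP n : n.+1%:R <= rho n by exact: (projT2 (cid (unb' n))).
have rho0 n : 0 < rho n by apply: lt_le_trans (rhoP n); rewrite ltr0n.
pose w n := resid I (phi (z n)); pose w' n := resid I (phi (- z n)).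
have jI n : phi (z n) - w n \in I by apply: resid_diff.
have jI' n : phi (- z n) - w' n \in I by apply: resid_diff.
have wc n : nrm (w n) <= c by apply: Hc.
have wc' n : nrm (w' n) <= c'.
  have := Hc' (projT1 (cid (unb' n))) 0; rewrite addr0; apply => i; by rewrite mxE.
have [om omL] := mlim_ex wc; have [om' omL'] := mlim_ex wc'.
have [|io ioL] := @mlim_ex _ _ _ (fun n => (rho n)^-1 *: phi (z n)) 1.
  by move=> n; rewrite nrmZ gtr0_norm ?invr_gt0 // mulVf // gt_eqF.
have io1 : 1 <= nrm io.
  apply: (mlim_lbnd ioL); apply: ev_true => n.
  by rewrite nrmZ gtr0_norm ?invr_gt0 // mulVf // gt_eqF.
have small (f : nat -> 'M[R]_d) b : (forall n, nrm (f n) <= b) ->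
    mlim (fun n => (rho n)^-1 *: f n) 0.
  move=> fb; apply: (@mlim_small _ _ _ _ `|b|) => //; apply: ev_true => n.
  rewrite nrmZ gtr0_norm ?invr_gt0 // mulrC; apply: ler_pM.
  - exact: nrm_ge0.
  - by rewrite invr_ge0 ltW.
  - exact: le_trans (fb n) (ler_norm _).
  - by rewrite lef_pV2 ?posrE ?ltr0n.
have ioI : io \in I.
  apply: (@vspace_closed _ _ _ (fun n => (rho n)^-1 *: (phi (z n) - w n))).
    rewrite -[io]subr0 -[0]oppr0 opprK.
    have := mlimD ioL (mlimN (small _ _ wc)); rewrite oppr0 addr0.
    by apply: mlim_ev; apply: ev_true => n; rewrite scalerBr.
  by apply: ev_true => n; rewrite memvZ.
have ioA := idealA iI ioI.
have io_w n : io *m phi (z n) = io *m w n.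
  by apply/eqP; rewrite -subr_eq0 -mulmxBr nil.
have io_w' n : io *m phi (- z n) = io *m w' n.
  by apply/eqP; rewrite -subr_eq0 -mulmxBr nil.
have wA n : w n \in A by apply: residA.
have wA' n : w' n \in A by apply: residA.
have omA : om \in A by apply: (vspace_closed omL); apply: ev_true.
have omA' : om' \in A by apply: (vspace_closed omL'); apply: ev_true.
have ioww : io *m om *m om' = io.
  apply: (mlim_uniq (mlimM (mlimM (mlim_cst io) omL) omL')).
  apply: mlim_ev (mlim_cst io); apply: ev_true => n.
  rewrite -io_w -mulmxA (AC (phiA _) (wA' n)) mulmxA -io_w' -mulmxA phiNl.
  by rewrite mulmx1.
(* The square of [phi (- z n) - w' n] is zero; solving for [phi (- z n)] expresses its growth
   through [phi (z n)]. *)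
have inv n : phi (- z n) = 2 *: w' n - phi (z n) *m (w' n *m w' n).
  have := nil _ _ (jI' n) (jI' n); rewrite mulmxBl !mulmxBr (AC (wA' n) (phiA _)).
  move/(congr1 (mulmx (phi (z n)))); rewrite mulmx0 !mulmxBr !mulmxA phiNr !mul1mx -!mulmxA.
  move/eqP; rewrite subr_eq0 => /eqP/(canRL (subrK _)) ->.
  by rewrite scaler_nat mulr2n addrAC.
(* The limit of [x *m phi (- z n)] divided by [rho n]; its sign is opposite to that of the limit
   [x *m io] obtained from [phi (z n)]. *)
pose v := - (x *m io *m (om' *m om')).
have vcl : cl K v.
  apply: (@cl_lim _ _ _ cK (fun n => (rho n)^-1 *: (x *m phi (- z n)))).
    have L1 := mlimN (mlimM (mlimM (mlim_cst x) ioL) (mlimM omL' omL')).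
    have wc2 n : nrm (2 *: w' n) <= 2 * c'.
      by rewrite nrmZ ger0_norm // ler_wpM2l.
    have L2 := mlimM (mlim_cst x) (small _ _ wc2); rewrite mulmx0 in L2.
    have := mlimD L2 L1; rewrite add0r; apply: mlim_ev; apply: ev_true => n.
    by rewrite [in RHS]inv -!scalemxAr -!scalemxAl mulmxBr scalerBr -scalemxAr !mulmxA.
  by apply: ev_true => n; apply/(cl_scale cK)/(cl_cone cK)/Kphi; rewrite // invr_ge0 ltW.
(* On [io] the matrices [phi (z n)] act as the bounded [w n], so applying them twice cancels the two
   factors [om'] in the limit. *)
have nxcl : cl K (- (x *m io)).
  apply: (@cl_lim _ _ _ cK (fun n => v *m phi (z n) *m phi (z n))); last first.
    by apply: ev_true => n; do 2 apply: cl_phi.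
  have L := mlimN (mlimM (mlimM (mlim_cst (x *m io *m (om' *m om'))) omL) omL).
  have -> : x *m io = x *m io *m (om' *m om') *m om *m om.
    have cc := AC omA' omA; rewrite -[in LHS]ioww -!(mulmxA x); congr (x *m _).
    rewrite !mulmxA -(mulmxA _ om' om) cc !mulmxA -(mulmxA io om' om) cc !mulmxA.
    by rewrite ioww -(mulmxA io om' om) cc !mulmxA.
  apply: mlim_ev L; apply: ev_true => n.
  have tw b : b \in A -> io *m b *m phi (z n) = io *m b *m w n.
    move=> bA; rewrite -mulmxA (AC bA (phiA _)) mulmxA io_w.
    by rewrite -!mulmxA (AC bA (wA n)).
  rewrite /v !mulNmx -!(mulmxA x); congr (- (x *m _)).
  by rewrite tw ?AM // -(mulmxA io _ (w n)) tw ?AM.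
have xcl : cl K (x *m io).
  apply: (@cl_lim _ _ _ cK (fun n => x *m ((rho n)^-1 *: phi (z n)))).
    exact: mlimM (mlim_cst x) ioL.
  apply: ev_true => n; rewrite -scalemxAr.
  by apply/(cl_scale cK)/(cl_cone cK)/Kphi; rewrite // invr_ge0 ltW.
have := eval_inj ioA (cone_salient cK xcl nxcl) => h.
by move: io1; rewrite h nrm0; lra.
Qed.

(** A minimal ideal is not nilpotent, hence it is a field. If its dimension exceeded 1, the
    directions bounded modulo it would outnumber the single one lost by [step_field], and a bounded
    direction of the discrete group would remain. *)
Lemma unit_in_ideal I0 : ideal I0 -> I0 != 0%VS ->
  exists e, [/\ e \in I0, e != 0, e *m e = e
    & forall a, a \in A -> exists c, a *m e = c *: e].
Proof.
move=> iI0 nI0.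
have [I mI sI] := minimal_over_ex ideal0 iI0 (sub0v _) nI0.
have [iI _ nI _] := mI.
have [b [j [bI jI bj]]] : exists b j, [/\ b \in I, j \in I & b *m j \notin 0%VS].
  apply: contrapT => h; apply: (no_nil_ideal iI nI) => b j bI jI.
  apply: contrapT => /eqP bj; apply: h; exists b, j; split => //.
  by rewrite memv0.
have [e eI eP] := minimal_unit AM AC ideal0 mI bI jI bj.
have eP' m : m \in I -> e *m m = m.
  by move=> /eP; rewrite memv0 subr_eq0 => /eqP.
have e0 : e != 0.
  apply: contra bj => /eqP e0; rewrite -(eP' b bI) e0 mul0mx mul0mx.
  exact: mem0v.
have dI : (\dim I <= 1)%N.
  have [S [h1 h2]] := bounded_directions A1 AM AC phiA phiD phi0 iI.
  have [S' [_ k2 k3]] := step_field A1 AM AC phiA phiD phi0 ideal0 mI bI jI bj h2.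
  rewrite leqNgt; apply/negP => h; apply: (nonzero_dir _ k3).
  by have := dimvS iI.1; lia.
have IE : I = <[e]>%VS.
  apply/esym/eqP; rewrite eqEdim dim_vline e0 dI andbT.
  by apply/subvP => _ /vlineP[c ->]; rewrite memvZ.
exists e; split => //; [by move/subvP: sI; apply|exact: eP'|].
move=> a aA; apply/vlineP; rewrite -IE; exact: iI.2.
Qed.

(** Orthogonal idempotents, on each of which [A] acts through a real character. *)
Definition orthogonal_units n (e : 'I_n -> 'M[R]_d) :=
  [/\ forall i, e i \in A, forall i, e i != 0,
      forall i j, e i *m e j = if i == j then e i else 0
    & forall i a, a \in A -> exists c, a *m e i = c *: e i].

Lemma orthogonal_units_dim n (e : 'I_n -> 'M[R]_d) : orthogonal_units e -> (n <= \dim A)%N.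
Proof.
case=> eA e0 ee _; pose X := [tuple e i | i < n].
have fX : free X.
  apply/freeP => c h i; have : (\sum_i c i *: X`_i) *m e i = 0 by rewrite h mul0mx.
  rewrite mulmx_suml (bigD1 i) //= big1 ?addr0 => [|j ji]; last first.
    by rewrite -scalemxAl nth_mktuple ee (negPf ji) scaler0.
  rewrite -scalemxAl nth_mktuple ee eqxx => /eqP.
  by rewrite scaler_eq0 (negPf (e0 i)) orbF => /eqP.
move: fX; rewrite /free size_tuple => /eqP <-; apply: dimvS.
by apply/span_subvP => _ /mapP[i _ ->].
Qed.

(** While the idempotents found do not sum to 1, their complement [f] generates a nonzero ideal
    orthogonal to them, which contains a further one; the dimension of [A] stops the process. *)
Lemma full_orthogonal_units : exists n (e : 'I_n -> 'M[R]_d),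
  orthogonal_units e /\ \sum_i e i = 1%:M.
Proof.
apply: contrapT => H.
suff /(_ (\dim A).+1)[e /orthogonal_units_dim] : forall n, exists e : 'I_n -> 'M[R]_d,
  orthogonal_units e by rewrite ltnn.
elim=> [|n [e He]]; first by exists (fun=> 0); split; case.
have [eA e0 ee ea] := He.
pose f : 'M[R]_d := 1%:M - \sum_i e i.
have fA : f \in A by rewrite memvB // memv_suml.
have f0 : f != 0.
  apply/eqP => h; apply: H; exists n, e; split => //.
  by apply/eqP; rewrite eq_sym -subr_eq0 -/f h.
have fe i : e i *m f = 0.
  rewrite mulmxBr mulmx1 mulmx_sumr (bigD1 i) //= ee eqxx big1 ?addr0 ?subrr // => j ji.
  by rewrite ee eq_sym (negPf ji).
have iA : ideal A by split; [exact: subvv|move=> a j; apply: AM].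
have iF := ideal_add AM AC ideal0 fA iA.
have [|e' [e'I e'0 e'e e'a]] := unit_in_ideal iF.
  apply: contra f0 => /eqP h; rewrite -memv0 -h -[f in f \in _]mulmx1.
  exact: add_mem.
have ee' i : e i *m e' = 0.
  have [w [j [wA]]] := addP e'I; rewrite memv0 => /eqP -> ->.
  by rewrite addr0 mulmxA fe mul0mx.
have e'A : e' \in A by exact: (idealA iF).
exists (fun i : 'I_n.+1 => if unlift ord_max i is Some j then e j else e'); split.
- by move=> i; case: unliftP.
- by move=> i; case: unliftP.
- move=> i j; case: unliftP => [i' ->|->]; case: unliftP => [j' ->|->].
  + by rewrite ee (inj_eq lift_inj).
  + by rewrite ee' eq_sym (negPf (neq_lift _ _)).
  + by rewrite AC // ee' (negPf (neq_lift _ _)).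
  + by rewrite eqxx.
- by move=> i a aA; case: unliftP => [j _|_]; [apply: ea|apply: e'a].
Qed.

Lemma hom_int_linear (l : 'rV[int]_k -> R) : (forall y z, l (y + z) = l y + l z) ->
  forall z, l z = \sum_j (z 0 j)%:~R * l (delta_mx 0 j).
Proof.
move=> lD z.
have l0 : l 0 = 0 by apply: (addrI (l 0)); rewrite -lD !addr0.
have lN y : l (- y) = - l y.
  by apply/eqP; rewrite -addr_eq0 -lD addNr l0.
have lnat y (m : nat) : l (y *+ m) = m%:R * l y.
  elim: m => [|m IH]; first by rewrite mulr0n l0 mul0r.
  by rewrite mulrS lD IH -natr1; ring.
have lZ y (c : int) : l (c *: y) = c%:~R * l y.
  case: c => m; first by rewrite -[X in X *: _]natz scaler_nat lnat -pmulrn.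
  by rewrite NegzE scaleNr lN -[X in l (X *: _)]natz scaler_nat lnat mulrNz mulNr -pmulrn.
rewrite {1}[z]row_sum_delta (big_morph l lD l0).
by apply: eq_bigr => j _; rewrite lZ.
Qed.

(* The orbit is a lattice in the simplicial cone spanned by the vectors [x *m e i]. *)
Lemma discrete_cocompact : exists l, forall y, K y -> exists z,
  K (l *: y - x *m phi z) /\ K (l *: (x *m phi z) - y).
Proof.
have [n [e [He sum1]]] := full_orthogonal_units.
have [eA e0 ee ea] := He; have ndim := orthogonal_units_dim He.
have exch i z : exists c, phi z *m e i = c *: e i by apply: ea.
pose ch i z := projT1 (cid (exch i z)).
have chP i z : phi z *m e i = ch i z *: e i := projT2 (cid (exch i z)).
have einj i : injective (fun c : R => c *: e i).
  by move=> c c' /eqP; rewrite -subr_eq0 -scalerBl scaler_eq0 (negPf (e0 i)) orbF subr_eq0 => /eqP.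
have chD i y z : ch i (y + z) = ch i y * ch i z.
  apply: (einj i); rewrite /= -chP phiD -mulmxA chP -scalemxAr chP scalerA.
  by rewrite mulrC.
have ch1 i : ch i 0 = 1 by apply: (einj i); rewrite /= -chP phi0 mul1mx scale1r.
have ch0 i z : ch i z != 0.
  apply/eqP => h; have := chD i z (- z); rewrite subrr ch1 h mul0r => /eqP.
  by rewrite oner_eq0.
pose l i z := ln `|ch i z|.
have lD i y z : l i (y + z) = l i y + l i z.
  by rewrite /l chD normrM lnM // posrE normr_gt0.
have chl i z : `|ch i z| = expR (l i z) by rewrite lnK // posrE normr_gt0.
pose L : 'M[R]_(k, n) := \matrix_(j, i) l i (delta_mx 0 j).
have lL i z : l i z = (map_mx (fun c : int => c%:~R) z *m L) 0 i.
  by rewrite (hom_int_linear (lD i)) mxE; apply: eq_bigr => j _; rewrite !mxE.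
have phie z : phi z = \sum_i ch i z *: e i.
  by rewrite -[LHS]mulmx1 -sum1 mulmx_sumr; apply: eq_bigr => i _; rewrite chP.
have flL s i : `|l i (fl s) - (s *m L) 0 i| <= nrm L.
  pose r : 'rV[R]_k := map_mx (fun c : int => c%:~R) (fl s) - s.
  have -> : l i (fl s) - (s *m L) 0 i = (r *m L) 0 i by rewrite lL mulmxBl [RHS]mxE; congr (_ + _); rewrite [RHS]mxE.
  rewrite mxE; apply: le_trans (ler_norm_sum _ _ _) _.
  apply: (@le_trans _ _ (\sum_j `|L j i|)).
    apply: ler_sum => j _; rewrite normrM -[leRHS]mul1r ler_wpM2r //.
    have -> : r 0 j = (fl s 0 j)%:~R - s 0 j by rewrite /r !mxE.
    by have := flP s j; rewrite ler_norml; lra.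
  apply: ler_sum => j _; rewrite (bigD1 i) //= lerDl; exact: sumr_ge0.
(* A row vector killed by [L] is a direction in which all characters, and hence [phi], stay bounded.
   So [L] is injective, and [n <= dim A <= k] makes it invertible. *)
have rL : \rank L = k.
  apply/eqP/row_freeP; apply/row_freeP; rewrite -kermx_eq0; apply/eqP/row_matrixP => i.
  rewrite row0; apply: contrapT => /eqP s0; set s := row i _ in s0.
  have sL : s *m L = 0 by apply/sub_kermxP; apply: row_sub.
  apply: (no_bounded_dir s0); exists (\sum_i expR (nrm L) * nrm (e i)) => N.
  rewrite dst0 phie; apply: le_trans (nrm_sum _ _) _; apply: ler_sum => j _.
  rewrite nrmZ ler_wpM2r ?nrm_ge0 // chl ler_expR.
  have := flL (N%:~R *: s) j; rewrite -scalemxAl sL scaler0 mxE subr0.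
  exact: le_trans (ler_norm _).
have fullL : row_full L.
  rewrite /row_full eqn_leq rank_leq_col rL; exact: leq_trans full_rank.
have solve (tau : 'rV[R]_n) : exists z, forall i, `|l i z - tau 0 i| <= nrm L.
  exists (fl (tau *m pinvmx L)) => i; have := flL (tau *m pinvmx L) i.
  by rewrite mulmxKpV // submx_full.
pose u i := x *m e i.
have u0 i : u i != 0 by apply: contra (e0 i) => /eqP /(eval_inj (eA i)) ->.
have coordE y : exists eta, forall i, y *m e i = eta i *: u i.
  have [a aA ->] := cyclic y.
  pose eta i := projT1 (cid (ea i a aA)); have etaP i := projT2 (cid (ea i a aA)).
  by exists eta => i; rewrite -mulmxA etaP scalemxAr.
have ysum y : y = \sum_i y *m e i by rewrite -mulmx_sumr sum1 mulmx1.
have ue i j : u i *m e j = if i == j then u i else 0.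
  by rewrite /u -mulmxA ee; case: ifP => _; rewrite ?mulmx0.
(* When the [i]-th character dominates, rescaled translates of [y] converge to its [i]-th
   component. *)
have vertex y i eta : K y -> y *m e i = eta *: u i -> cl K (eta *: u i).
  move=> Ky <-.
  (* The margin [t / 2] beyond the rounding error [nrm L] makes every ratio of squared characters at
     most [expR (- t)]; squaring, through [z t + z t], disposes of signs. *)
  pose T (t : nat) : R := nrm L + t%:R / 2.
  have exz t : exists z, forall j, `|l j z - (if j == i then T t else - T t)| <= nrm L.
    have [z zP] := solve (\row_j (if j == i then T t else - T t)).
    by exists z => j; have := zP j; rewrite mxE.
  pose z t := projT1 (cid (exz t)).
  have zP t j : `|l j (z t) - (if j == i then T t else - T t)| <= nrm L := projT2 (cid (exz t)) j.
  pose a t := ch i (z t + z t).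
  have a0 t : 0 < a t by rewrite /a chD -expr2 exprn_even_gt0 // ch0.
  apply: (@cl_lim _ _ _ cK (fun t => (a t)^-1 *: (y *m phi (z t + z t)))); last first.
    by apply: ev_true => t; apply/(cl_scale cK)/(cl_cone cK)/Kphi; rewrite // invr_ge0 ltW.
  have E t : (a t)^-1 *: (y *m phi (z t + z t)) - y *m e i =
      \sum_(j | j != i) (ch j (z t + z t) / a t) *: (y *m e j).
    rewrite phie mulmx_sumr (bigD1 i) //= scalerDr -/(a t) -scalemxAr scalerA mulVf ?gt_eqF //.
    rewrite scale1r addrC addKr scaler_sumr; apply: eq_bigr => j _.
    by rewrite -scalemxAr scalerA mulrC.
  suff h : mlim (fun t => (a t)^-1 *: (y *m phi (z t + z t)) - y *m e i) 0.
    by have := mlimD h (mlim_cst (y *m e i)); rewrite add0r; apply: mlim_ev; apply: ev_true => t; rewrite subrK.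
  apply: (@mlim_small _ _ _ _ (\sum_(j | j != i) nrm (y *m e j))).
    by apply: sumr_ge0 => j _; apply: nrm_ge0.
  apply: ev_true => t; rewrite E mulr_suml.
  apply: le_trans (_ : _ <= \sum_(j | j != i) nrm ((ch j (z t + z t) / a t) *: (y *m e j))) _.
    elim/big_rec2: _ => [|j s1 s2 _ IH]; first by rewrite nrm0.
    by apply: le_trans (nrmD _ _) _; rewrite lerD2l.
  apply: ler_sum => j ji; rewrite nrmZ mulrC ler_wpM2l ?nrm_ge0 //.
  rewrite /a !chD normrM normrM normfV normrM !chl -!expRD -expRN -expRD.
  have := zP t j; have := zP t i; rewrite eqxx (negPf ji) /T !ler_norml => /andP[h1 h2] /andP[h3 h4].
  have t0 := ler0n R t.
  apply: (@le_trans _ _ (expR (- t%:R))); first by rewrite ler_expR; lra.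

  rewrite expRN lef_pV2 ?posrE ?expR_gt0 ?ltr0n // -natr1 addrC.
  exact: expR_ge1Dx.
have xe i : cl K (u i) by have := vertex x i 1 Kx; rewrite scale1r; apply.
(* Salience gives nonnegative coordinates; moving [y] slightly against [u i] inside the open cone
   makes them positive. *)
have pos y i eta : K y -> y *m e i = eta *: u i -> 0 < eta.
  have nonneg y' eta' : K y' -> y' *m e i = eta' *: u i -> 0 <= eta'.
    move=> Ky ye; rewrite leNgt; apply/negP => h.
    have := vertex _ _ _ Ky ye => /(cl_scale cK (c := - eta'^-1)).
    rewrite scalerA mulNr mulVf ?lt_eqF // scaleN1r => /(_ _) nu.
    have := cone_salient cK (xe i) (nu _); rewrite oppr_ge0 invr_le0 => /(_ (ltW h)) /eqP.
    by rewrite (negPf (u0 i)).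
  move=> Ky ye; rewrite lt_neqAle (nonneg y) // andbT; apply/eqP => h.
  have [r r0 hr] := cone_open cK Ky.
  pose q := r / (nrm (u i) + 1).
  have nu := nrm_ge0 (u i).
  have q0 : 0 < q by rewrite divr_gt0 //; lra.
  have Ky' : K (y - q *: u i).
    apply: hr; rewrite addrC addKr nrmN nrmZ gtr0_norm // /q mulrAC ltr_pdivrMr; last lra.
    by rewrite ltr_pM2l //; lra.
  have := nonneg _ (eta - q) Ky'; rewrite -h sub0r oppr_ge0 leNgt q0 => /(_ _)/negP; apply => //.
  by rewrite mulmxBl ye -scalemxAl ue eqxx -h scale0r sub0r scaleNr.
have inK y (eta : 'I_n -> R) : (forall i, y *m e i = eta i *: u i) ->
    (forall i, 0 < eta i) -> K y.
  move=> ye eta0.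
  have [m m0 mP] : exists2 m, 0 < m & forall i, m <= eta i.
    exists (\sum_i (eta i)^-1 + 1)^-1.
      by rewrite invr_gt0 ltr_wpDl // sumr_ge0 // => i _; rewrite invr_ge0 ltW.
    move=> i; rewrite -[leRHS]invrK lef_pV2 ?posrE ?invr_gt0 //; last first.
      by rewrite ltr_wpDl // sumr_ge0 // => j _; rewrite invr_ge0 ltW.
    rewrite (bigD1 i) //= -addrA lerDl addr_ge0 // sumr_ge0 // => j _.
    by rewrite invr_ge0 ltW.
  have -> : y = \sum_i (eta i - m) *: u i + m *: x.
    rewrite [x in _ *: x]ysum scaler_sumr -big_split [LHS]ysum; apply: eq_bigr => i _ /=.
    by rewrite -scalerDl subrK ye.
  apply: (_ : cl K _); last exact: (cone_scale cK).
  elim/big_rec: _ => [|i v _ IH]; first exact: cl0.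
  by apply: cl_add => //; apply: (cl_scale cK) => //; rewrite subr_ge0.
(* [expR (nrm L)] is the rounding error of the logarithms, and the factor 2 makes the inequalities
   strict, as the open cone requires. *)
exists (2 * expR (nrm L)) => y Ky.
have [eta ye] := coordE y; have eta0 i := pos _ _ _ Ky (ye i).
have [z zP] := solve (\row_i ln (eta i)); exists z.
have xz i : x *m phi z *m e i = ch i z *: u i by rewrite -mulmxA chP scalemxAr.
have chi0 i := pos _ _ _ (Kphi z Kx) (xz i).
have E0 := expR_gt0 (nrm L).
have hz i : ch i z <= expR (nrm L) * eta i /\ eta i <= expR (nrm L) * ch i z.
  have := zP i; rewrite mxE ler_norml => h.
  rewrite -[ch i z]gtr0_norm // chl -{1 2}[eta i]lnK ?posrE // -!expRD !ler_expR.
  by split; lra.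
split.
- apply: (inK _ (fun i => 2 * expR (nrm L) * eta i - ch i z)) => i.
    by rewrite mulmxBl -scalemxAl ye xz scalerA scalerBl.
  have [h1 h2] := hz i; have := mulr_gt0 E0 (eta0 i); rewrite subr_gt0; lra.
- apply: (inK _ (fun i => 2 * expR (nrm L) * ch i z - eta i)) => i.
    by rewrite mulmxBl -scalemxAl ye xz scalerA scalerBl.
  have [h1 h2] := hz i; have := mulr_gt0 E0 (chi0 i); rewrite subr_gt0; lra.
Qed.

End DiscreteAbelian.

(** * Lattices acting on a cone that is open in a subspace *)

Section RelativeCocompact.
Variables (R : realType) (d k : nat) (phi : 'rV[int]_k -> 'M[R]_d).
Variables (K : 'rV[R]_d -> Prop) (Q : {vspace 'rV[R]_d}) (x : 'rV[R]_d).
Hypothesis phiD : forall x y, phi (x + y) = phi x *m phi y.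
Hypothesis phi0 : phi 0 = 1%:M.
Hypothesis KQ : forall v, K v -> v \in Q.
Hypothesis Kadd : forall u v, K u -> K v -> K (u + v).
Hypothesis Kscale : forall c v, 0 < c -> K v -> K (c *: v).
Hypothesis Kopen : forall v, K v ->
  exists2 e, 0 < e & forall w, w \in Q -> nrm (w - v) < e -> K w.
Hypothesis Ksalient : forall v, v \in Q -> cl K v -> cl K (- v) -> v = 0.
Hypothesis Kphi : forall z v, K v -> K (v *m phi z).
Hypothesis Kx : K x.
Hypothesis proper : forall l, finite_pred (fun z =>
  K (l *: x - x *m phi z) /\ K (l *: (x *m phi z) - x)).
Hypothesis dimQ : (\dim Q <= k)%N.

(** The action is restricted to the span [L] of the orbit of [x], where [x] is cyclic for the
    commutative algebra of the group. Then [k <= dim A <= dim L <= dim Q <= k], so [L] is [Q] and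
    the rank is full. *)
Lemma lattice_cocompact : exists l, forall y, K y -> exists z,
  K (l *: y - x *m phi z) /\ K (l *: (x *m phi z) - y).
Proof.
have [s [s1 s2]] := span_pred (fun v => exists z, v = x *m phi z).
set L := <<s>>%VS in s2.
have LQ : (L <= Q)%VS.
  by apply/span_subvP => v /s1[z ->]; apply/KQ/Kphi.
have Lphi z v : v \in L -> v *m phi z \in L.
  apply: (@span_lin _ _ s (fun v => v *m phi z \in L)).
  - by rewrite mul0mx mem0v.
  - by move=> a u w hu hw; rewrite mulmxDl -scalemxAl memvD // memvZ.
  by move=> w /s1[z' ->]; apply: s2; exists (z' + z); rewrite phiD mulmxA.
pose B : 'M[R]_(\dim L, d) := \matrix_i (vbasis L)`_i.
have BE (c : 'rV_(\dim L)) : c *m B = \sum_i c 0 i *: (vbasis L)`_i.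
  by rewrite mulmx_sum_row; apply: eq_bigr => i _; rewrite rowK.
have BL c : c *m B \in L.
  rewrite BE memv_suml // => i _; rewrite memvZ // vbasis_mem // mem_nth //.
  by rewrite size_tuple.
have [P BP] : exists P, B *m P = 1%:M.
  apply/row_freeP; rewrite -kermx_eq0; apply/eqP/row_matrixP => i; rewrite row0.
  set c := row i _; have : c *m B = 0 by apply/sub_kermxP; apply: row_sub.
  rewrite BE => h; have /freeP fr := basis_free (vbasisP L).
  by apply/rowP => j; rewrite [RHS]mxE; apply: fr h j.
have PB v : v \in L -> v *m P *m B = v.
  move=> vL; have -> : v = (\row_i coord (vbasis L) i v) *m B.
    by rewrite BE {1}(coord_vbasis vL); apply: eq_bigr => i _; rewrite mxE.
  by rewrite -!mulmxA (mulmxA B) BP mul1mx.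
pose phi1 z := B *m phi z *m P.
have phi1B z : phi1 z *m B = B *m phi z.
  apply/row_matrixP => i; rewrite /phi1 !row_mul PB //.
  by apply: Lphi; rewrite rowE; apply: BL.
have phi1D y z : phi1 (y + z) = phi1 y *m phi1 z.
  by rewrite {3}/phi1 !mulmxA phi1B -(mulmxA B) -phiD.
have phi10 : phi1 0 = 1%:M by rewrite /phi1 phi0 mulmx1.
pose K1 v := K (v *m B); pose x1 := x *m P.
have xL : x \in L by apply: s2; exists 0; rewrite phi0 mulmx1.
have x1B : x1 *m B = x by rewrite PB.
have K1x : K1 x1 by rewrite /K1 x1B.
have x1phi z : x1 *m phi1 z *m B = x *m phi z by rewrite -mulmxA phi1B mulmxA x1B.
have clK1 v : cl K1 v -> cl K (v *m B).
  move=> hv z Kz; have [e e0 he] := Kopen Kz.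
  have nx := nrm_ge0 x; pose q := e / (nrm x + 1).
  have q0 : 0 < q by rewrite divr_gt0 //; lra.
  have -> : v *m B + z = (v *m B + q *: x) + (z - q *: x).
    by rewrite -addrA [q *: x + _]addrC subrK.
  apply: Kadd.
    have := hv (q *: x1); rewrite /K1 mulmxDl -!scalemxAl x1B; apply.
    exact: Kscale.
  apply: he; first by rewrite memvB ?memvZ ?KQ.
  rewrite addrC addKr nrmN nrmZ gtr0_norm // /q mulrAC ltr_pdivrMr; last lra.
  by rewrite ltr_pM2l //; lra.
have cK1 : salient_cone K1.
  split; rewrite /K1.
  - by move=> u v Ku Kv; rewrite mulmxDl; apply: Kadd.
  - by move=> c v c0 Kv; rewrite -scalemxAl; apply: Kscale.
  - move=> v /Kopen[e e0 he]; have nB := nrm_ge0 B.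
    exists (e / (nrm B + 1)); first by rewrite divr_gt0 //; lra.
    move=> w; rewrite ltr_pdivlMr; last lra.
    move=> hw; apply: he; first by move/subvP: LQ; apply.
    rewrite -mulmxBl; apply: le_lt_trans (nrmM _ _) _; apply: le_lt_trans hw.
    by rewrite ler_wpM2l ?nrm_ge0 //; lra.
  - move=> v /clK1 h1 /clK1; rewrite mulNmx => h2.
    have vB : v *m B = 0 by apply: Ksalient => //; move/subvP: LQ; apply.
    by rewrite -[v]mulmx1 -BP mulmxA vB mul0mx.
have K1phi z v : K1 v -> K1 (v *m phi1 z).
  by rewrite /K1 -mulmxA phi1B mulmxA; apply: Kphi.
have proper1 l : finite_pred (fun z =>
    K1 (l *: x1 - x1 *m phi1 z) /\ K1 (l *: (x1 *m phi1 z) - x1)).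
  apply: finite_predS (proper l) => z.
  by rewrite /K1 !mulmxBl -!scalemxAl x1phi x1B.
have [t [t1 t2]] := span_pred (fun a => exists z, a = phi1 z).
set A := <<t>>%VS in t2.
have phiA z : phi1 z \in A by apply: t2; exists z.
have A1 : 1%:M \in A by rewrite -phi10.
have AM a b : a \in A -> b \in A -> a *m b \in A.
  move=> aA bA; move: a aA.
  apply: (@span_lin _ _ t (fun a => a *m b \in A)).
  - by rewrite mul0mx mem0v.
  - by move=> c u w hu hw; rewrite mulmxDl -scalemxAl memvD // memvZ.
  move=> _ /t1[z ->]; move: b bA.
  apply: (@span_lin _ _ t (fun b => phi1 z *m b \in A)).
  - by rewrite mulmx0 mem0v.
  - by move=> c u w hu hw; rewrite mulmxDr -scalemxAr memvD // memvZ.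
  by move=> _ /t1[z' ->]; rewrite -phi1D.
have AC a b : a \in A -> b \in A -> a *m b = b *m a.
  move=> aA bA; move: a aA.
  apply: (@span_lin _ _ t (fun a => a *m b = b *m a)).
  - by rewrite mul0mx mulmx0.
  - by move=> c u w hu hw; rewrite mulmxDl mulmxDr -scalemxAl -scalemxAr hu hw.
  move=> _ /t1[z ->]; move: b bA.
  apply: (@span_lin _ _ t (fun b => phi1 z *m b = b *m phi1 z)).
  - by rewrite mul0mx mulmx0.
  - by move=> c u w hu hw; rewrite mulmxDl mulmxDr -scalemxAl -scalemxAr hu hw.
  by move=> _ /t1[z' ->]; rewrite -!phi1D addrC.
have cyclic v : exists2 a, a \in A & v = x1 *m a.
  suff [a aA h] : exists2 a, a \in A & v *m B = x1 *m a *m B.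
    by exists a => //; rewrite -[v]mulmx1 -BP mulmxA h -mulmxA BP mulmx1.
  apply: (@span_lin _ _ s (fun u => exists2 a, a \in A & u = x1 *m a *m B)) (BL v).
  - by exists 0; rewrite ?mem0v // mulmx0 mul0mx.
  - move=> c u w [a aA ->] [b bA ->]; exists (c *: a + b).
      by rewrite memvD // memvZ.
    by rewrite mulmxDr mulmxDl -scalemxAr -scalemxAl.
  by move=> u /s1[z ->]; exists (phi1 z) => //; rewrite x1phi.
have kA := discrete_rank A1 AM AC phiA phi1D phi10 cK1 K1x K1phi proper1.
have dA : (\dim A <= \dim L)%N.
  pose f := linfun (mulmx x1 : 'M[R]_(\dim L) -> 'rV[R]_(\dim L)).
  have := limg_ker_dim f A.
  have -> : (A :&: lker f)%VS = 0%VS.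
    apply/eqP; rewrite -subv0; apply/subvP => a; rewrite memv_cap memv_ker lfunE /=.
    move=> /andP[aA /eqP xa]; rewrite memv0; apply/eqP.
    exact: (eval_inj AC cyclic).
  rewrite dimv0 add0n => <-; have := dimvS (subvf (f @: A)%VS).
  by rewrite dimvf /dim /= mul1n.
have dL := dimvS LQ.
have LE : L = Q by apply/eqP; rewrite eqEdim LQ; exact: leq_trans dimQ (leq_trans kA dA).
have full : (\dim A <= k)%N := leq_trans dA (leq_trans dL dimQ).
have [l Hl] := discrete_cocompact A1 AM AC phiA phi1D phi10 cK1 K1x K1phi proper1 cyclic full.
exists l => y Ky; have yL : y \in L by rewrite LE KQ.
have [|z [h1 h2]] := Hl (y *m P); first by rewrite /K1 PB.
exists z; move: h1 h2; rewrite /K1 !mulmxBl -!scalemxAl x1phi PB //.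
Qed.

End RelativeCocompact.

(** * Functionals positive on an open cone *)

Section Pairing.
Variables (R : realType) (N : nat).
Implicit Types (u v w : 'rV[R]_N) (f h : 'cV[R]_N).

Definition pair v f : R := (v *m f) 0 0.

Lemma pairDl u v f : pair (u + v) f = pair u f + pair v f.
Proof. by rewrite /pair mulmxDl mxE. Qed.
Lemma pairDr u f h : pair u (f + h) = pair u f + pair u h.
Proof. by rewrite /pair mulmxDr mxE. Qed.
Lemma pairZl c v f : pair (c *: v) f = c * pair v f.
Proof. by rewrite /pair -scalemxAl mxE. Qed.
Lemma pairZr c v f : pair v (c *: f) = c * pair v f.
Proof. by rewrite /pair -scalemxAr mxE. Qed.
Lemma pairNl v f : pair (- v) f = - pair v f.
Proof. by rewrite /pair mulNmx mxE. Qed.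
Lemma pairNr v f : pair v (- f) = - pair v f.
Proof. by rewrite /pair mulmxN mxE. Qed.
Lemma pairBl u v f : pair (u - v) f = pair u f - pair v f.
Proof. by rewrite pairDl pairNl. Qed.
Lemma pairBr u f h : pair u (f - h) = pair u f - pair u h.
Proof. by rewrite pairDr pairNr. Qed.
Lemma pair0l f : pair 0 f = 0. Proof. by rewrite /pair mul0mx mxE. Qed.
Lemma pair0r v : pair v 0 = 0. Proof. by rewrite /pair mulmx0 mxE. Qed.
Lemma pairM v (g : 'M[R]_N) f : pair (v *m g) f = pair v (g *m f).
Proof. by rewrite /pair mulmxA. Qed.
Lemma pair_delta f i : pair (delta_mx 0 i) f = f i 0.
Proof. by rewrite /pair -rowE mxE. Qed.
Lemma pair_tr v f : pair v f = pair f^T v^T.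
Proof. by rewrite /pair -trmx_mul [RHS]mxE. Qed.
Lemma pair_le v f : `|pair v f| <= nrm v * nrm f.
Proof. exact: le_trans (entry_le_nrm _ _ _) (nrmM _ _). Qed.

(** One Hahn-Banach step: the value on [u] is the supremum of the lower bounds that [D] imposes on
    it. *)
Lemma functional_extension (D : 'rV[R]_N -> Prop) d0 (W : 'M[R]_N) u f :
  (forall x y, D x -> D y -> D (x + y)) ->
  (forall c x, 0 < c -> D x -> D (c *: x)) ->
  (forall x, D x -> exists2 e, 0 < e & forall w, nrm (w - x) < e -> D w) ->
  D d0 -> (d0 <= W)%MS -> pair d0 f = 1 ->
  (forall v, D v -> (v <= W)%MS -> 0 <= pair v f) ->
  exists2 f', pair d0 f' = 1 & forall v, D v -> (v <= W + u)%MS -> 0 <= pair v f'.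
Proof.
move=> Dadd Dscale Dopen Dd0 d0W fd0 fpos.
have [uW|uW] := boolP (u <= W)%MS.
  exists f => // v Dv vW; apply: fpos => //; apply: submx_trans vW _.
  by rewrite addsmx_sub submx_refl.
have [j gj] : exists j, (u *m cokermx W) 0 j != 0.
  rewrite submxE in uW; have [i [j h]] := sumr_gt0_entry uW.
  by exists j; rewrite (ord1 i) in h.
pose g := ((u *m cokermx W) 0 j)^-1 *: col j (cokermx W).
have gE w : pair w g = ((u *m cokermx W) 0 j)^-1 * (w *m cokermx W) 0 j.
  rewrite pairZr; congr (_ * _).
  by rewrite /pair colE (mulmxA w) -colE [LHS]mxE.
have gW w : (w <= W)%MS -> pair w g = 0.
  by rewrite submxE => /eqP h; rewrite gE h [X in _ * X]mxE mulr0.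
have gu : pair u g = 1 by rewrite gE mulVf.
have [e e0 he] := Dopen _ Dd0.
(* With this multiple of [d0], both [c d0 + u] and [c d0 - u] lie in [D], so lower and upper bounds
   for the value on [u] both exist. *)
pose c := (nrm u + 1) / e; have nu := nrm_ge0 u.
have c0 : 0 < c by rewrite divr_gt0 //; lra.
have far s : `|s| = 1 -> D (c *: d0 + s *: u).
  move=> s1; have -> : c *: d0 + s *: u = c *: (d0 + c^-1 *: (s *: u)).
    by rewrite scalerDr [in RHS]scalerA divff ?scale1r // gt_eqF.
  apply: Dscale => //; apply: he; rewrite addrC addKr !nrmZ s1 mul1r.
  rewrite gtr0_norm ?invr_gt0 // mulrC ltr_pdivrMr // /c mulrCA divff ?gt_eqF //; lra.
pose E := [set - pair w f | w in [set w | (w <= W)%MS /\ D (w + u)]]%classic.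
have E0 : E (- pair (c *: d0) f).
  exists (c *: d0) => //; split; first exact: scalemx_sub.
  by have := far 1 (normr1 _); rewrite scale1r.
have Eub w' : (w' <= W)%MS -> D (w' - u) -> ubound E (pair w' f).
  move=> w'W Dw' _ [w [wW Dw] <-].
  have := fpos (w + w'); rewrite pairDl => h.
  have : 0 <= pair w f + pair w' f.
    apply: h; last exact: addmx_sub.
    by have := Dadd _ _ Dw Dw'; rewrite addrACA subrr addr0.
  lra.
have Es : has_sup E.
  split; first by exists (- pair (c *: d0) f).
  exists (pair (c *: d0) f); apply: Eub; first exact: scalemx_sub.
  by have := far (-1) (normrN1 _); rewrite scaleN1r.
pose r := sup E.
exists (f + (r - pair u f) *: g).
  by rewrite pairDr pairZr gW // mulr0 addr0.
move=> v Dv /sub_addsmxP[[b1 b2] /= vE]; set w := b1 *m W in vE.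
have wW : (w <= W)%MS by apply: submxMl.
have b2E : b2 *m u = b2 0 0 *: u.
  by rewrite {1}[b2]mx11_scalar mul_scalar_mx.
move: Dv; rewrite vE b2E; set t := b2 0 0 => Dv.
rewrite pairDl pairZl !pairDr (pairZr _ w) (pairZr _ u) gW // gu mulr0 addr0 mulr1 subrKC.
have [t0|t0|t0] := ltrgt0P t.
- have tw : E (- pair (t^-1 *: w) f).
    exists (t^-1 *: w) => //; split; first exact: scalemx_sub.
    have -> : t^-1 *: w + u = t^-1 *: (w + t *: u).
      by rewrite scalerDr [in RHS]scalerA mulVf ?scale1r // gt_eqF.
    by apply: Dscale => //; rewrite invr_gt0.
  have := ub_le_sup (proj2 Es) tw; rewrite -/r pairZl.
  rewrite -mulrN mulrC ler_pdivrMr //; lra.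
- have tw : ubound E (pair ((- t)^-1 *: w) f).
    apply: Eub; first exact: scalemx_sub.
    have -> : (- t)^-1 *: w - u = (- t)^-1 *: (w + t *: u).
      by rewrite scalerDr [in RHS]scalerA invrN mulNr mulVf ?scaleN1r // lt_eqF.
    by apply: Dscale => //; rewrite invr_gt0 oppr_gt0.
  have := ge_sup (proj1 Es) tw; rewrite -/r pairZl mulrC ler_pdivlMr ?oppr_gt0 //; lra.
- by move: Dv; rewrite t0 mul0r addr0 scale0r addr0 => Dw; apply: fpos.
Qed.

(** The extension runs through the basis vectors, starting from the line of [d0], which [D] meets
    only in positive multiples because it misses 0. Openness makes the final inequality strict. *)
Lemma open_cone_functional (D : 'rV[R]_N -> Prop) d0 :
  (forall x y, D x -> D y -> D (x + y)) ->
  (forall c x, 0 < c -> D x -> D (c *: x)) ->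
  (forall x, D x -> exists2 e, 0 < e & forall w, nrm (w - x) < e -> D w) ->
  D d0 -> ~ D 0 -> exists f, forall v, D v -> 0 < pair v f.
Proof.
move=> Dadd Dscale Dopen Dd0 D0.
have d00 : d0 != 0 by apply: contra_notN D0 => /eqP <-.
pose W0 : 'M[R]_N := <<d0>>%MS.
suff H (s : seq 'rV[R]_N) : exists f (W : 'M[R]_N), [/\ pair d0 f = 1, (d0 <= W)%MS,
    forall v, D v -> (v <= W)%MS -> 0 <= pair v f & forall u, u \in s -> (u <= W)%MS].
  have [f [W [f1 _ fpos Ws]]] := H [seq delta_mx 0 i | i : 'I_N].
  have Wv v : (v <= W)%MS.
    rewrite [v]row_sum_delta summx_sub // => i _; apply: scalemx_sub; apply: Ws.
    by apply/mapP; exists i; rewrite ?mem_enum.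
  exists f => v Dv; have [e e0 he] := Dopen _ Dv.
  have nd := nrm_ge0 d0; pose q := e / (nrm d0 + 1).
  have q0 : 0 < q by rewrite divr_gt0 //; lra.
  have Dv' : D (v - q *: d0).
    apply: he; rewrite addrC addKr nrmN nrmZ gtr0_norm // /q mulrAC ltr_pdivrMr; last lra.
    by rewrite ltr_pM2l //; lra.
  by have := fpos _ Dv' (Wv _); rewrite pairBl pairZl f1; lra.
elim: s => [|u s [f [W [f1 dW fpos Ws]]]]; last first.
  have [f' f'1 f'pos] := @functional_extension D d0 W u f Dadd Dscale Dopen Dd0 dW f1 fpos.
  exists f', (W + u)%MS; split => //; first exact: submx_trans dW (addsmxSl _ _).
  move=> w; rewrite inE => /predU1P[->|/Ws h]; first exact: addsmxSr.
  exact: submx_trans h (addsmxSl _ _).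
have [i [j dj]] := sumr_gt0_entry d00; rewrite (ord1 i) in dj.
exists ((d0 0 j)^-1 *: delta_mx j 0), W0; split => //.
- by rewrite pairZr /pair -colE mxE mulVf.
- by rewrite genmxE.
move=> v Dv; rewrite genmxE => /sub_rVP[c vE]; rewrite vE in Dv *.
rewrite pairZl pairZr /pair -colE mxE mulVf // mulr1 leNgt; apply/negP => c0.
apply: D0; have Dn : D (- c *: d0) by apply: Dscale; rewrite ?oppr_gt0.
by have := Dadd _ _ Dv Dn; rewrite scaleNr subrr.
Qed.

End Pairing.

(** * Determinants and inverses of bounded matrices *)

Section DetBounds.
Variable R : realType.

Lemma det_bound n (A : 'M[R]_n) c : (forall i j, `|A i j| <= c) ->
  `|\det A| <= #|{: 'S_n}|%:R * c ^+ n.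
Proof.
move=> H; rewrite /determinant; apply: le_trans (ler_norm_sum _ _ _) _.
apply: (@le_trans _ _ (\sum_(s : 'S_n) c ^+ n)); last first.
  by rewrite sumr_const mulr_natl.
apply: ler_sum => s _; rewrite normrM normrX normrN1 expr1n mul1r normr_prod.
rewrite -[n in c ^+ n]card_ord -prodr_const; apply: ler_prod => i _.
by rewrite normr_ge0 H.
Qed.

(** With determinant of absolute value 1, the inverse is the adjugate up to sign. *)
Lemma inv_bound n c : exists2 b, 0 <= b & forall A : 'M[R]_n, A \in unitmx -> `|\det A| = 1 ->
  nrm A <= c -> nrm (invmx A) <= b.
Proof.
pose b := #|{: 'S_n.-1}|%:R * `|c| ^+ n.-1.
have b0 : 0 <= b by rewrite mulr_ge0 // exprn_ge0.
exists ((n * n)%:R * b); first by rewrite mulr_ge0.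
move=> A uA dA Ac; rewrite /invmx uA nrmZ normfV dA invr1 mul1r.
apply: nrm_le => i j; rewrite mxE /cofactor normrM normrX normrN1 expr1n mul1r.
apply: det_bound => i' j'; rewrite !mxE.
exact: le_trans (entry_le_nrm _ _ _) (le_trans Ac (ler_norm _)).
Qed.

End DetBounds.

Section Infinite.
Variables T T' : eqType.

Lemma infinite_fiber (P : T -> Prop) (f : T -> T') :
  ~ finite_pred P -> finite_pred (fun y => exists2 x, P x & f x = y) ->
  exists y, ~ finite_pred (fun x => P x /\ f x = y).
Proof.
move=> infP [l lP]; apply: contrapT => H; apply: infP.
have K y : exists s : seq T, forall x, P x /\ f x = y -> x \in s.
  by apply: contrapT => h; apply: H; exists y.
exists (flatten [seq projT1 (cid (K y)) | y <- l]) => x Px.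
apply/flatten_mapP; exists (f x); first by apply: lP; exists x.
by apply: (projT2 (cid (K (f x)))).
Qed.

(** Some fiber of the first function is still infinite; the remaining functions are treated inside
    it. *)
Lemma infinite_constant (I : eqType) (s : seq I) (P : T -> Prop) (f : I -> T -> T') :
  ~ finite_pred P ->
  (forall i, i \in s -> finite_pred (fun y => exists2 x, P x & f i x = y)) ->
  exists x y, [/\ P x, P y, x != y & forall i, i \in s -> f i x = f i y].
Proof.
elim: s P => [|i s IH] P infP fin.
  have [t [us st sP]] := infinite_uniq 2 infP.
  case: t us st sP => [|x [|y [|? ?]]] // us _ sP.
  exists x, y; split => //; try (by apply: sP; rewrite !inE eqxx ?orbT).
  by move: us; rewrite /= inE andbT.
have [v infv] := infinite_fiber infP (fin i (mem_head _ _)).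
have [j js|x [y [[Px fx] [Py fy] xy H]]] := IH _ infv.
  apply: finite_predS (fin j _); last by rewrite inE js orbT.
  by move=> y [x [Px _] <-]; exists x.
exists x, y; split => // j; rewrite inE => /predU1P[->|/H //].
by rewrite fx fy.
Qed.

End Infinite.

(** Proper convexity in linear form is [ca_chart]: the slice of [C] at height 1 for [a] has norm at
    most [m]. Discreteness at 1 passes to every element by translation. *)
Record convex_action (R : realType) (N : nat) (C : 'rV[R]_N -> Prop) (a : 'cV[R]_N) (m : R)
    (G : 'M[R]_N -> Prop) : Prop := ConvexAction {
  ca_add : forall x y, C x -> C y -> C (x + y);
  ca_scale : forall c x, 0 < c -> C x -> C (c *: x);
  ca_open : forall x, C x -> exists2 e, 0 < e & forall w, nrm (w - x) < e -> C w;
  ca_chart : forall v, C v -> 0 < pair v a /\ nrm v <= m * pair v a;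
  ca_one : G 1%:M;
  ca_mul : forall g h, G g -> G h -> G (g *m h);
  ca_inv : forall g, G g -> G (invmx g);
  ca_unit : forall g, G g -> g \in unitmx;
  ca_det : forall g, G g -> `|\det g| = 1;
  ca_act : forall g v, G g -> C v -> C (v *m g);
  ca_discrete : exists2 e, 0 < e & forall g, G g -> nrm (g - 1%:M) < e -> g = 1%:M }.

Definition normal_abelian (R : realType) N (G : 'M[R]_N -> Prop) :=
  exists A : 'M[R]_N -> Prop,
  [/\ forall g, A g -> G g, A 1%:M,
      forall g h, A g -> A h -> A (g *m h) /\ A (invmx g),
      forall g h, G g -> A h -> A (invmx g *m h *m g)
    & (forall g h, A g -> A h -> g *m h = h *m g) /\ exists2 g, A g & g != 1%:M].

(** * Displacement and finiteness for discrete actions on a cone *)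

Section Actions.
Variables (R : realType) (N : nat) (C : 'rV[R]_N -> Prop) (a : 'cV[R]_N) (m : R).
Variable G : 'M[R]_N -> Prop.
Hypothesis CA : convex_action C a m G.
Implicit Types (u v w x y : 'rV[R]_N) (g h : 'M[R]_N).

Lemma action_cl_chart v : cl C v -> (exists x, C x) ->
  0 <= pair v a /\ nrm v <= m * pair v a.
Proof.
move=> hv [x Cx].
have [px nx] := ca_chart CA Cx.
have H (e : R) : 0 < e -> 0 < pair v a + e * pair x a /\
    nrm v <= m * pair v a + e * (m * pair x a + nrm x).
  move=> e0; have [h1 h2] := ca_chart CA (hv _ (ca_scale CA e0 Cx)).
  rewrite pairDl pairZl in h1 h2; split => //.
  have := nrmB (v + e *: x) (e *: x); rewrite addrK nrmZ gtr0_norm // => h3.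
  lra.
split; rewrite leNgt; apply/negP => h.
  have e0 : 0 < - pair v a / pair x a by rewrite divr_gt0 ?oppr_gt0.
  by have [+ _] := H _ e0; rewrite divfK ?gt_eqF // subrr ltxx.
have c0 : 0 <= m * pair x a + nrm x by have := nrm_ge0 x; lra.
pose e := (nrm v - m * pair v a) / (m * pair x a + nrm x + 1).
have e0 : 0 < e by rewrite divr_gt0 //; lra.
have [_] := H e e0.
have : e * (m * pair x a + nrm x + 1) = nrm v - m * pair v a.
  by rewrite divfK // gt_eqF //; lra.
lra.
Qed.

Lemma action_salient : (exists x, C x) -> salient_cone C.
Proof.
move=> neC; split; try by [apply: ca_add CA|apply: ca_scale CA|apply: ca_open CA].
move=> v /action_cl_chart/(_ neC)[h1 h2] /action_cl_chart/(_ neC)[h3 h4].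
rewrite pairNl nrmN in h3 h4; apply: nrm_eq0; apply/eqP; rewrite eq_le nrm_ge0 andbT.
have v0 : pair v a = 0 by lra.
by rewrite v0 mulr0 in h2.
Qed.

Lemma interval_bound w u : C (w + u) -> C (w - u) -> nrm u <= m * pair w a.
Proof.
move=> /(ca_chart CA)[_]; rewrite pairDl => h1 /(ca_chart CA)[_]; rewrite pairBl => h2.
have := nrmB (w + u) (w - u); have -> : w + u - (w - u) = 2 *: u.
  by apply/rowP => i; rewrite !mxE; ring.
rewrite nrmZ ger0_norm //; lra.
Qed.

Lemma actV g v : G g -> v *m g *m invmx g = v.
Proof. by move=> /(ca_unit CA) ug; rewrite mulmxK. Qed.

Lemma actVK g v : G g -> v *m invmx g *m g = v.
Proof. by move=> /(ca_unit CA) ug; rewrite mulmxKV. Qed.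

Lemma action_cl g v : G g -> cl C v -> cl C (v *m g).
Proof.
move=> Gg hv z Cz; rewrite -(actVK z Gg) -mulmxDl; apply: (ca_act CA) => //.
by apply: hv; apply: (ca_act CA) => //; apply: (ca_inv CA).
Qed.

(* uniform interior points: a way to speak of compact subsets of the cone *)
Definition thick e b x := nrm x <= b /\ forall w, nrm (w - x) < e -> C w.

Lemma thick_cone e b x : 0 < e -> thick e b x -> C x.
Proof. by move=> e0 [_]; apply; rewrite subrr nrm0. Qed.

Lemma cone_thick x : C x -> exists e, 0 < e /\ thick e (nrm x) x.
Proof. by move=> /(ca_open CA)[e e0 he]; exists e; split. Qed.

Lemma thick_unit e b x v c : 0 < e -> thick e b x -> 0 < c -> nrm v <= c ->
  C ((2 * c / e) *: x - v) /\ C ((2 * c / e) *: x + v).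
Proof.
move=> e0 [_ he] c0 vc; have q0 : 0 < 2 * c / e by rewrite divr_gt0 ?mulr_gt0.
have K u : nrm u <= c -> C ((2 * c / e) *: x + u).
  move=> uc; have -> : (2 * c / e) *: x + u = (2 * c / e) *: (x + (2 * c / e)^-1 *: u).
    by rewrite scalerDr scalerA divff ?scale1r // gt_eqF.
  apply: (ca_scale CA) => //; apply: he; rewrite addrC addKr nrmZ.
  rewrite gtr0_norm ?invr_gt0 // mulrC ltr_pdivrMr //.
  by rewrite mulrCA divff ?gt_eqF // mulr1; lra.
by split; apply: K; rewrite ?nrmN.
Qed.

(** Basis vectors lie between multiples of [x], so their images, the rows of [g], lie between
    multiples of [x *m g] and hence of [x]; the chart bounds such order intervals. *)
Lemma thick_displacement e b : 0 < e -> exists c, forall x g l,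
  thick e b x -> G g -> C (l *: x - x *m g) -> nrm g <= c * `|l|.
Proof.
move=> e0; pose q : R := 2 * 1 / e.
have q0 : 0 < q by rewrite divr_gt0 // mulr_gt0.
exists (N%:R * (`|m| * (q * (b * nrm a)))) => x g l tx Gg Cl.
have -> : N%:R * (`|m| * (q * (b * nrm a))) * `|l| = N%:R * (`|m| * (q * `|l| * (b * nrm a))) by ring.
have Cx := thick_cone e0 tx; have [px _] := ca_chart CA Cx.
have rowb i : nrm (row i g) <= `|m| * (q * `|l| * (b * nrm a)).
  have nd : nrm (delta_mx 0 i : 'rV[R]_N) <= 1.
    rewrite /nrm big_ord1 (bigD1 i) //= mxE !eqxx normr1 big1 ?addr0 // => j ji.
    by rewrite mxE (negPf ji) andbF normr0.
  have [h1 h2] := thick_unit e0 tx ltr01 nd; rewrite -/q in h1 h2.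
  have Clq := ca_scale CA q0 Cl.
  have k1 := ca_add CA Clq (ca_act CA Gg h1).
  have k2 := ca_add CA Clq (ca_act CA Gg h2).
  rewrite scalerBr mulmxBl -scalemxAl addrA subrK -rowE scalerA in k1.
  rewrite scalerBr mulmxDl -scalemxAl addrA subrK -rowE scalerA in k2.
  apply: le_trans (interval_bound k2 k1) _; rewrite pairZl.
  apply: le_trans (ler_norm _) _; rewrite normrM; apply: ler_wpM2l => //.
  rewrite normrM; apply: ler_pM => //; first by rewrite normrM gtr0_norm.
  apply: le_trans (pair_le _ _) _; rewrite ler_wpM2r ?nrm_ge0 //; exact: tx.1.
rewrite /nrm; apply: (@le_trans _ _ (\sum_i nrm (row i g))).
  apply: ler_sum => i _; rewrite /nrm big_ord1; apply: ler_sum => j _.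
  by rewrite mxE.
apply: (@le_trans _ _ (\sum_(i < N) (`|m| * (q * `|l| * (b * nrm a))))).
  exact: ler_sum.
by rewrite sumr_const card_ord mulr_natl.
Qed.

(** Among infinitely many bounded matrices two are so close that their quotient violates
    discreteness at 1. *)
Lemma bounded_finite c : finite_pred (fun g => G g /\ nrm g <= c).
Proof.
apply: contrapT => inf; have [b b0 hb] := @inv_bound R N c.
have [e e0 he] := ca_discrete CA.
have d0 : 0 < e / (b + 1) by rewrite divr_gt0 //; lra.
have [g [h [[Gg gc] [Gh hc] gh near]]] :=
  pigeonhole_mx inf (fun g (p : G g /\ nrm g <= c) => p.2) d0.
have uh := ca_unit CA Gh.
have E : g *m invmx h = 1%:M.
  apply: he; first by apply: (ca_mul CA) => //; apply: (ca_inv CA).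
  have -> : g *m invmx h - 1%:M = (g - h) *m invmx h by rewrite mulmxBl mulmxV.
  apply: le_lt_trans (nrmM _ _) _; have := hb h uh (ca_det CA Gh) hc.
  rewrite ltr_pdivlMr in near; last lra.
  move=> k; apply: le_lt_trans near; rewrite ler_wpM2l ?nrm_ge0 //; lra.
by move/eqP: gh; apply; rewrite -[g](mulmxKV uh) E mul1mx.
Qed.

Lemma displacement_finite e b l : 0 < e ->
  finite_pred (fun g => G g /\ exists2 x, thick e b x & C (l *: x - x *m g)).
Proof.
move=> e0; have [c hc] := thick_displacement b e0.
by apply: finite_predS (bounded_finite (c * `|l|)) => g [Gg [x tx h]]; split => //; apply: hc tx _ h.
Qed.

Lemma center_normal_abelian z : G z -> z != 1%:M -> (forall g, G g -> z *m g = g *m z) ->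
  normal_abelian G.
Proof.
move=> Gz z1 zc; exists (fun h => G h /\ forall g, G g -> h *m g = g *m h); split.
- by move=> g [].
- by split; [exact: ca_one CA|move=> g _; rewrite mul1mx mulmx1].
- move=> g h [Gg gc] [Gh hc]; split; split.
  + exact: (ca_mul CA).
  + by move=> k Gk; rewrite -mulmxA hc // mulmxA gc // mulmxA.
  + exact: (ca_inv CA).
  + move=> k Gk; have ug := ca_unit CA Gg.
    by rewrite -[k in LHS](mulmxK ug) -(gc _ Gk) !mulmxA mulVmx // mul1mx.
- move=> g h Gg [Gh hc]; have ug := ca_unit CA Gg.
  by rewrite -mulmxA hc // mulmxA mulVmx // mul1mx.
split; last by exists z.
by move=> g h [Gg gc] [Gh hc]; apply: gc.
Qed.

(** Finite generation enters through the second hypothesis: an element commuting with the finite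
    family [s] is central. *)
Lemma conj_finite_normal_abelian (s : seq 'M[R]_N) (P : 'M[R]_N -> Prop) :
  (forall g, g \in s -> G g) ->
  (forall z, G z -> (forall g, g \in s -> z *m g = g *m z) ->
     forall g, G g -> z *m g = g *m z) ->
  (forall g, P g -> G g) -> ~ finite_pred P ->
  (forall g, g \in s -> finite_pred (fun h => exists2 p, P p & p *m g *m invmx p = h)) ->
  normal_abelian G.
Proof.
move=> sG gen PG infP fin.
have [p [q [Pp Pq pq H]]] := infinite_constant infP fin.
have up := ca_unit CA (PG p Pp); have uq := ca_unit CA (PG q Pq).
have Gz : G (invmx p *m q) by apply: (ca_mul CA); [apply: (ca_inv CA)|]; apply: PG.
apply: (center_normal_abelian Gz).
  apply: contra pq => /eqP h; rewrite -[q](mulKVmx up) h mulmx1.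
  exact: eqxx.
apply: gen => // g gs; have := H g gs => h.
have {}h : q *m g = p *m g *m invmx p *m q by rewrite h mulmxKV.
by rewrite -mulmxA h !mulmxA mulVmx // mul1mx.
Qed.

End Actions.

Lemma finite_argmin (R : realType) (T : eqType) (P : T -> Prop) (f : T -> R) x0 :
  finite_pred P -> P x0 -> exists2 x, P x & forall y, P y -> f x <= f y.
Proof.
case=> s sP Px0; suff H (l : seq T) : exists2 x, P x & forall y, y \in l -> P y -> f x <= f y.
  by have [x Px h] := H s; exists x => // y Py; apply: h => //; apply: sP.
elim: l => [|a l [x Px h]]; first by exists x0.
have [[Pa ax]|na] := pselect (P a /\ f a <= f x).
  exists a => // y; rewrite inE => /predU1P[->//|yl] Py.
  exact: le_trans ax (h y yl Py).
exists x => // y; rewrite inE => /predU1P[->|/h//] Pa.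
by rewrite leNgt; apply/negP => ax; apply: na; split => //; apply: ltW.
Qed.

Lemma nrm_row (R : realType) m n (A : 'M[R]_(m, n)) i : nrm (row i A) <= nrm A.
Proof.
rewrite /nrm big_ord1 [leRHS](bigD1 i) //=; under eq_bigr do rewrite mxE.
by rewrite lerDl; apply: sumr_ge0 => k _; apply: sumr_ge0.
Qed.

(** * Limits of displacements *)

Section LimitGroup.
Variables (R : realType) (N : nat) (C : 'rV[R]_N -> Prop) (a : 'cV[R]_N) (m : R).
Variable G : 'M[R]_N -> Prop.
Hypothesis CA : convex_action C a m G.
Implicit Types (g h : 'M[R]_N).

Lemma cofactor_row (T T' : 'M[R]_N) i j : (forall r c, r != i -> T' r c = T r c) ->
  cofactor T' i j = cofactor T i j.
Proof.
move=> H; rewrite /cofactor; congr (_ * \det _); apply/matrixP => r c.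
by rewrite !mxE H // eq_sym neq_lift.
Qed.

(* Nearly maximizing the determinant gives coordinates in which the unit ball
   of the order norm at [x] lies between the unit simplex and a cube. *)
Lemma order_ball_basis x : C x -> exists T : 'M[R]_N, [/\ T \in unitmx,
  forall i, C (x + row i T) /\ C (x - row i T)
  & forall v, C (x + v) -> C (x - v) -> forall i, `|(v *m invmx T) 0 i| <= 2].
Proof.
move=> Cx.
pose ball (T : 'M[R]_N) := forall i, C (x + row i T) /\ C (x - row i T).
pose E := [set r : R | exists2 T, ball T & r = `|\det T|]%classic.
have ball_entry T : ball T -> forall i j, `|T i j| <= m * pair x a.
  move=> bT i j; have [h1 h2] := bT i.
  apply: le_trans (interval_bound CA h1 h2).
  by have := entry_le_nrm (row i T) 0 j; rewrite mxE.
have ubE : ubound E (#|{: 'S_N}|%:R * (m * pair x a) ^+ N).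
  by move=> _ [T bT ->]; apply: det_bound; apply: ball_entry.
have [e e0 he] := ca_open CA Cx.
pose q := e / (N.+1)%:R.
have q0 : 0 < q by rewrite divr_gt0.
have bq : ball q%:M.
  have nr i : nrm (row i (q%:M : 'M[R]_N)) < e.
    rewrite -scalemx1 linearZ /= nrmZ gtr0_norm // /q mulrAC ltr_pdivrMr //.
    rewrite ltr_pM2l //; apply: le_lt_trans (nrm_row _ _) _.
    by rewrite nrm1 ltr_nat.
  by move=> i; split; apply: he; rewrite addrC addKr ?nrmN.
have Eq : E (q ^+ N) by exists q%:M => //; rewrite det_scalar ger0_norm // exprn_ge0 // ltW.
have hs : has_sup E by split; [exists (q ^+ N)|exists (#|{: 'S_N}|%:R * (m * pair x a) ^+ N)].
have s0 : 0 < sup E by apply: lt_le_trans (ub_le_sup (proj2 hs) Eq); apply: exprn_gt0.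
(* Replacing a row by [v] multiplies the determinant by a coordinate of [v]. If the determinant is
   above half the supremum, this coordinate is at most 2, and no maximum has to be attained. *)
have s2 : 0 < sup E / 2 by lra.
have [_ [T bT ->] hT] := sup_adherent s2 hs.
have dT : sup E / 2 < `|\det T| by lra.
have uT : T \in unitmx.
  by rewrite unitmxE unitfE; apply/eqP => h; rewrite h normr0 in dT; lra.
exists T; split => // v h1 h2 i.
pose T' : 'M[R]_N := \matrix_(r, c) if r == i then v 0 c else T r c.
have T'i : row i T' = v by apply/rowP => j; rewrite !mxE eqxx.
have T'r r : r != i -> row r T' = row r T.
  by move=> ri; apply/rowP => j; rewrite !mxE (negPf ri).
have bT' : ball T'.
  by move=> r; have [->|ri] := eqVneq r i; rewrite ?T'i // T'r.
have E' : (v *m invmx T) 0 i = \det T' / \det T.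
  rewrite /invmx uT -scalemxAr mxE mulrC; congr (_ / _).
  rewrite (expand_det_row _ i) mxE; apply: eq_bigr => j _.
  rewrite mxE [T' i j]mxE eqxx; congr (_ * _); apply/esym/cofactor_row.
  by move=> r c ri; rewrite mxE (negPf ri).
have le_s : `|\det T'| <= sup E by apply: (ub_le_sup (proj2 hs)); exists T'.
rewrite E' normrM normfV ler_pdivrMr; lra.
Qed.

Variable x : nat -> 'rV[R]_N.
Hypothesis Cx : forall t, C (x t).
Hypothesis displaced : forall g, G g -> exists l, forall t, C (l *: x t - x t *m g).

Let T t := projT1 (cid (order_ball_basis (Cx t))).
Let TP t := projT2 (cid (order_ball_basis (Cx t))).
Let uT t : T t \in unitmx. Proof. by case: (TP t). Qed.
(** The action in the coordinates adapted to [x t], where bounded displacement becomes a bound on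
    the matrix. *)
Let A t g := T t *m g *m invmx (T t).

Let AM t g h : A t (g *m h) = A t g *m A t h.
Proof. by rewrite /A !mulmxA mulmxKV ?uT. Qed.

Let A1 t : A t 1%:M = 1%:M.
Proof. by rewrite /A mulmx1 mulmxV ?uT. Qed.

Let Abound t g l : G g -> C (l *: x t - x t *m g) -> nrm (A t g) <= (N * N)%:R * (2 * l).
Proof.
move=> Gg Cl.
have Cl' : C (l *: x t).
  by rewrite -(subrK (x t *m g) (l *: x t)); apply: (ca_add CA) => //; apply: (ca_act CA).
have l0 : 0 < l.
  have [h _] := ca_chart CA Cl'; rewrite pairZl in h; have [h' _] := ca_chart CA (Cx t).
  by rewrite pmulr_lgt0 in h.
have [_ b1 b2] := TP t; apply: nrm_le => i j.
have [r1 r2] := b1 i.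
have k1 := ca_add CA Cl (ca_act CA Gg r1); have k2 := ca_add CA Cl (ca_act CA Gg r2).
rewrite mulmxDl addrA subrK in k1; rewrite mulmxBl addrA subrK in k2.
have li : 0 < l^-1 by rewrite invr_gt0.
have := b2 (l^-1 *: (row i (T t) *m g)).
have K1 := ca_scale CA li k1; rewrite scalerDr scalerA mulVf ?scale1r ?gt_eqF // in K1.
have K2 := ca_scale CA li k2; rewrite scalerBr scalerA mulVf ?scale1r ?gt_eqF // in K2.
move=> /(_ K1 K2 j); rewrite -scalemxAl mxE normrM gtr0_norm // mulrC ler_pdivrMr //.
by rewrite /A -!row_mul mxE.
Qed.

Let theta_ex g : exists L, G g -> mlim (fun t => A t g) L.
Proof.
have [Gg|nG] := pselect (G g); last by exists 0.
have [l hl] := displaced Gg.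
by have [L hL] := mlim_ex (fun t => Abound Gg (hl t)); exists L.
Qed.
(** A homomorphism on [G]. Nothing makes it injective, which is why the shortest element is later
    chosen at a fixed time [t] and not in the limit. *)
Let theta g := projT1 (cid (theta_ex g)).
Let thetaP g : G g -> mlim (fun t => A t g) (theta g) := projT2 (cid (theta_ex g)).

Let thetaM g h : G g -> G h -> theta (g *m h) = theta g *m theta h.
Proof.
move=> Gg Gh; apply: (mlim_uniq (thetaP (ca_mul CA Gg Gh))).
by apply: mlim_ev (mlimM (thetaP Gg) (thetaP Gh)); apply: ev_true => t; rewrite AM.
Qed.

Let theta1 : theta 1%:M = 1%:M.
Proof.
apply: (mlim_uniq (thetaP (ca_one CA))); apply: mlim_ev (mlim_cst _).
by apply: ev_true => t; rewrite A1.
Qed.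

Let near1 d g := G g /\ nrm (theta g - 1%:M) < d.

(* For [d] small the elements of [near1 d] span a space [V] independent of [d], hence
   invariant under conjugation; the subgroup consists of the elements of [G] in the
   center of the algebra generated by [V].  It is nontrivial because, at a fixed
   time, the element moving least among those close to 1 commutes with the rest. *)
Lemma limit_normal_abelian L :
  ~ finite_pred (fun g => G g /\ exists t0, forall t, (t0 <= t)%N -> C (L *: x t - x t *m g)) ->
  normal_abelian G.
Proof.
move=> inf.
(* The infinitely many given elements have bounded limits, and so do their inverses; two of them
   therefore have a quotient with limit near 1. *)
have small d : 0 < d -> exists2 g, near1 d g & g != 1%:M.
  move=> d0; pose c := (N * N)%:R * (2 * L).
  have [b b0 hb] := @inv_bound R N c.
  have thc g : (G g /\ exists t0, forall t, (t0 <= t)%N -> C (L *: x t - x t *m g)) ->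
      nrm (theta g) <= c /\ nrm (theta (invmx g)) <= b.
    move=> [Gg [t0 h]].
    have Ac : ev (fun t => nrm (A t g) <= c).
      by apply: ev_sub (ev_ge t0) => t tt; apply: Abound => //; apply: h.
    split; first exact: mlim_bnd (thetaP Gg) Ac.
    apply: (mlim_bnd (thetaP (ca_inv CA Gg))); apply: ev_sub Ac => t h1.
    have ug := ca_unit CA Gg.
    have uA : A t g \in unitmx by rewrite /A !unitmx_mul uT ug unitmx_inv uT.
    have -> : A t (invmx g) = invmx (A t g).
      by rewrite -[RHS]mul1mx -(A1 t) -(mulVmx ug) AM -mulmxA mulmxV // mulmx1.
    apply: hb => //; rewrite /A !det_mulmx det_inv !normrM (ca_det CA Gg) mulr1.
    by rewrite -normrM mulfV ?normr1 // -unitfE -unitmxE uT.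
  have e0 : 0 < d / (b + 1) by rewrite divr_gt0 //; lra.
  have [g [h [Pg Ph gh near]]] := pigeonhole_mx inf (fun g p => proj1 (thc g p)) e0.
  have [Gg _] := Pg; have [Gh _] := Ph; have uh := ca_unit CA Gh.
  have Gi := ca_inv CA Gh.
  exists (g *m invmx h); last first.
    by apply: contra gh => /eqP E; rewrite -[g](mulmxKV uh) E mul1mx.
  split; first exact: (ca_mul CA).
  have -> : theta (g *m invmx h) - 1%:M = (theta g - theta h) *m theta (invmx h).
    by rewrite mulmxBl -!thetaM // mulmxV // theta1.
  apply: le_lt_trans (nrmM _ _) _; have := proj2 (thc h Ph).
  rewrite ltr_pdivlMr in near; last lra.
  by move=> k; apply: le_lt_trans near; rewrite ler_wpM2l ?nrm_ge0 //; lra.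
pose Pv (V : {vspace 'M[R]_N}) := exists2 d, 0 < d & exists s : seq 'M[R]_N,
  [/\ forall g, g \in s -> near1 d g, forall g, near1 d g -> g \in <<s>>%VS & V = <<s>>%VS].
have Pex d : 0 < d -> exists2 V, Pv V & exists s : seq 'M[R]_N,
    [/\ forall g, g \in s -> near1 d g, forall g, near1 d g -> g \in <<s>>%VS & V = <<s>>%VS].
  move=> d0; have [s [s1 s2]] := span_pred (near1 d).
  by exists <<s>>%VS; [exists d => //; exists s|exists s].
have [V0 PV0 _] := Pex 1 ltr01.
have [V [d0 d00 [s0 [s01 s02 VE]]] Vmin] := vspace_min PV0.
have near_le d g : d <= d0 -> near1 d g -> near1 d0 g.
  by move=> dd [Gg h]; split => //; apply: lt_le_trans dd.
have Vd d : 0 < d -> d <= d0 -> exists2 s : seq 'M[R]_N,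
    forall g, g \in s -> near1 d g & <<s>>%VS = V.
  move=> dp dd; have [V' PV' [s [s1 s2 V'E]]] := Pex d dp; exists s => //.
  rewrite -V'E; apply/eqP; rewrite eqEdim Vmin // andbT V'E.
  by apply/span_subvP => g /s1/(near_le _ _ dd); rewrite VE; apply: s02.
(* Commutant and bicommutant of [V]: elements of [G] lying in both commute with each other. *)
pose cent (b : 'M[R]_N) := forall v : 'M[R]_N, v \in V -> b *m v = v *m b.
pose bicent (z : 'M[R]_N) := forall b, cent b -> z *m b = b *m z.
have cent_of d b : 0 < d -> d <= d0 -> (forall g, near1 d g -> b *m g = g *m b) -> cent b.
  move=> dp dd H v; have [s s1 <-] := Vd d dp dd; move: v.
  apply: (@span_lin _ _ s (fun v => b *m v = v *m b)).
  - by rewrite mul0mx mulmx0.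
  - by move=> c u w hu hw; rewrite mulmxDl mulmxDr -scalemxAl -scalemxAr hu hw.
  by move=> g /s1; apply: H.
(* Conjugation by [g] multiplies the distance of a limit to 1 by at most [q], and the elements
   closer than [d0 / q] still span [V]. *)
have cent_conj g b : G g -> cent b -> cent (invmx g *m b *m g).
  move=> Gg cb; have ug := ca_unit CA Gg; have Gi := ca_inv CA Gg.
  have n1 := nrm_ge0 (theta g); have n2 := nrm_ge0 (theta (invmx g)).
  have q1 : 1 <= nrm (theta g) * nrm (theta (invmx g)) + 1 by rewrite lerDr mulr_ge0.
  set q := _ + 1 in q1.
  have qp : 0 < q by lra.
  apply: (@cent_of (d0 / q)); first exact: divr_gt0.
    by rewrite ler_pdivrMr // ler_peMr // ltW.
  move=> h [Gh hh].
  have hV : g *m h *m invmx g \in V.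
    rewrite VE; apply: s02; split; first by do 2 apply: (ca_mul CA) => //.
    have -> : theta (g *m h *m invmx g) - 1%:M = theta g *m (theta h - 1%:M) *m theta (invmx g).
      rewrite mulmxBr mulmxBl mulmx1 -!thetaM ?mulmxV ?theta1 //.
      exact: (ca_mul CA).
    apply: le_lt_trans (nrmM _ _) _.
    rewrite ltr_pdivlMr // in hh; apply: le_lt_trans hh.
    apply: (@le_trans _ _ (nrm (theta g) * nrm (theta h - 1%:M) * nrm (theta (invmx g)))).
      by rewrite ler_wpM2r // nrmM.
    by have := nrm_ge0 (theta h - 1%:M); rewrite /q; lra.
  have := cb _ hV => E.
  have E2 : b *m g *m h = g *m h *m invmx g *m b *m g.
    by rewrite -[LHS](mulmxKV ug) -E !mulmxA mulmxKV // -!mulmxA.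
  by rewrite -!mulmxA (mulmxA b) E2 !mulmxA mulVmx // mul1mx.
have bicentM z z' : bicent z -> bicent z' -> bicent (z *m z').
  by move=> hz hz' b cb; rewrite -mulmxA hz' // mulmxA hz // mulmxA.
have bicentV z : G z -> bicent z -> bicent (invmx z).
  move=> Gz hz b cb; have uz := ca_unit CA Gz.
  by rewrite -[b in LHS](mulmxK uz) -hz // !mulmxA mulVmx // mul1mx.
have V_bicent z : z \in V -> bicent z by move=> zV b cb; rewrite cb.
exists (fun z => [/\ G z, cent z & bicent z]); split.
- by move=> g [].
- split; first exact: ca_one CA.
    by move=> v _; rewrite mul1mx mulmx1.
  by move=> v _; rewrite mul1mx mulmx1.
- move=> g h [Gg cg bg] [Gh ch bh]; split; split.
  + exact: (ca_mul CA).
  + by move=> v vV; rewrite -mulmxA ch // mulmxA cg // mulmxA.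
  + exact: bicentM.
  + exact: (ca_inv CA).
  + by move=> v vV; have ug := ca_unit CA Gg;
      rewrite -[v in LHS](mulmxK ug) -cg // !mulmxA mulVmx // mul1mx.
  + exact: bicentV.
- move=> g h Gg [Gh ch bh]; have ug := ca_unit CA Gg; have Gi := ca_inv CA Gg.
  split; first by do 2 apply: (ca_mul CA) => //.
    exact: cent_conj.
  move=> b cb; have := cent_conj _ _ Gi cb; rewrite invmxK => /bh E.
  have E2 : h *m g *m b = g *m b *m invmx g *m h *m g.
    by rewrite -E !mulmxA mulmxKV.
  by rewrite -!mulmxA (mulmxA h) E2 !mulmxA mulVmx // mul1mx.
split; first by move=> g h [Gg cg bg] [Gh ch bh]; apply: bg.
(* For [d <= 1 / K] the inverses have norm at most [2 (N + 1)], so the commutator with [z] is at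
   distance at most [8 (N + 1)^2 d] times that of [z], that is at most half of it. *)
pose K : R := 16 * (N.+1%:R * N.+1%:R).
have N1 : 1 <= N.+1%:R :> R by rewrite ler1n.
have K16 : 16 <= K by rewrite /K; nra.
pose d := Num.min d0 K^-1.
have dp : 0 < d by rewrite lt_min d00 invr_gt0; lra.
have dd0 : d <= d0 by rewrite ge_min lexx.
have dK : d * K <= 1 by rewrite -ler_pdivlMr ?mul1r ?ge_min ?lexx ?orbT //; lra.
have [s s1 sV] := Vd d dp dd0.
have [g0 n0 g01] := small d dp.
have [t tP] : exists t, forall g, g \in g0 :: s -> nrm (A t g - 1%:M) < d.
  apply/ev_ex/ev_all => g; rewrite inE => gs.
  have [Gg hg] : near1 d g by case/predU1P: gs => [->|/s1].
  have := mlimD (thetaP Gg) (mlimN (mlim_cst 1%:M)) => lim.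
  exact: mlim_ltb lim hg.
(* Only bicentral elements compete: they include [g0], and commutators with the family [s] spanning
   [V] stay among them. *)
pose P z := [/\ G z, bicent z, z != 1%:M & nrm (A t z - 1%:M) <= d].
have P0 : P g0.
  split; [exact: n0.1| |by []|by apply/ltW/tP; rewrite mem_head].
  by apply: V_bicent; rewrite VE; apply/s02/near_le/n0.
have finP : finite_pred P.
  apply: finite_predS (bounded_finite CA (nrm (invmx (T t)) * (N%:R + d) * nrm (T t))).
  move=> z [Gz _ _ hz]; split => //.
  have -> : z = invmx (T t) *m A t z *m T t.
    by rewrite /A !mulmxA mulVmx ?uT // mul1mx mulmxKV ?uT.
  apply: le_trans (nrmM _ _) _; rewrite ler_wpM2r ?nrm_ge0 //.
  apply: le_trans (nrmM _ _) _; rewrite ler_wpM2l ?nrm_ge0 //.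
  have := nrmD (A t z - 1%:M) 1%:M; rewrite subrK nrm1; lra.
have [z [Gz bz z1 hz] zmin] := finite_argmin (fun z => nrm (A t z - 1%:M)) finP P0.
exists z => //; split => //.
have invb g : G g -> nrm (A t g - 1%:M) <= d -> nrm (A t (invmx g)) <= 2 * N.+1%:R.
  move=> Gg hg; have ug := ca_unit CA Gg; set B := A t (invmx g).
  have : B = 1%:M - (A t g - 1%:M) *m B by rewrite mulmxBl mul1mx opprB -AM mulmxV // A1 addrCA subrr addr0.
  move/(congr1 (@nrm _ _ _)) => h.
  have := nrmB 1%:M ((A t g - 1%:M) *m B); rewrite -h nrm1.
  have := nrmM (A t g - 1%:M) B; have nB := nrm_ge0 B; rewrite -natr1.
  have : nrm (A t g - 1%:M) * nrm B <= d * nrm B by rewrite ler_wpM2r.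
  have : d * nrm B <= 2^-1 * nrm B by rewrite ler_wpM2r //; nra.
  lra.
rewrite /cent -sV; apply: (@span_lin _ _ s (fun v => z *m v = v *m z)).
- by rewrite mul0mx mulmx0.
- by move=> c u w hu hw; rewrite mulmxDl mulmxDr -scalemxAl -scalemxAr hu hw.
move=> g gs; have [Gg ng] := s1 g gs.
have gd : nrm (A t g - 1%:M) < d by apply: tP; rewrite inE gs orbT.
have ug := ca_unit CA Gg; have uz := ca_unit CA Gz.
have Gi := ca_inv CA Gg; have Gzi := ca_inv CA Gz.
pose c := invmx z *m invmx g *m z *m g.
have Gc : G c by do 3 apply: (ca_mul CA) => //.
have bg : bicent g by apply: V_bicent; rewrite -sV memv_span.
have bc : bicent c by apply: (bicentM) => //; apply: (bicentM) => //; apply: (bicentM); apply: bicentV.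
have [c1|c1] := eqVneq c 1%:M.
  have : g *m z *m c = g *m z by rewrite c1 mulmx1.
  by rewrite /c !mulmxA mulmxK // mulmxV // mul1mx.
exfalso.
have zpos : 0 < nrm (A t z - 1%:M).
  apply: nrm_gt0; rewrite subr_eq0; apply: contra z1 => /eqP h.
  have -> : z = invmx (T t) *m A t z *m T t.
    by rewrite /A !mulmxA mulVmx ?uT // mul1mx mulmxKV ?uT.
  by rewrite h mulmx1 mulVmx ?uT.
have E : A t c - 1%:M = A t (invmx z) *m A t (invmx g) *m
   ((A t z - 1%:M) *m (A t g - 1%:M) - (A t g - 1%:M) *m (A t z - 1%:M)).
  have -> : (A t z - 1%:M) *m (A t g - 1%:M) - (A t g - 1%:M) *m (A t z - 1%:M) =
      A t (z *m g) - A t (g *m z).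
    rewrite !mulmxBl !mulmxBr !mul1mx !mulmx1 -!AM.
    by apply/matrixP => i j; rewrite !mxE; ring.
  rewrite mulmxBr -!AM /c !mulmxA mulmxKV // mulVmx // A1 //.
have nc : nrm (A t c - 1%:M) < nrm (A t z - 1%:M).
  rewrite E; apply: le_lt_trans (nrmM _ _) _.
  have h1 := nrmM (A t (invmx z)) (A t (invmx g)).
  have iz := invb z Gz hz; have ig := invb g Gg (ltW gd).
  have h2 : nrm (A t (invmx z)) * nrm (A t (invmx g)) <= (2 * N.+1%:R) * (2 * N.+1%:R).
    by apply: ler_pM; rewrite ?nrm_ge0.
  have h3 := nrmB ((A t z - 1%:M) *m (A t g - 1%:M)) ((A t g - 1%:M) *m (A t z - 1%:M)).
  have h4 := nrmM (A t z - 1%:M) (A t g - 1%:M).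
  have h5 := nrmM (A t g - 1%:M) (A t z - 1%:M).
  set y := nrm (A t z - 1%:M) in zpos h4 h5 *; set r := nrm (A t g - 1%:M) in gd h4 h5.
  set w := nrm (_ - _) in h3 *.
  have h6 : w <= 2 * (y * d).
    have : y * r <= y * d by rewrite ler_wpM2l // ltW.
    by lra.
  have w0 : 0 <= w by apply: nrm_ge0.
  apply: (@le_lt_trans _ _ ((2 * N.+1%:R) * (2 * N.+1%:R) * (2 * (y * d)))).
    by apply: ler_pM => //; [apply: nrm_ge0|apply: le_trans h2].
  have : y * (d * K) <= y * 1 by rewrite ler_wpM2l // ltW.
  by rewrite /K; lra.
have Pc : P c by split => //; apply: le_trans (ltW nc) hz.
by have := zmin c Pc; rewrite leNgt nc.
Qed.

End LimitGroup.

(** * Faces and dual faces *)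

Section Functionals.
Variables (R : realType) (N : nat).
Implicit Types (U : {vspace 'rV[R]_N}).

Lemma annihilator U v : v \notin U ->
  exists2 f : 'cV[R]_N, (forall u, u \in U -> pair u f = 0) & pair v f != 0.
Proof.
move=> vU; pose F := (\1 - projv U)%VF.
have FE w : F w = w - projv U w by rewrite add_lfunE opp_lfunE id_lfunE.
have Fv : F v != 0.
  by apply: contra vU; rewrite FE subr_eq0 => /eqP ->; apply: memv_proj.
have [i [j h]] := sumr_gt0_entry Fv; rewrite (ord1 i) in h.
have pE w : pair w (col j (lin1_mx F)) = F w 0 j.
  by rewrite /pair colE mulmxA mul_rV_lin1 -colE mxE.
exists (col j (lin1_mx F)); last by rewrite pE.
by move=> u uU; rewrite pE FE projv_id // subrr mxE.
Qed.

Lemma nonzero_functional (f : 'cV[R]_N) : f != 0 ->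
  exists2 v : 'rV[R]_N, nrm v = 1 & 0 < pair v f.
Proof.
move=> f0; have [i [j h]] := sumr_gt0_entry f0; rewrite (ord1 j) in h.
exists (Num.sg (f i 0) *: delta_mx 0 i).
  rewrite nrmZ normr_sg h mul1r /nrm big_ord1 (bigD1 i) //= mxE !eqxx normr1.
  by rewrite big1 ?addr0 // => k ki; rewrite mxE (negPf ki) andbF normr0.
by rewrite pairZl pair_delta -normrEsg normr_gt0.
Qed.

(** Serves for the face in an invariant subspace and for the dual face. The sum [y] of a spanning
    family of the cone is an order unit of the span, that is a relative interior point; minimality
    of the span will give its invariance. *)
Lemma cone_span_unit (P : 'rV[R]_N -> Prop) :
  P 0 -> (forall u v, P u -> P v -> P (u + v)) ->
  (forall c v, 0 <= c -> P v -> P (c *: v)) ->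
  exists U y k, [/\ forall v, P v -> v \in U, y \in U, P y,
    0 <= k /\ forall u, u \in U -> P ((k * nrm u) *: y - u)
    & forall W : {vspace 'rV[R]_N}, (forall v, P v -> v \in W) -> (U <= W)%VS].
Proof.
move=> P0 PD PZ; have [s [s1 s2]] := span_pred P.
pose U := <<s>>%VS; pose y := \sum_(i < size s) s`_i.
have Psum I (r : seq I) (F : I -> 'rV[R]_N) : (forall i, P (F i)) -> P (\sum_(i <- r) F i).
  by move=> h; elim/big_rec: _ => // i x _; apply: PD.
have Psi (i : 'I_(size s)) : P s`_i by apply/s1/mem_nth.
have Py : P y by apply: Psum.
have pt u : u \in U -> exists2 c, 0 <= c & P (c *: y - u).
  move=> /(@coord_span _ _ _ (in_tuple s)) uE.
  pose ci i := coord (in_tuple s) i u; pose c := \sum_i `|ci i|.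
  exists c; first by apply: sumr_ge0.
  have -> : c *: y - u = \sum_(i < size s) (c - ci i) *: s`_i.
    rewrite scaler_sumr {1}uE -sumrB; apply: eq_bigr => i _.
    by rewrite scalerBl.
  apply: Psum => i; apply: PZ => //; rewrite subr_ge0 (le_trans (ler_norm _)) //.
  by rewrite /c (bigD1 i) //= lerDl sumr_ge0.
pose B := vbasis U.
have Bi (i : 'I_(\dim U)) : B`_i \in U.
  by apply: vbasis_mem; apply: mem_nth; rewrite size_tuple.
have BNi (i : 'I_(\dim U)) : - B`_i \in U by rewrite memvN.
pose c1 i := projT1 (cid2 (pt _ (Bi i))).
pose c2 i := projT1 (cid2 (pt _ (BNi i))).
have h1 i : 0 <= c1 i /\ P (c1 i *: y - B`_i) by rewrite /c1; case: cid2.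
have h2 i : 0 <= c2 i /\ P (c2 i *: y - - B`_i) by rewrite /c2; case: cid2.
have cb i : exists2 c, 0 <= c & forall v, `|coord B i v| <= c * nrm v.
  pose f (v : 'rV[R]_N) : 'M[R]_1 := (coord B i v)%:M.
  have fl : linear f by move=> c u v; rewrite /f linearP /= raddfD /= scale_scalar_mx.
  have [c c0 H] := nrm_linear fl; exists c => // v; apply: le_trans (H v).
  by have := entry_le_nrm (f v) 0 0; rewrite mxE eqxx mulr1n.
pose b i := projT1 (cid2 (cb i)).
have hb i : 0 <= b i /\ forall v, `|coord B i v| <= b i * nrm v by rewrite /b; case: cid2.
pose k := \sum_i b i * (c1 i + c2 i).
have k0 : 0 <= k.
  apply: sumr_ge0 => i _; apply: mulr_ge0; first by case: (hb i).
  by apply: addr_ge0; [case: (h1 i)|case: (h2 i)].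
exists U, y, k; split => //.
- by rewrite memv_suml // => i _; apply/s2.
- split => // u uU.
  have -> : (k * nrm u) *: y - u =
      \sum_i ((b i * (c1 i + c2 i) * nrm u) *: y - coord B i u *: B`_i).
    rewrite big_split /= sumrN -(coord_vbasis uU) -scaler_suml /k mulr_suml.
    by [].
  apply: Psum => i; have [b0 bi] := hb i; have [p1 q1] := h1 i; have [p2 q2] := h2 i.
  set t := coord B i u; have tb : `|t| <= b i * nrm u by apply: bi.
  have nu := nrm_ge0 u.
  have [t0|t0] := lerP 0 t.
    have -> : (b i * (c1 i + c2 i) * nrm u) *: y - t *: B`_i =
        t *: (c1 i *: y - B`_i) + (b i * (c1 i + c2 i) * nrm u - t * c1 i) *: y.
      by rewrite scalerBr scalerBl !scalerA; apply/rowP => j; rewrite !mxE; ring.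
    rewrite ger0_norm // in tb; apply: PD; apply: PZ => //.
    have := ler_wpM2r p1 tb; have : 0 <= b i * nrm u * c2 i by rewrite !mulr_ge0.
    lra.
  have -> : (b i * (c1 i + c2 i) * nrm u) *: y - t *: B`_i =
      (- t) *: (c2 i *: y - - B`_i) + (b i * (c1 i + c2 i) * nrm u + t * c2 i) *: y.
    by apply/rowP => j; rewrite !mxE; ring.
  rewrite ltr0_norm // in tb; apply: PD; apply: PZ => //; first by lra.
  have := ler_wpM2r p2 tb; have : 0 <= b i * nrm u * c1 i by rewrite !mulr_ge0.
  lra.
- by move=> W h; apply/span_subvP => v /s1/h.
Qed.

End Functionals.

Section ConeFunctionals.
Variables (R : realType) (N : nat) (C : 'rV[R]_N -> Prop) (a : 'cV[R]_N) (m : R).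
Variable G : 'M[R]_N -> Prop.
Hypothesis CA : convex_action C a m G.
Variable x : 'rV[R]_N.
Hypothesis Cx : C x.
Variable U : {vspace 'rV[R]_N}.

Lemma functional_vanish f : (forall c u, C c -> u \in U -> 0 < pair (c + u) f) ->
  forall u, u \in U -> pair u f = 0.
Proof.
move=> H u uU; have px : 0 < pair x f by rewrite -[x]addr0 H ?mem0v.
apply: contrapT => /eqP pu.
have := H x ((- (pair x f) / pair u f) *: u) Cx.
by rewrite memvZ // pairDl pairZl divfK // subrr ltxx => /(_ isT).
Qed.

(** Otherwise the open cone of all [c + u - r v] misses 0. A functional positive on it lies in the
    dual face, hence is positive at [v], and so vanishes at some [x - r v]. *)
Lemma bipolar v : (forall u, u \in U -> ~ C u) ->
  (forall f, f != 0 -> (forall c, C c -> 0 <= pair c f) ->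
     (forall u, u \in U -> pair u f = 0) -> 0 < pair v f) ->
  exists2 u, u \in U & C (v + u).
Proof.
move=> UC H; apply: contrapT => nv.
pose D w := exists c u r, [/\ C c, u \in U, 0 <= r & w = c + u - r *: v].
have Dadd w w' : D w -> D w' -> D (w + w').
  move=> [c [u [r [Cc uU r0 ->]]]] [c' [u' [r' [Cc' uU' r0' ->]]]].
  exists (c + c'), (u + u'), (r + r'); split; rewrite ?memvD ?addr_ge0 //.
    exact: (ca_add CA).
  by apply/rowP => j; rewrite !mxE; ring.
have Dscale t w : 0 < t -> D w -> D (t *: w).
  move=> t0 [c [u [r [Cc uU r0 ->]]]].
  exists (t *: c), (t *: u), (t * r); split; rewrite ?memvZ ?mulr_ge0 // ?ltW //.
    exact: (ca_scale CA).
  by apply/rowP => j; rewrite !mxE; ring.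
have Dopen w : D w -> exists2 e, 0 < e & forall w', nrm (w' - w) < e -> D w'.
  move=> [c [u [r [Cc uU r0 ->]]]]; have [e e0 he] := ca_open CA Cc.
  exists e => // w' hw'; exists (c + (w' - (c + u - r *: v))), u, r; split => //.
    by apply: he; rewrite addrC addKr.
  by apply/rowP => j; rewrite !mxE; ring.
have DC c u r : C c -> u \in U -> 0 <= r -> D (c + u - r *: v) by exists c, u, r.
have Dx : D x by have := DC x 0 0 Cx (mem0v _) (lexx _); rewrite scale0r subr0 addr0.
have [|f fpos] := open_cone_functional Dadd Dscale Dopen Dx.
  move=> [c [u [r [Cc uU r0 E]]]].
  have [r1|r1] := eqVneq r 0.
    apply: (UC (- u)); first by rewrite memvN.
    have -> : - u = c; last by [].
    by apply/eqP; rewrite eq_sym -addr_eq0 E r1 scale0r subr0.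
  have rp : 0 < r by rewrite lt_neqAle eq_sym r1.
  apply: nv; exists (- r^-1 *: u); first by rewrite memvZ.
  have -> : v + - r^-1 *: u = r^-1 *: c.
    apply: (scalerI r1); rewrite scalerDr !scalerA mulrN divff // scale1r scaleN1r.
    by move/eqP: E; rewrite eq_sym subr_eq0 => /eqP <-; rewrite addrK.
  by apply: (ca_scale CA) => //; rewrite invr_gt0.
have fC c : C c -> 0 < pair c f.
  by move=> Cc; have := fpos _ (DC c 0 0 Cc (mem0v _) (lexx _)); rewrite scale0r subr0 addr0.
have fU : forall u, u \in U -> pair u f = 0.
  apply: functional_vanish => c u Cc uU.
  by have := fpos _ (DC c u 0 Cc uU (lexx _)); rewrite scale0r subr0.
have fv : 0 < pair v f.
  apply: H => //; last by move=> c /fC/ltW.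
  by apply/eqP => f0; have := fC x Cx; rewrite f0 pair0r ltxx.
have := fpos _ (DC x 0 (pair x f / pair v f) Cx (mem0v _) _).
rewrite addr0 pairBl pairZl divfK ?gt_eqF // subrr ltxx => F.
by have /F: 0 <= pair x f / pair v f by rewrite divr_ge0 // ltW // fC.
Qed.

(** The cone [C + U] fattened by a small multiple of the height still misses 0, by compactness. A
    functional positive on the fattened cone vanishes on [U] and is bounded below on the slice of
    [C]. *)
Lemma transversal_functional : (forall u, u \in U -> cl C u -> u = 0) ->
  exists f k, (forall u, u \in U -> pair u f = 0) /\
    forall v, C v -> nrm v <= k * pair v f.
Proof.
move=> UC.
pose D e w := exists c u, [/\ C c, u \in U & nrm (w - c - u) < e * pair c a].
have [n nD] : exists n : nat, ~ D n.+1%:R^-1 0.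
  apply: contrapT => h.
  have K (n : nat) : exists p : 'rV[R]_N * 'rV[R]_N, [/\ C p.1, p.2 \in U,
      pair p.1 a = 1 & nrm (p.1 - p.2) <= 1 * n.+1%:R^-1].
    have [c [u [Cc uU hcu]]] : D n.+1%:R^-1 0 by apply: contrapT => nD; apply: h; exists n.
    have [pc _] := ca_chart CA Cc; have pi : 0 < (pair c a)^-1 by rewrite invr_gt0.
    exists ((pair c a)^-1 *: c, - (pair c a)^-1 *: u) => /=; split.
    - exact: (ca_scale CA).
    - by rewrite memvZ.
    - by rewrite pairZl mulVf // gt_eqF.
    rewrite scaleNr opprK -scalerDr nrmZ gtr0_norm // mul1r ler_pdivrMl // mulrC.
    by apply: ltW; move: hcu; rewrite sub0r -opprD nrmN.
  pose c n := (projT1 (cid (K n))).1; pose u n := (projT1 (cid (K n))).2.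
  have P n := projT2 (cid (K n)).
  have [|c0 cL] := @mlim_ex _ _ _ c `|m|.
    move=> n; have [Cc _ pc _] := P n; have [_] := ca_chart CA Cc.
    by rewrite pc mulr1 => h1; apply: le_trans h1 (ler_norm _).
  have uL : mlim u c0.
    have d0 : mlim (fun n => c n - u n) 0.
      by apply: (@mlim_small _ _ _ _ 1) => //; apply: ev_true => n; have [] := P n.
    have := mlimD cL (mlimN d0); rewrite oppr0 addr0; apply: mlim_ev.
    by apply: ev_true => n; rewrite opprB addrC subrK.
  have cU : c0 \in U.
    rewrite -[c0]mulmx1; have := @mlim_uniq R 1 N (fun n => projv U (u n)) (projv U c0) c0.
    move=> E; rewrite mulmx1 -E ?memv_proj //.
      by apply: (mlim_lin _ uL) => t v w; rewrite linearP.
    by apply: mlim_ev uL; apply: ev_true => n; have [_ ? _ _] := P n; rewrite projv_id.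
  have ccl : cl C c0.
    apply: (cl_lim (action_salient CA _) cL); first by exists x.
    by apply: ev_true => n; have [? _ _ _] := P n; apply: (cl_cone (action_salient CA (ex_intro _ x Cx))).
  have : (1%:M : 'M[R]_1) = 0.
    rewrite -(mul0mx _ a) -(UC _ cU ccl).
    apply: (@mlim_uniq _ _ _ (fun n => c n *m a)); last exact: mlimM cL (mlim_cst a).
    apply: mlim_ev (mlim_cst _); apply: ev_true => n; have [_ _ pc _] := P n.
    by rewrite [RHS]mx11_scalar -/(pair _ _) pc.
  by move/matrixP/(_ 0 0); rewrite !mxE /= => /eqP; rewrite oner_eq0.
pose e : R := n.+1%:R^-1; have e0 : 0 < e by rewrite invr_gt0.
have Dadd w w' : D e w -> D e w' -> D e (w + w').
  move=> [c [u [Cc uU h]]] [c' [u' [Cc' uU' h']]].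
  exists (c + c'), (u + u'); split; rewrite ?memvD //; first exact: (ca_add CA).
  have -> : w + w' - (c + c') - (u + u') = (w - c - u) + (w' - c' - u').
    by apply/rowP => j; rewrite !mxE; ring.
  by apply: le_lt_trans (nrmD _ _) _; rewrite pairDl mulrDr ltrD.
have Dscale t w : 0 < t -> D e w -> D e (t *: w).
  move=> t0 [c [u [Cc uU h]]]; exists (t *: c), (t *: u); split; rewrite ?memvZ //.
    exact: (ca_scale CA).
  by rewrite -!scalerBr nrmZ pairZl gtr0_norm // mulrCA ltr_pM2l.
have Dopen w : D e w -> exists2 r, 0 < r & forall w', nrm (w' - w) < r -> D e w'.
  move=> [c [u [Cc uU h]]]; exists (e * pair c a - nrm (w - c - u)); first by lra.
  move=> w' hw'; exists c, u; split => //.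
  have -> : w' - c - u = (w' - w) + (w - c - u) by apply/rowP => j; rewrite !mxE; ring.
  by apply: le_lt_trans (nrmD _ _) _; lra.
have DC c u w : C c -> u \in U -> nrm w < e * pair c a -> D e (c + u + w).
  move=> Cc uU hw; exists c, u; split => //.
  by have -> : c + u + w - c - u = w by apply/rowP => j; rewrite !mxE; ring.
have epos c : C c -> 0 < e * pair c a by move=> /(ca_chart CA)[? _]; rewrite mulr_gt0.
have DCU c u : C c -> u \in U -> D e (c + u).
  by move=> Cc uU; rewrite -[c + u]addr0; apply: DC => //; rewrite nrm0 epos.
have Dx : D e x by rewrite -[x]addr0; apply: DCU; rewrite ?mem0v.
have [f fpos] := open_cone_functional Dadd Dscale Dopen Dx nD.
have fU := functional_vanish (fun c u Cc uU => fpos _ (DCU c u Cc uU)).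
have f0 : f != 0 by apply/eqP => f0; have := fpos _ Dx; rewrite f0 pair0r ltxx.
have [v nv pv] := nonzero_functional f0.
exists f, (`|m| * (2 / (e * pair v f))); split => // c Cc.
have [pc nc] := ca_chart CA Cc.
have := fpos (c + 0 + (- (e / 2 * pair c a)) *: v); rewrite addr0 pairDl pairZl => F.
have {}F : 0 < pair c f + - (e / 2 * pair c a) * pair v f.
  apply: F; rewrite -[c in c + _]addr0; apply: DC; rewrite ?mem0v //.
  rewrite nrmZ nv mulr1 normrN gtr0_norm; first by have := epos c Cc; lra.
  by rewrite !mulr_gt0 // invr_gt0.
have ev0 : 0 < e * pair v f by rewrite mulr_gt0.
apply: le_trans nc _; apply: (@le_trans _ _ (`|m| * pair c a)).
  by rewrite ler_wpM2r ?ler_norm // ltW.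
rewrite -!mulrA ler_wpM2l // mulrA mulrAC ler_pdivlMr //; lra.
Qed.

End ConeFunctionals.

(** * Cocompact actions *)

Section Cocompact.
Variables (R : realType) (N : nat) (C : 'rV[R]_N -> Prop) (a : 'cV[R]_N) (m : R).
Variable G : 'M[R]_N -> Prop.
Hypothesis CA : convex_action C a m G.
Variable x : 'rV[R]_N.
Hypothesis Cx : C x.
Variable U : {vspace 'rV[R]_N}.
Hypothesis UG : forall g u, G g -> u \in U -> u *m g \in U.

(** The compact set of representatives is replaced by the bounded and uniformly interior points, up
    to scale. *)
Definition cocompact_action e b := forall v, C v ->
  exists g k c, [/\ G g, thick C e b k, 0 < c & v = c *: (k *m g)].

Lemma cone_larger c l v w : C v -> c <= l -> C (c *: v - w) -> C (l *: v - w).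
Proof.
move=> Cv; rewrite le_eqVlt => /predU1P[-> //|cl] h.
have -> : l *: v - w = (c *: v - w) + (l - c) *: v.
  by apply/rowP => j; rewrite !mxE; ring.
by apply: (ca_add CA) => //; apply: (ca_scale CA) => //; rewrite subr_gt0.
Qed.

(* Every point is at bounded distance from [U], which fails near a point of
   the frontier at which some supporting hyperplane misses the closure of [U]. *)
Lemma cocompact_avoids_interior e b u0 : 0 < e -> cocompact_action e b ->
  U != fullv -> u0 \in U -> C u0 -> False.
Proof.
move=> e0 cc Uf u0U Cu0.
have [v vU] : exists v, v \notin U.
  apply: contrapT => h; move/eqP: Uf; apply; apply/vspaceP => v; rewrite memvf.
  by apply: contrapT => vU; apply: h; exists v; apply/negP => h2; apply: vU; rewrite h2.
have [f fU fv] := annihilator vU.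
have f0 : f != 0 by apply: contra fv => /eqP ->; rewrite pair0r.
have [p np fp] := nonzero_functional f0.
pose E := [set r : R | exists2 v, C v & r = pair v f / pair v a]%classic.
have ubE : ubound E (`|m| * nrm f).
  move=> _ [c Cc ->]; have [pc nc] := ca_chart CA Cc; rewrite ler_pdivrMr //.
  apply: le_trans (ler_norm _) _; apply: le_trans (pair_le _ _) _.
  rewrite mulrAC ler_wpM2r ?nrm_ge0 //; apply: le_trans nc _.
  by rewrite ler_wpM2r ?ler_norm // ltW.
have hs : has_sup E by split; [exists (pair x f / pair x a), x|exists (`|m| * nrm f)].
have s0 : 0 < sup E.
  have [r r0 hr] := ca_open CA Cu0.
  have Cp : C (u0 + (r / 2) *: p).
    by apply: hr; rewrite addrC addKr nrmZ np mulr1 gtr0_norm; lra.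
  have [pp _] := ca_chart CA Cp.
  apply: (@lt_le_trans _ _ (pair (u0 + (r / 2) *: p) f / pair (u0 + (r / 2) *: p) a)).
    by rewrite divr_gt0 // pairDl pairZl (fU u0) // add0r mulr_gt0 // divr_gt0.
  by apply: (ub_le_sup (proj2 hs)); exists (u0 + (r / 2) *: p).
have [e1 [e10 tu0]] := cone_thick CA Cu0.
pose B := `|b| + nrm u0 + 1.
have nu := nrm_ge0 u0; have nb := normr_ge0 b.
have B0 : 0 < B by rewrite /B; lra.
pose L := 2 * B / e + 2 * B / e1 + 1.
have L1 : 2 * B / e <= L /\ 2 * B / e1 <= L /\ 1 <= L.
  have : 0 < 2 * B / e by rewrite divr_gt0 // mulr_gt0.
  have : 0 < 2 * B / e1 by rewrite divr_gt0 // mulr_gt0.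
  by rewrite /L; lra.
have near c : C c -> exists u, [/\ u \in U, C (L *: c - u) & C (L *: u - c)].
  move=> /cc[g [k [t [Gg tk t0 ->]]]].
  have Ck := thick_cone e0 tk.
  exists (t *: (u0 *m g)); split; first by rewrite memvZ // UG.
    have -> : L *: (t *: (k *m g)) - t *: (u0 *m g) = t *: ((L *: k - u0) *m g).
      by rewrite mulmxBl -scalemxAl scalerBr !scalerA mulrC.
    apply: (ca_scale CA) => //; apply: (ca_act CA) => //.
    have uB : nrm u0 <= B by rewrite /B; lra.
    have [h _] := thick_unit CA e0 tk B0 uB.
    by apply: cone_larger h => //; lra.
  have -> : L *: (t *: (u0 *m g)) - t *: (k *m g) = t *: ((L *: u0 - k) *m g).
    by rewrite mulmxBl -scalemxAl scalerBr !scalerA mulrC.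
  apply: (ca_scale CA) => //; apply: (ca_act CA) => //.
  have kB : nrm k <= B.
    by apply: le_trans tk.1 _; have := ler_norm b; rewrite /B; lra.
  have [h _] := thick_unit CA e10 tu0 B0 kB.
  by apply: cone_larger h => //; lra.
(* [L c] dominates [u], where [f] vanishes, and the height of [u] is at least that of [c] divided by
   [L]. So a fixed fraction of the height of [c] is lost for [f], and the supremum contracts. *)
have key c : C c -> pair c f / pair c a <= sup E * (1 - (L * L)^-1).
  move=> Cc; have [u [uU h1 h2]] := near c Cc.
  have [pc _] := ca_chart CA Cc.
  have S w : C w -> pair w f <= sup E * pair w a.
    move=> Cw; have [pw _] := ca_chart CA Cw; rewrite -ler_pdivrMr //.
    by apply: (ub_le_sup (proj2 hs)); exists w.
  have := S _ h1; rewrite !pairBl !pairZl (fU u) // subr0 => k1.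
  have [k2 _] := ca_chart CA h2; rewrite pairBl pairZl in k2.
  have LL : 0 < L * L by nra.
  rewrite ler_pdivrMr // -(ler_pM2l LL).
  have -> : L * L * (sup E * (1 - (L * L)^-1) * pair c a) =
            L * (sup E * (L * pair c a)) - sup E * pair c a.
    by rewrite mulrBr mulr1 mulrBl mulrBr mulrA; congr (_ - _); [ring|rewrite !mulrA -(mulrA _ _ (sup E)); field; lra].
  have : L * (L * pair c f) <= L * (sup E * (L * pair c a - pair u a)).
    by rewrite ler_wpM2l //; lra.
  have : sup E * pair c a <= sup E * (L * pair u a) by rewrite ler_wpM2l; lra.
  lra.
have : sup E <= sup E * (1 - (L * L)^-1).
  apply: ge_sup; first by exists (pair x f / pair x a), x.
  by move=> _ [c Cc ->]; apply: key.
have : 0 < (L * L)^-1 by rewrite invr_gt0; nra.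
nra.
Qed.

(* The slices of the cone parallel to [U] are uniformly balanced about each of
   their points, which fails near the boundary of a slice. *)
Lemma cocompact_meets_closure e b u1 : 0 < e -> cocompact_action e b ->
  u1 \in U -> u1 != 0 -> (forall u, u \in U -> cl C u -> u = 0) -> False.
Proof.
move=> e0 cc u1U u10 Ucl.
have [f [k [fU fk]]] := transversal_functional CA Cx Ucl.
pose B := `|b| + `|k| * (`|b| * nrm f) + 1.
have nf := nrm_ge0 f; have nb := normr_ge0 b.
have h0 : 0 <= `|k| * (`|b| * nrm f) by rewrite !mulr_ge0.
have B0 : 0 < B by rewrite /B; lra.
pose l := (2 * B / e)^-1.
have q0 : 0 < 2 * B / e by rewrite divr_gt0 // mulr_gt0.
have l0 : 0 < l by rewrite invr_gt0.
(* Once [c] is moved to a thick point [z], the displacement [u'] is bounded: [f] ignores [u'], so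
   its value at [z] bounds the norm of [z + u']. *)
have balance c u : C c -> u \in U -> C (c + u) -> C (c - l *: u).
  move=> /cc[g [z [t [Gg tz t0 ->]]]] uU Cu.
  pose u' := t^-1 *: (u *m invmx g).
  have Gi := ca_inv CA Gg.
  have uE : u = t *: (u' *m g).
    by rewrite -scalemxAl (actVK CA) // scalerA mulfV ?scale1r // gt_eqF.
  have u'U : u' \in U by rewrite memvZ // UG.
  have Czu : C (z + u').
    have ti : 0 < t^-1 by rewrite invr_gt0.
    have := ca_scale CA ti (ca_act CA Gi Cu); rewrite mulmxDl scalerDr -scalemxAl.
    by rewrite (actV CA) // scalerA mulVf ?scale1r // gt_eqF.
  have nu' : nrm u' <= B.
    have h1 := fk _ Czu; rewrite pairDl (fU u') // addr0 in h1.
    have h2 := pair_le z f; have := nrmB (z + u') z; rewrite addrC addKr => h3.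
    have zb : nrm z <= `|b| by apply: le_trans tz.1 (ler_norm _).
    have h4 : k * pair z f <= `|k| * (`|b| * nrm f).
      apply: le_trans (ler_norm _) _; rewrite normrM ler_wpM2l //.
      by apply: le_trans h2 _; rewrite ler_wpM2r.
    by rewrite /B; lra.
  have [h _] := thick_unit CA e0 tz B0 nu'.
  have -> : t *: (z *m g) - l *: u = t *: ((l *: ((2 * B / e) *: z - u')) *m g).
    have -> : l *: ((2 * B / e) *: z - u') = z - l *: u'.
      by rewrite scalerBr scalerA mulVf ?scale1r // gt_eqF.
    by rewrite mulmxBl scalerBr -scalemxAl {1}uE !scalerA [l * t]mulrC.
  apply: (ca_scale CA) => //; apply: (ca_act CA) => //.
  exact: (ca_scale CA).
pose E := [set s : R | C (x + s *: u1)]%classic.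
have nu1 : 0 < nrm u1 by apply: nrm_gt0.
have ubE : ubound E ((nrm x + k * pair x f) / nrm u1).
  move=> s Cs; rewrite ler_pdivlMr //; have := fk _ Cs.
  rewrite pairDl pairZl (fU u1) // mulr0 addr0 => h.
  have := nrmB (x + s *: u1) x; rewrite addrC addKr nrmZ => h2.
  have : s * nrm u1 <= `|s| * nrm u1 by rewrite ler_wpM2r ?ler_norm // ltW.
  lra.
have hs : has_sup E.
  split; first by exists 0; rewrite /E /= scale0r addr0.
  by exists ((nrm x + k * pair x f) / nrm u1).
have s0 : 0 < sup E.
  have [r r0 hr] := ca_open CA Cx; pose s := r / (2 * nrm u1).
  have sp : 0 < s by rewrite divr_gt0 // mulr_gt0.
  apply: (lt_le_trans sp); apply: (ub_le_sup (proj2 hs)); apply: hr.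
  rewrite addrC addKr nrmZ (gtr0_norm sp).
  have -> : s * nrm u1 = r / 2 by rewrite /s; field; rewrite gt_eqF.
  lra.
(* Seen from [x + s u1], the point [x] is at displacement [- s u1], so by balance [(1 + l) s] is in
   [E] too. A bounded set with positive supremum is not stable under this dilation. *)
have : ubound E (sup E / (1 + l)).
  move=> s Cs; rewrite ler_pdivlMr; last lra.
  apply: (ub_le_sup (proj2 hs)).
  have := balance _ (- s *: u1) Cs; rewrite memvZ // scaleNr addrK => /(_ isT Cx).
  by rewrite /E /= scalerN opprK scalerA mulrDr mulr1 scalerDl addrA [l * s]mulrC.
move=> /(ge_sup (proj1 hs)); rewrite ler_pdivlMr; last lra.
by nra.
Qed.

Section Face.
Variables (y : 'rV[R]_N) (k : R).
Hypothesis yU : y \in U.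
Hypothesis ycl : cl C y.
Hypothesis yunit : forall u, u \in U -> cl C ((k * nrm u) *: y - u).
Hypothesis UC : forall u, u \in U -> ~ C u.

Let cC : salient_cone C := action_salient CA (ex_intro _ x Cx).

Lemma face_bound u c : u \in U -> k * nrm u <= c -> cl C (c *: y - u).
Proof.
move=> uU h; have -> : c *: y - u = ((k * nrm u) *: y - u) + (c - k * nrm u) *: y.
  by apply/rowP => j; rewrite !mxE; ring.
by apply: cl_add; [exact: yunit|apply: (cl_scale cC) => //; rewrite subr_ge0].
Qed.

Lemma ray_cone (t : R) : 0 <= t -> C (x + t *: y).
Proof. by move=> t0; rewrite addrC; apply: (cl_scale cC). Qed.

(** [y] is an order unit of the invariant [U], so [y *m g] is below a multiple of [y], with the same
    factor for all [t]. *)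
Lemma ray_displacement g : G g -> exists l, forall t : R, 0 <= t ->
  C (l *: (x + t *: y) - (x + t *: y) *m g).
Proof.
move=> Gg; have [c c0 hc] := order_unit cC Cx.
pose l1 := c * (nrm (x *m g) + 1); pose l2 := `|k * nrm (y *m g)|.
have n1 := nrm_ge0 (x *m g).
have l10 : 0 < l1 by rewrite mulr_gt0 //; lra.
have h1 : C (l1 *: x - x *m g) by apply: hc; lra.
exists (l1 + l2) => t t0.
have -> : (l1 + l2) *: (x + t *: y) - (x + t *: y) *m g =
    (l2 *: x + t *: ((l1 + l2) *: y - y *m g)) + (l1 *: x - x *m g).
  by rewrite mulmxDl -scalemxAl; apply/rowP => j; rewrite !mxE; ring.
suff h2 : cl C (l2 *: x + t *: ((l1 + l2) *: y - y *m g)) by apply: h2.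
apply: cl_add; first by apply: (cl_scale cC); [exact: normr_ge0|exact: cl_cone].
apply: (cl_scale cC) => //; apply: face_bound; first exact: UG.
by have := ler_norm (k * nrm (y *m g)); rewrite /l2; lra.
Qed.

(** [P] collects the elements relating points of the ray to thick points. If it were finite, the ray
    would stay at bounded distance from [x] and [y] would be interior. *)
Lemma cocompact_face_normal_abelian e b (s : seq 'M[R]_N) : 0 < e -> cocompact_action e b ->
  y != 0 -> (forall g, g \in s -> G g) ->
  (forall z, G z -> (forall g, g \in s -> z *m g = g *m z) ->
     forall g, G g -> z *m g = g *m z) ->
  normal_abelian G.
Proof.
move=> e0 cc y0 sG gen.
pose P p := G p /\ exists t q c, [/\ 0 <= t, thick C e b q, 0 < c & x + t *: y = c *: (q *m p)].
apply: (conj_finite_normal_abelian CA (P := P) sG gen); first by move=> p [].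
- move=> [l lP].
  pose Bi := \sum_(p <- l) nrm (invmx p) + 1; pose Bp := \sum_(p <- l) nrm p.
  have Bi1 : 1 <= Bi by rewrite lerDr sumr_ge0 // => p _; apply: nrm_ge0.
  have pl p : p \in l -> nrm (invmx p) < Bi /\ nrm p <= Bp.
    move=> pl; rewrite /Bi /Bp !(big_rem p pl) /=.
    have : 0 <= \sum_(y0 <- rem p l) nrm (invmx y0) by apply: sumr_ge0 => i _; apply: nrm_ge0.
    have : 0 <= \sum_(y0 <- rem p l) nrm y0 by apply: sumr_ge0 => i _; apply: nrm_ge0.
    lra.
  have ya : 0 < pair y a.
    have [h1 h2] := action_cl_chart CA ycl (ex_intro _ x Cx).
    rewrite lt_neqAle h1 andbT; apply/eqP => h; move/eqP: y0; apply; apply: nrm_eq0.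
    by apply/eqP; rewrite eq_le nrm_ge0 andbT; rewrite -h mulr0 in h2.
  have [xa _] := ca_chart CA Cx.
  have nx : 0 < nrm x by apply: nrm_gt0; apply/eqP => h; rewrite h pair0l ltxx in xa.
  (* [eta] keeps [q - eta x p^-1] in the ball around the thick point [q]; [t] will be so large that
     [c eta > 2], and then [x + t y - c eta x] in [C] forces [y] into [C]. *)
  pose eta := e / (2 * Bi * nrm x).
  have eta0 : 0 < eta by rewrite divr_gt0 // !mulr_gt0 //; lra.
  pose M := `|b| * Bp * nrm a + 1.
  have Bp0 : 0 <= Bp by apply: sumr_ge0 => p _; apply: nrm_ge0.
  have M1 : 1 <= M by rewrite lerDr !mulr_ge0 // nrm_ge0.
  pose t := 2 * M / (eta * pair y a).
  have t0 : 0 < t by rewrite divr_gt0 // mulr_gt0 //; lra.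
  have [p [q [c [Gp tq c0 xE]]]] := cc _ (ray_cone (ltW t0)).
  have [pi pp] : nrm (invmx p) < Bi /\ nrm p <= Bp.
    by apply: pl; apply: lP; split => //; exists t, q, c; split => //; apply: ltW.
  have cbig : t * pair y a < c * M.
    have : pair (x + t *: y) a = c * pair (q *m p) a by rewrite xE pairZl.
    rewrite pairDl pairZl => h.
    have h1 := le_trans (ler_norm _) (pair_le (q *m p) a).
    have h2 : nrm (q *m p) <= `|b| * Bp.
      apply: le_trans (nrmM _ _) _; apply: ler_pM; rewrite ?nrm_ge0 //.
      by apply: le_trans tq.1 (ler_norm _).
    have h3 : nrm (q *m p) * nrm a <= `|b| * Bp * nrm a by rewrite ler_wpM2r ?nrm_ge0.
    have : c * pair (q *m p) a <= c * (M - 1).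
      by apply: ler_wpM2l; [exact: ltW|rewrite /M; lra].
    lra.
  have ceta : 2 < c * eta.
    have : t * pair y a * eta < c * M * eta by rewrite ltr_pM2r.
    rewrite /t -mulrA [pair y a * eta]mulrC divfK; last by rewrite gt_eqF // mulr_gt0.
    have -> : c * M * eta = (c * eta) * M by ring.
    by rewrite ltr_pM2r //; lra.
  have Cq : C (q - eta *: x *m invmx p).
    apply: tq.2; rewrite addrC addKr nrmN; apply: le_lt_trans (nrmM _ _) _.
    rewrite nrmZ gtr0_norm //.
    have -> : e = eta * nrm x * (2 * Bi).
      by rewrite /eta; field; lra.
    by rewrite ltr_pM2l; [lra|exact: mulr_gt0].
  have := ca_scale CA c0 (ca_act CA Gp Cq); rewrite mulmxBl (actVK CA) // scalerBr -xE scalerA.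
  move=> h; apply: (UC yU).
  have ti : 0 < t^-1 by rewrite invr_gt0.
  have -> : y = t^-1 *: ((x + t *: y - (c * eta) *: x) + (c * eta - 1) *: x).
    have -> : x + t *: y - (c * eta) *: x + (c * eta - 1) *: x = t *: y.
      by apply/rowP => j; rewrite !mxE; ring.
    by rewrite scalerA mulVf ?scale1r // gt_eqF.
  apply: (ca_scale CA) => //; apply: (ca_add CA) => //; apply: (ca_scale CA) => //; lra.
move=> g gs; have Gg := sG g gs; have [l hl] := ray_displacement Gg.
apply: finite_predS (displacement_finite CA b l e0) => h [p [Gp [t [q [c [t0 tq c0 xE]]]]] <-].
have Gi := ca_inv CA Gp.
split; first by do 2 apply: (ca_mul CA) => //.
exists q => //; have := hl t t0; rewrite xE.
have -> : l *: (c *: (q *m p)) - c *: (q *m p) *m g = c *: (l *: (q *m p) - q *m p *m g).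
  by rewrite scalerBr -!scalemxAl !scalerA mulrC.
have ci : 0 < c^-1 by rewrite invr_gt0.
move=> /(ca_scale CA ci)/(ca_act CA Gi); rewrite scalerA mulVf ?gt_eqF // scale1r.
by rewrite mulmxBl -scalemxAl (actV CA) // !mulmxA.
Qed.

End Face.

End Cocompact.

(** * Coarse stabilizers of a face and its dual face *)

Section DualFace.
Variables (R : realType) (N : nat) (C : 'rV[R]_N -> Prop) (a : 'cV[R]_N) (m : R).
Variable G : 'M[R]_N -> Prop.
Hypothesis CA : convex_action C a m G.
Variable x : 'rV[R]_N.
Hypothesis Cx : C x.

(* functionals, written as row vectors, on which [g] acts by [w |-> w *m g^T] *)
Definition dual_face (U : {vspace 'rV[R]_N}) (w : 'rV[R]_N) :=
  (forall v, C v -> 0 <= pair v w^T) /\ forall u, u \in U -> pair u w^T = 0.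

Definition coarse_stab U (y f : 'rV[R]_N) (mu : R) (g : 'M[R]_N) := exists al be : R,
  [/\ 0 < al, 0 < be,
    cl C ((mu * al) *: y - y *m g) /\ cl C ((mu / al) *: y - y *m invmx g),
    dual_face U ((mu * be) *: f - f *m g^T)
  & dual_face U ((mu / be) *: f - f *m (invmx g)^T)].

Lemma pair_act v (g : 'M[R]_N) w : pair v (w *m g^T)^T = pair (v *m g) w^T.
Proof. by rewrite trmx_mul trmxK pairM. Qed.

Section DualCone.
Variable U : {vspace 'rV[R]_N}.

Lemma dual_face0 : dual_face U 0.
Proof. by split=> v _; rewrite trmx0 pair0r. Qed.

Lemma dual_faceD v w : dual_face U v -> dual_face U w -> dual_face U (v + w).
Proof.
move=> [h1 h2] [h3 h4]; split=> u hu; rewrite linearD /= pairDr.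
  by rewrite addr_ge0 ?h1 ?h3.
by rewrite h2 // h4 // addr0.
Qed.

Lemma dual_faceZ c v : 0 <= c -> dual_face U v -> dual_face U (c *: v).
Proof.
move=> c0 [h1 h2]; split=> u hu; rewrite linearZ /= pairZr.
  by rewrite mulr_ge0 ?h1.
by rewrite h2 // mulr0.
Qed.

Lemma dual_face_act g w : (forall u, u \in U -> u *m g \in U) -> G g ->
  dual_face U w -> dual_face U (w *m g^T).
Proof.
move=> UG Gg [h1 h2]; split=> v hv; rewrite pair_act.
  by apply: h1; apply: (ca_act CA).
by apply: h2; apply: UG.
Qed.

(** [x] is interior, so the value at [x] controls every functional nonnegative on [C]. *)
Lemma dual_nrm : exists2 c, 0 <= c & forall w, (forall v, C v -> 0 <= pair v w^T) ->
  nrm w <= c * pair x w^T.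
Proof.
have [e e0 he] := ca_open CA Cx; exists ((1 * N)%:R * (2 / e)).
  by rewrite mulr_ge0 // divr_ge0 // ltW.
move=> w hw; rewrite -mulrA; apply: nrm_le => i j; rewrite (ord1 i).
have nd s : `|s| = 1 -> 0 <= pair x w^T + s * (e / 2) * w 0 j.
  move=> s1; have := hw (x + (s * (e / 2)) *: delta_mx 0 j); rewrite pairDl pairZl pair_delta mxE.
  apply; apply: he; rewrite addrC addKr nrmZ normrM s1 mul1r.
  have -> : nrm (delta_mx 0 j : 'rV[R]_N) = 1.
    rewrite /nrm big_ord1 (bigD1 j) //= mxE !eqxx normr1 big1 ?addr0 // => k kj.
    by rewrite mxE (negPf kj) andbF normr0.
  by rewrite mulr1 gtr0_norm; lra.
have := nd 1 (normr1 _); have := nd (-1) (normrN1 _).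
rewrite mulN1r mul1r mulNr => h1 h2; rewrite mulrAC ler_pdivlMr //.
by rewrite -[X in _ * X](gtr0_norm e0) -normrM ler_norml; lra.
Qed.

End DualCone.

Variable U : {vspace 'rV[R]_N}.
Hypothesis UG : forall g u, G g -> u \in U -> u *m g \in U.
Variables (y f : 'rV[R]_N) (k k' : R) (U' : {vspace 'rV[R]_N}).
Hypothesis yU : y \in U.
Hypothesis ycl : cl C y.
Hypothesis yunit : forall u, u \in U -> cl C ((k * nrm u) *: y - u).
Hypothesis UC : forall u, u \in U -> ~ C u.
Hypothesis fF : dual_face U f.
Hypothesis FU' : forall w, dual_face U w -> w \in U'.
Hypothesis k'0 : 0 <= k'.
Hypothesis funit : forall w, w \in U' -> dual_face U ((k' * nrm w) *: f - w).

Let cC : salient_cone C := action_salient CA (ex_intro _ x Cx).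

(* Functionals positive on [C] that do not vanish on [U] are dominated, for t large,
   by the contribution of t y; the others are controlled by [f]. *)
Lemma ray_stab mu : 0 < mu -> exists2 L, 0 < L & forall g al be, G g -> 0 < al -> 0 < be ->
  cl C ((mu * al) *: y - y *m g) -> dual_face U ((mu * be) *: f - f *m g^T) ->
  exists2 T, 0 < T & forall t, T <= t ->
    C ((L * be) *: (x + (al / be * t) *: y) - (x + t *: y) *m g).
Proof.
move=> mu0; have [k1 k10 hk1] := dual_nrm.
have fx : 0 <= pair x f^T by apply: fF.1.
(* For [h] in the dual face, the value at [x *m g] is at most [th * mu * be] times the value at [x].
   With [th + 1] instead, [v] is positive on the nonzero [h], so [bipolar] puts [v] in [C] up to an
   element of [U]. *)
pose th := k' * k1 * pair x f^T; have th0 : 0 <= th by rewrite /th !mulr_ge0.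
exists ((th + 2) * mu); first by rewrite mulr_gt0 //; lra.
move=> g al be Gg al0 be0 hy hf.
pose v := ((th + 1) * mu * be) *: x - x *m g.
have [u uU Cu] : exists2 u, u \in U & C (v + u).
  apply: (bipolar CA Cx UC) => h h0 hC hU.
  have hF : dual_face U h^T by split; rewrite trmxK.
  have := hk1 _ hF.1; rewrite trmxK => nh.
  have px : 0 < pair x h.
    rewrite lt_neqAle hC // andbT; apply/eqP => p0; rewrite -p0 mulr0 in nh.
    move/eqP: h0; apply; rewrite -[h]trmxK; apply/eqP; rewrite trmx_eq0; apply/eqP.
    by apply: nrm_eq0; apply/eqP; rewrite eq_le nh nrm_ge0.
  have := (funit (FU' hF)).1 (x *m g) (ca_act CA Gg Cx).
  rewrite linearB linearZ /= trmxK pairBr pairZr => s1.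
  have := hf.1 x Cx; rewrite linearB linearZ /= pairBr pairZr pair_act => s2.
  have s3 : k' * nrm h^T * pair (x *m g) f^T <= k' * (k1 * pair x h) * (mu * be * pair x f^T).
    apply: ler_pM.
    - by rewrite mulr_ge0 ?nrm_ge0.
    - by apply: fF.1; apply: (ca_act CA).
    - by rewrite ler_wpM2l.
    - by lra.
  rewrite pairBl pairZl.
  have : 0 < mu * be * pair x h by rewrite !mulr_gt0.
  by rewrite /th; lra.
have Cv : C (v + (k * nrm u) *: y).
  have := yunit uU Cu; congr C; apply/rowP => j; rewrite !mxE; ring.
pose s := k * nrm u; pose q := (th + 1) * mu * al.
have q0 : 0 < q by rewrite !mulr_gt0 //; lra.
exists (`|s| / q + 1); first by rewrite ltr_wpDl // divr_ge0 // ltW.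
move=> t ht; have t0 : 0 <= t.
  by apply: le_trans ht; rewrite addr_ge0 // divr_ge0 // ltW.
have sq : s <= q * t.
  apply: le_trans (ler_norm _) _; rewrite mulrC -ler_pdivrMr //.
  by apply: le_trans ht; rewrite lerDl.
have -> : ((th + 2) * mu * be) *: (x + (al / be * t) *: y) - (x + t *: y) *m g =
    (((q * t - s) *: y + t *: ((mu * al) *: y - y *m g)) + (mu * be) *: x) + (v + s *: y).
  rewrite mulmxDl -scalemxAl /v /q.
  have -> : ((th + 2) * mu * be) *: (x + (al / be * t) *: y) =
     ((th + 2) * mu * be) *: x + ((th + 2) * mu * al * t) *: y.
    rewrite scalerDr scalerA; congr (_ + _ *: _); field; exact: lt0r_neq0.
  by apply/rowP => j; rewrite !mxE; ring.
suff hc : cl C ((q * t - s) *: y + t *: ((mu * al) *: y - y *m g) + (mu * be) *: x).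
  exact: hc.
apply: cl_add.
  by apply: cl_add; apply: (cl_scale cC) => //; lra.
by apply: (cl_scale cC); [rewrite mulr_ge0 // ltW|apply: cl_cone].
Qed.

(** A coarse stabilizer [p] carries the ray to a reparametrized ray, where [g] displaces it by [l],
    and the inverse of [p] carries it back; so the conjugate of [g] displaces far points by at most
    [L * L * l]. Either infinitely many elements do so, and [limit_normal_abelian] applies, or the
    conjugates are finite in number. *)
Lemma face_stab_normal_abelian mu (s : seq 'M[R]_N) : 0 < mu ->
  (forall g, g \in s -> G g) ->
  (forall z, G z -> (forall g, g \in s -> z *m g = g *m z) ->
     forall g, G g -> z *m g = g *m z) ->
  ~ finite_pred (fun g => G g /\ coarse_stab U y f mu g) ->
  normal_abelian G.
Proof.
move=> mu0 sG gen inf; have [L L0 hL] := ray_stab mu0.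
pose xt (t : nat) := x + t%:R *: y.
have disp g : G g -> exists l, forall t, C (l *: xt t - xt t *m g).
  move=> Gg; have [l hl] := ray_displacement CA Cx UG yU ycl yunit Gg.
  by exists l => t; apply: hl.
have Cxt t : C (xt t) by apply: (ray_cone CA Cx ycl).
have [//|nab] := pselect (normal_abelian G).
apply: (conj_finite_normal_abelian CA sG gen _ inf); first by move=> g [].
move=> g gs; have Gg := sG g gs.
have [l hl] := ray_displacement CA Cx UG yU ycl yunit Gg.
pose D h := G h /\ exists t0, forall t, (t0 <= t)%N -> C ((L * L * l) *: xt t - xt t *m h).
have finD : finite_pred D.
  by apply: contrapT => infD; apply: nab; apply: (limit_normal_abelian CA Cxt disp infD).
apply: finite_predS finD => h [p [Gp [al [be [al0 be0 [h1 h2] h3 h4]]]] <-].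
have Gi := ca_inv CA Gp.
have [T1 T10 hT1] := hL p al be Gp al0 be0 h1 h3.
have ali : 0 < al^-1 by rewrite invr_gt0.
have bei : 0 < be^-1 by rewrite invr_gt0.
have [T2 T20 hT2] := hL (invmx p) al^-1 be^-1 Gi ali bei h2 h4.
split; first by do 2 apply: (ca_mul CA) => //.
(* Beyond both thresholds of [ray_stab]: [T1] at time [t] for [p], and [T2] at time [tau * t] for
   its inverse. *)
exists (Num.bound (T1 + T2 / (al / be))) => t tt.
pose tau := al / be; have tau0 : 0 < tau by rewrite divr_gt0.
have T2t : 0 < T2 / tau by rewrite divr_gt0.
have tb : T1 + T2 / tau < t%:R.
  apply: lt_le_trans (_ : _ < (Num.bound (T1 + T2 / tau))%:R) _; last by rewrite ler_nat.
  by apply: archi_boundP; lra.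
have a1 : T1 <= t%:R by lra.
have a2 : T2 <= tau * t%:R by rewrite mulrC -ler_pdivrMr //; lra.
have k1 := hT1 _ a1; have k2 := hT2 _ a2; have k3 := hl (tau * t%:R) _.
have t0 : 0 <= tau * t%:R by rewrite mulr_ge0 // ltW.
have {}k3 := k3 t0.
have E : al^-1 / be^-1 * (tau * t%:R) = t%:R.
  by rewrite /tau; field; rewrite !lt0r_neq0.
rewrite E in k2; rewrite -/tau -/(xt t) in k1; rewrite -/(xt t) in k2.
set z := x + (tau * t%:R) *: y in k1 k2 k3.
have l0 : 0 < l.
  have Cz : C z by apply: (ray_cone CA Cx ycl).
  have : C (l *: z) by rewrite -(subrK (z *m g) (l *: z)); apply: (ca_add CA) => //; apply: (ca_act CA).
  move=> /(ca_chart CA)[+ _]; have [pz _] := ca_chart CA Cz.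
  by rewrite pairZl pmulr_lgt0.
have b1 := ca_act CA Gi (ca_act CA Gg k1).
have b2 : C ((L * be) *: ((l *: z - z *m g) *m invmx p)).
  by apply: (ca_scale CA); [rewrite mulr_gt0|apply: (ca_act CA)].
have b3 : C ((L * be * l) *: ((L * be^-1) *: xt t - z *m invmx p)).
  by apply: (ca_scale CA) => //; rewrite !mulr_gt0.
have := ca_add CA (ca_add CA b1 b2) b3; congr C.
rewrite !mulmxBl -!scalemxAl !mulmxA !scalerBr !scalerA.
have -> : L * be * l * (L / be) = L * L * l by field; exact: lt0r_neq0.
by apply/rowP => j; rewrite !mxE; ring.
Qed.

End DualFace.

(** * Finiteness of coarse stabilizers of interior rays *)

Section StabFinite.
Variables (R : realType) (n : nat) (C : 'rV[R]_n.+1 -> Prop) (a : 'cV[R]_n.+1) (m : R).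
Variable G : 'M[R]_n.+1 -> Prop.
Hypothesis CA : convex_action C a m G.
Variable x : 'rV[R]_n.+1.
Hypothesis Cx : C x.

Lemma det_lower : exists2 d : R, 0 < d & forall g : 'M[R]_n.+1, `|\det g| = 1 -> d <= nrm g.
Proof.
pose K : R := #|{: 'S_n.+1}|%:R; have K0 : 0 <= K by [].
exists (K + 1)^-1; first by rewrite invr_gt0; lra.
move=> g dg; rewrite leNgt; apply/negP => h.
have g1 : nrm g < 1 by apply: lt_le_trans h _; rewrite invf_le1; lra.
have := @det_bound R n.+1 g (nrm g) (entry_le_nrm g); rewrite dg -/K.
have : nrm g ^+ n.+1 <= nrm g by rewrite exprS ler_piMr ?nrm_ge0 // exprn_ile1 ?nrm_ge0 // ltW.
have : K * nrm g < 1.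
  apply: (@le_lt_trans _ _ (K * (K + 1)^-1)); first by rewrite ler_wpM2l // ltW.
  by rewrite ltr_pdivrMr; lra.
have := nrm_ge0 g => h1 h2 h3 h4.
have : K * nrm g ^+ n.+1 <= K * nrm g by rewrite ler_wpM2l.
lra.
Qed.

(** The scale [al] is bounded, because an inverse with determinant of absolute value 1 cannot be too
    small. *)
Lemma scaled_bound_finite K (P : 'M[R]_n.+1 -> Prop) :
  (forall g, P g -> G g /\ exists2 al, 0 < al & nrm g <= K * al /\ nrm (invmx g) <= K / al) ->
  finite_pred P.
Proof.
move=> H; have [d d0 hd] := det_lower.
apply: finite_predS (bounded_finite CA (`|K| * (`|K| / d))) => g /H[Gg [al al0 [h1 h2]]].
split => //; apply: le_trans h1 _.
have di : `|\det (invmx g)| = 1 by rewrite det_inv normfV (ca_det CA Gg) invr1.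
have := le_trans (hd _ di) h2; rewrite ler_pdivlMr // => h3.
have ald : al <= `|K| / d.
  by rewrite ler_pdivlMr // mulrC; apply: le_trans h3 (ler_norm _).
apply: (@le_trans _ _ (`|K| * al)); first by rewrite ler_wpM2r ?ler_norm // ltW.
by rewrite ler_wpM2l.
Qed.

Lemma interior_stab_finite W y f mu : 0 < mu -> C y ->
  finite_pred (fun g => G g /\ coarse_stab C W y f mu g).
Proof.
move=> mu0 Cy; have [e [e0 ty]] := cone_thick CA Cy.
have [c hc] := thick_displacement CA (nrm y) e0.
have bound g al : G g -> 0 < al -> cl C ((mu * al) *: y - y *m g) -> nrm g <= (c * (mu + 1)) * al.
  move=> Gg al0 h; have l0 : 0 < (mu + 1) * al by rewrite mulr_gt0 //; lra.
  have := hc y g ((mu + 1) * al) ty Gg; rewrite gtr0_norm // mulrA; apply.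
  have -> : ((mu + 1) * al) *: y - y *m g = ((mu * al) *: y - y *m g) + al *: y.
    by apply/rowP => j; rewrite !mxE; ring.
  by apply: h; apply: (ca_scale CA).
apply: (@scaled_bound_finite (c * (mu + 1))) => g [Gg [al [be [al0 be0 [h1 h2] _ _]]]].
split => //; exists al => //; split; first exact: bound h1.
by apply: bound h2; [apply: (ca_inv CA)|rewrite invr_gt0].
Qed.

(** [f] controls the norm on [C], and each row of [g] is a multiple of the difference of the images
    of two points of [C]. *)
Lemma dual_stab_finite W y f mu k : 0 < mu -> dual_face C W f ->
  (forall v, C v -> nrm v <= k * pair v f^T) ->
  finite_pred (fun g => G g /\ coarse_stab C W y f mu g).
Proof.
move=> mu0 fW fk; have [e e0 he] := ca_open CA Cx.
have nx := nrm_ge0 x; have nf := nrm_ge0 f.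
pose K := n.+1%:R * (`|k| * (mu * (2 * nrm x + e / 2) * nrm f) * (2 / e)).
have bound g be : G g -> 0 < be -> dual_face C W ((mu * be) *: f - f *m g^T) -> nrm g <= K * be.
  move=> Gg be0 [h _].
  have vb v : C v -> nrm (v *m g) <= `|k| * (mu * nrm v * nrm f) * be.
    move=> Cv; have Cvg := ca_act CA Gg Cv.
    have := h v Cv; rewrite linearB linearZ /= pairBr pairZr pair_act => h1.
    have p0 : 0 <= pair (v *m g) f^T by apply: fW.1.
    apply: le_trans (fk _ Cvg) _.
    apply: (@le_trans _ _ (`|k| * pair (v *m g) f^T)); first by rewrite ler_wpM2r ?ler_norm.
    rewrite -mulrA ler_wpM2l //.
    have := le_trans (ler_norm _) (pair_le v f^T); rewrite nrm_tr => h2.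
    have : mu * be * pair v f^T <= mu * be * (nrm v * nrm f) by rewrite ler_wpM2l // ltW // mulr_gt0.
    lra.
  have nd i : nrm (delta_mx 0 i : 'rV[R]_n.+1) = 1.
    rewrite /nrm big_ord1 (bigD1 i) //= mxE !eqxx normr1 big1 ?addr0 // => j ji.
    by rewrite mxE (negPf ji) andbF normr0.
  have rowb i : nrm (row i g) <= `|k| * (mu * (2 * nrm x + e / 2) * nrm f) * (2 / e) * be.
    pose v := x + (e / 2) *: delta_mx 0 i.
    have Cv : C v by apply: he; rewrite addrC addKr nrmZ nd mulr1 gtr0_norm; lra.
    have nv : nrm v <= nrm x + e / 2.
      by apply: le_trans (nrmD _ _) _; rewrite nrmZ nd mulr1 gtr0_norm; lra.
    have -> : row i g = (2 / e) *: (v *m g - x *m g).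
      rewrite -mulmxBl /v addrC addKr -scalemxAl scalerA -rowE.
      have -> : 2 / e * (e / 2) = 1 by field; exact: lt0r_neq0.
      by rewrite scale1r.
    rewrite nrmZ gtr0_norm ?divr_gt0 //.
    have -> : `|k| * (mu * (2 * nrm x + e / 2) * nrm f) * (2 / e) * be =
       2 / e * (`|k| * (mu * (2 * nrm x + e / 2) * nrm f) * be) by ring.
    apply: ler_wpM2l; first by rewrite divr_ge0 // ltW.
    apply: le_trans (nrmB _ _) _.
    have b1 := vb _ Cv; have b2 := vb _ Cx.
    have b3 : `|k| * (mu * nrm v * nrm f) * be <= `|k| * (mu * (nrm x + e / 2) * nrm f) * be.
      apply: ler_wpM2r; first exact: ltW.
      apply: ler_wpM2l => //; apply: ler_wpM2r => //; apply: ler_wpM2l => //; exact: ltW.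
    lra.
  rewrite /K -mulrA; apply: (@le_trans _ _ (\sum_i nrm (row i g))).
    apply: ler_sum => i _; rewrite /nrm big_ord1; apply: ler_sum => j _.
    by rewrite mxE.
  apply: le_trans (ler_sum _ (fun i _ => rowb i)) _.
  by rewrite sumr_const card_ord -[leLHS]mulr_natl.
apply: (@scaled_bound_finite K) => g [Gg [al [be [al0 be0 _ h1 h2]]]].
split => //; exists be => //; split; first exact: bound h1.
by apply: bound h2; [apply: (ca_inv CA)|rewrite invr_gt0].
Qed.

End StabFinite.

(** * Relative interiors of closed cones *)

Section UnitCone.
Variables (R : realType) (N : nat) (P : 'rV[R]_N -> Prop).
Hypothesis P0 : P 0.
Hypothesis PD : forall u v, P u -> P v -> P (u + v).
Hypothesis PZ : forall c v, 0 <= c -> P v -> P (c *: v).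
Variables (U : {vspace 'rV[R]_N}) (y : 'rV[R]_N) (k : R).
Hypothesis yU : y \in U.
Hypothesis Py : P y.
Hypothesis k0 : 0 <= k.
Hypothesis yunit : forall u, u \in U -> P ((k * nrm u) *: y - u).

(* the interior, relative to [U], of the closed cone [P] *)
Definition unit_cone v := v \in U /\ exists2 e, 0 < e & P (v - e *: y).

Lemma unit_cone_unit : unit_cone y.
Proof. by split=> //; exists 1 => //; rewrite scale1r subrr. Qed.

Lemma unit_coneD v w : unit_cone v -> unit_cone w -> unit_cone (v + w).
Proof.
move=> [vU [e e0 he]] [wU [r r0 hr]]; split; first exact: memvD.
by exists (e + r); rewrite ?addr_gt0 // scalerDl opprD addrACA; apply: PD.
Qed.

Lemma unit_coneZ c v : 0 < c -> unit_cone v -> unit_cone (c *: v).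
Proof.
move=> c0 [vU [e e0 he]]; split; first exact: memvZ.
exists (c * e); first exact: mulr_gt0.
by rewrite -scalerA -scalerBr; apply: PZ => //; apply: ltW.
Qed.

Lemma unit_cone_sub v : unit_cone v -> P v.
Proof.
move=> [_ [e e0 he]]; rewrite -(subrK (e *: y) v); apply: PD => //.
by apply: PZ => //; apply: ltW.
Qed.

Lemma unit_cone_open v : unit_cone v ->
  exists2 e, 0 < e & forall w, w \in U -> nrm (w - v) < e -> unit_cone w.
Proof.
move=> [vU [e e0 he]]; exists (e / 2 / (k + 1)); first by apply: divr_gt0; [apply: divr_gt0|apply: ltr_wpDl].
move=> w wU; rewrite ltr_pdivlMr; last by apply: ltr_wpDl.
move=> h; split=> //; exists (e / 2); first exact: divr_gt0.
have vw : v - w \in U by rewrite memvB.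
have nv : nrm (v - w) = nrm (w - v) by rewrite nrmC.
have n0 := nrm_ge0 (w - v).
have -> : w - (e / 2) *: y = (v - e *: y) + (((k * nrm (v - w)) *: y - (v - w)) +
    (e / 2 - k * nrm (v - w)) *: y).
  by apply/rowP => j; rewrite !mxE; field.
apply: PD => //; apply: PD; first exact: yunit.
by apply: PZ => //; rewrite nv; lra.
Qed.

(** Since [y *m h] is below a multiple [c y], applying [g] shows that [y] is below [c (y *m g)]; so
    the image of the order unit is again interior. *)
Lemma unit_cone_act (g h : 'M[R]_N) v :
  (forall v, P v -> P (v *m g)) -> (forall u, u \in U -> u *m g \in U) ->
  (forall u, u \in U -> u *m h \in U) -> (forall v : 'rV[R]_N, v *m h *m g = v) ->
  unit_cone v -> unit_cone (v *m g).
Proof.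
move=> Pg Ug Uh hg [vU [e e0 he]]; split; first exact: Ug.
pose c := k * nrm (y *m h) + 1; have c1 : 1 <= c by rewrite lerDr mulr_ge0 // nrm_ge0.
have cp : 0 < c by lra.
exists (e / c); first exact: divr_gt0.
have q : P (y *m g - c^-1 *: y).
  have -> : y *m g - c^-1 *: y =
      c^-1 *: (((k * nrm (y *m h)) *: y - y *m h) *m g + y *m g).
    rewrite mulmxBl hg -scalemxAl /c.
    by apply/rowP => j; rewrite !mxE; field; move: cp; rewrite /c; lra.
  apply: PZ; first by rewrite invr_ge0 ltW.
  by apply: PD; apply: Pg => //; apply: yunit; apply: Uh.
have -> : v *m g - (e / c) *: y = (v - e *: y) *m g + e *: (y *m g - c^-1 *: y).
  by rewrite mulmxBl -scalemxAl; apply/rowP => j; rewrite !mxE; ring.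
by apply: PD; [apply: Pg|apply: PZ => //; apply: ltW].
Qed.

End UnitCone.

(** * Products of subspaces *)

Section Product.
Variables (R : realType) (n1 n2 : nat).
Variables (U1 : {vspace 'rV[R]_n1}) (U2 : {vspace 'rV[R]_n2}).

Definition prod_space : {vspace 'rV[R]_(n1 + n2)} :=
  (linfun (mulmxr (row_mx 1%:M 0)) @: U1 + linfun (mulmxr (row_mx 0 1%:M)) @: U2)%VS.

Lemma prod_spaceP v w : v \in U1 -> w \in U2 -> row_mx v w \in prod_space.
Proof.
move=> vU wU; have -> : row_mx v w = v *m row_mx 1%:M 0 + w *m row_mx 0 1%:M.
  by rewrite !mul_mx_row !mulmx1 !mulmx0 add_row_mx addr0 add0r.
apply: memv_add.
  by have := memv_img (linfun (mulmxr (row_mx 1%:M (0 : 'M_(n1, n2))))) vU; rewrite lfunE.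
by have := memv_img (linfun (mulmxr (row_mx (0 : 'M_(n2, n1)) 1%:M))) wU; rewrite lfunE.
Qed.

Lemma prod_space_sub z : z \in prod_space -> lsubmx z \in U1 /\ rsubmx z \in U2.
Proof.
move=> /memv_addP[_ /memv_imgP[v vU ->] [_ /memv_imgP[w wU ->] ->]].
rewrite !lfunE /= !mul_mx_row !mulmx1 !mulmx0 add_row_mx addr0 add0r.
by rewrite row_mxKl row_mxKr.
Qed.

Lemma dim_prod_space : (\dim prod_space <= \dim U1 + \dim U2)%N.
Proof.
have dim_img (aT rT : vectType R) (f : 'Hom(aT, rT)) V : (\dim (f @: V) <= \dim V)%N.
  by rewrite -(limg_ker_dim f V) leq_addl.
by apply: leq_trans (dimv_add_leqif _ _) _; apply: leq_add.
Qed.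

End Product.

Lemma exp2z_bound (R : realType) (e : int) (B : R) :
  (2 : R) ^ e <= B -> (2 : R) ^ (- e) <= B -> `|e| <= (Num.bound B)%:Z.
Proof.
move=> h1 h2.
have n2 (n : nat) : (2 : R) ^ (n%:Z) <= B -> (n%:Z <= (Num.bound B)%:Z).
  move=> h; rewrite lez_nat -(ler_nat R).
  have B0 : 0 <= B by apply: le_trans h; rewrite exprz_ge0.
  apply: le_trans (ltW (archi_boundP B0)); apply: le_trans h.
  by rewrite -exprnP -natrX ler_nat ltnW // ltn_expl.
case: e h1 h2 => n h1 h2; first by have := n2 n h1; lia.
by move: h2; rewrite NegzE opprK => /n2; lia.
Qed.

Lemma finite_preimage (T T' : eqType) (f : T -> T') (P : T' -> Prop) :
  injective f -> finite_pred P -> finite_pred (fun x => P (f x)).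
Proof.
move=> fi [l lP]; have K y : exists s : seq T, forall x, f x = y -> x \in s.
  have [[x fx]|nx] := pselect (exists x, f x = y); last first.
    by exists [::] => x fx; exfalso; apply: nx; exists x.
  by exists [:: x] => x'; rewrite -fx => /fi ->; rewrite inE eqxx.
exists (flatten [seq projT1 (cid (K y)) | y <- l]) => x Px.
by apply/flatten_mapP; exists (f x); [apply: lP|apply: (projT2 (cid (K (f x))))].
Qed.

(** * Lattices of large rank have finite index *)

Section LatticeIndex.
Variables (R : realType) (N : nat) (C : 'rV[R]_N -> Prop) (a : 'cV[R]_N) (m : R).
Variable G : 'M[R]_N -> Prop.
Hypothesis CA : convex_action C a m G.
Variable x : 'rV[R]_N.
Hypothesis Cx : C x.
Variables (W U U' : {vspace 'rV[R]_N}) (y f : 'rV[R]_N) (k k' : R).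
Hypothesis WG : forall g u, G g -> u \in W -> u *m g \in W.
Hypothesis UG : forall g u, G g -> u \in U -> u *m g \in U.
Hypothesis UG' : forall g u, G g -> u \in U' -> u *m g^T \in U'.
Hypothesis yU : y \in U.
Hypothesis ycl : cl C y.
Hypothesis k0 : 0 <= k.
Hypothesis yunit : forall u, u \in U -> cl C ((k * nrm u) *: y - u).
Hypothesis fU : f \in U'.
Hypothesis fF : dual_face C W f.
Hypothesis k'0 : 0 <= k'.
Hypothesis funit : forall w, w \in U' -> dual_face C W ((k' * nrm w) *: f - w).
Variables (r s : nat) (phi : 'rV[int]_r -> 'M[R]_N) (e1 e2 : 'rV[int]_s -> int).
Hypothesis phiD : forall v w, phi (v + w) = phi v *m phi w.
Hypothesis phi0 : phi 0 = 1%:M.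
Hypothesis Gphi : forall z, G (phi z).
Hypothesis phi_inj : injective phi.
Hypothesis e1D : forall p q, e1 (p + q) = e1 p + e1 q.
Hypothesis e2D : forall p q, e2 (p + q) = e2 p + e2 q.
(** A factor reduced to 0 puts no condition on its scaling, so one exponent is enough when the face
    or the dual face is 0. *)
Hypothesis e_finite : forall B : nat, finite_pred (fun p =>
  (y != 0 -> `|e1 p| <= B%:Z) /\ (f != 0 -> `|e2 p| <= B%:Z)).
Hypothesis dims : (\dim U + \dim U' <= r + s)%N.
Hypothesis stab_finite : forall mu, 0 < mu ->
  finite_pred (fun g => G g /\ coarse_stab C W y f mu g).

Let cC : salient_cone C := action_salient CA (ex_intro _ x Cx).
Let Pd := dual_face C W.

Let clD := @cl_add R N C.
Let clZ := @cl_scale R N C cC.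

Let pd0 : Pd 0. Proof. exact: dual_face0. Qed.
Let pdD u v : Pd u -> Pd v -> Pd (u + v). Proof. exact: dual_faceD. Qed.
Let pdZ c v : 0 <= c -> Pd v -> Pd (c *: v). Proof. exact: dual_faceZ. Qed.

Let K z := unit_cone (cl C) U y (lsubmx z) /\ unit_cone Pd U' f (rsubmx z).
Let x0 : 'rV[R]_(N + N) := row_mx y f.
Let c1 (z : 'rV[int]_(r + s)) : R := 2 ^ (e1 (rsubmx z)).
Let c2 (z : 'rV[int]_(r + s)) : R := 2 ^ (e2 (rsubmx z)).
Let Phi (z : 'rV[int]_(r + s)) : 'M[R]_(N + N) :=
  block_mx (c1 z *: phi (lsubmx z)) 0 0 (c2 z *: (phi (- lsubmx z))^T).

Let phiV z : invmx (phi z) = phi (- z).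
Proof.
have h : phi z *m phi (- z) = 1%:M by rewrite -phiD subrr phi0.
have u : phi z \in unitmx by apply: (ca_unit CA).
by rewrite -[LHS]mulmx1 -h mulKmx.
Qed.

Let phiK z v : v *m phi z *m phi (- z) = v :> 'rV[R]_N.
Proof. by rewrite -mulmxA -phiD subrr phi0 mulmx1. Qed.
Let phiTK z v : v *m (phi (- z))^T *m (phi z)^T = v :> 'rV[R]_N.
Proof. by rewrite -mulmxA -trmx_mul -phiD subrr phi0 trmx1 mulmx1. Qed.

Let c1_gt0 z : 0 < c1 z. Proof. by rewrite /c1 exprz_gt0. Qed.
Let c2_gt0 z : 0 < c2 z. Proof. by rewrite /c2 exprz_gt0. Qed.

Let clG g v : G g -> cl C v -> cl C (v *m g).
Proof. exact: (action_cl CA). Qed.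

Let PdG g v : G g -> Pd v -> Pd (v *m g^T).
Proof. by move=> Gg; apply: (dual_face_act CA) => // u; apply: WG. Qed.

(** All of [G], not only the lattice, acts on the product; the contragredient on the dual face makes
    both factors right actions. *)
Let Kact g z : G g -> K z -> K (row_mx (lsubmx z *m g) (rsubmx z *m (invmx g)^T)).
Proof.
move=> Gg [h1 h2]; have Gi := ca_inv CA Gg; have ug := ca_unit CA Gg.
rewrite /K row_mxKl row_mxKr; split.
  apply: (unit_cone_act (h := invmx g) clD clZ yU ycl k0 yunit _ _ _ _ h1).
  - by move=> v; apply: clG.
  - by move=> u; apply: UG.
  - by move=> u; apply: UG.
  - by move=> v; rewrite mulmxKV.
apply: (unit_cone_act (h := g^T) pdD pdZ fU fF k'0 funit _ _ _ _ h2).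
- by move=> v; apply: PdG.
- by move=> u; apply: UG'.
- by move=> u; apply: UG'.
- by move=> v; rewrite -mulmxA -trmx_mul mulVmx // trmx1 mulmx1.
Qed.

Let PhiE z (v w : 'rV[R]_N) : row_mx v w *m Phi z =
  row_mx (c1 z *: (v *m phi (lsubmx z))) (c2 z *: (w *m (phi (- lsubmx z))^T)).
Proof. by rewrite /Phi mul_row_block !mulmx0 addr0 add0r -2!scalemxAr. Qed.

Let PhiD z z' : Phi (z + z') = Phi z *m Phi z'.
Proof.
rewrite /Phi mulmx_block !mulmx0 !mul0mx !addr0 !add0r.
rewrite -!scalemxAl -!scalemxAr !scalerA /c1 /c2 !linearD /= e1D e2D.
rewrite !expfzDr ?pnatr_eq0 // phiD -trmx_mul -(phiD (- _)).
by rewrite [- lsubmx z' + _]addrC.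
Qed.

Let Phi0 : Phi 0 = 1%:M.
Proof.
have e10 : e1 0 = 0 by apply: (addrI (e1 0)); rewrite -e1D !addr0.
have e20 : e2 0 = 0 by apply: (addrI (e2 0)); rewrite -e2D !addr0.
by rewrite /Phi /c1 /c2 !linear0 e10 e20 phi0 trmx1 !expr0z !scale1r -scalar_mx_block.
Qed.

Let Kscale c1' c2' z : 0 < c1' -> 0 < c2' -> K z ->
  K (row_mx (c1' *: lsubmx z) (c2' *: rsubmx z)).
Proof.
move=> h1 h2 [k1 k2]; rewrite /K row_mxKl row_mxKr; split.
  exact: (unit_coneZ clZ).
exact: (unit_coneZ pdZ).
Qed.

Let KPhi t z : K z -> K (z *m Phi t).
Proof.
move=> /(Kact (Gphi (lsubmx t)))/(Kscale (c1_gt0 t) (c2_gt0 t)).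
by rewrite -{5}[z]hsubmxK PhiE phiV row_mxKl row_mxKr.
Qed.

Let nrm_sub (v : 'rV[R]_(N + N)) : nrm v = nrm (lsubmx v) + nrm (rsubmx v).
Proof.
rewrite /nrm !big_ord1 big_split_ord /=.
by congr (_ + _); apply: eq_bigr => i _; rewrite mxE.
Qed.

Let Ksalient v : cl K v -> cl K (- v) -> v = 0.
Proof.
have side w : cl K w -> cl C (lsubmx w) /\ (forall u, C u -> 0 <= pair u (rsubmx w)^T).
  move=> hw.
  have Kx0 : K x0.
    rewrite /K /x0 row_mxKl row_mxKr; split; first exact: (unit_cone_unit (@cl0 _ _ C)).
    exact: (unit_cone_unit pd0).
  have He (e : R) : 0 < e -> cl C (lsubmx w + e *: y) /\ Pd (rsubmx w + e *: f).
    move=> e0; have := hw _ (Kscale e0 e0 Kx0); rewrite /K !linearD /= row_mxKl row_mxKr.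
    rewrite /x0 row_mxKl row_mxKr => -[h1 h2]; split.
      exact: (unit_cone_sub clD clZ ycl h1).
    exact: (unit_cone_sub pdD pdZ fF h2).
  split.
    apply: (cl_lim cC (f := fun t => lsubmx w + t.+1%:R^-1 *: y)); last first.
      by apply: ev_true => t; have [] := He _ (_ : 0 < t.+1%:R^-1 :> R); rewrite ?invr_gt0.
    have L : mlim (fun t : nat => t.+1%:R^-1 *: y) 0.
      apply: (@mlim_small _ _ _ _ (nrm y)); first exact: nrm_ge0.
      by apply: ev_true => t; rewrite nrmZ gtr0_norm ?invr_gt0 // mulrC.
    by have := mlimD (mlim_cst (lsubmx w)) L; rewrite addr0.
  move=> u Cu; rewrite leNgt; apply/negP => h.
  have fu : 0 <= pair u f^T by apply: fF.1.
  pose e := - pair u (rsubmx w)^T / (pair u f^T + 1).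
  have e0 : 0 < e by rewrite divr_gt0 ?oppr_gt0 //; lra.
  have [_ [/(_ u Cu) + _]] := He e e0; rewrite linearD linearZ /= pairDr pairZr.
  have : e * (pair u f^T + 1) = - pair u (rsubmx w)^T by rewrite divfK // gt_eqF //; lra.
  lra.
move=> /side[h1 h2] /side[]; rewrite !linearN /= => h3 h4.
have l0 := cone_salient cC h1 h3.
have r0 : rsubmx v = 0.
  have [c cc0 hc] := dual_nrm CA Cx; apply: nrm_eq0; apply/eqP; rewrite eq_le nrm_ge0 andbT.
  apply: le_trans (hc _ h2) _.
  have := h4 x Cx; rewrite pairNr oppr_ge0 => h5.
  by rewrite mulr_ge0_le0.
by rewrite -[v]hsubmxK l0 r0 row_mx0.
Qed.

(** If the enlarged lattice element [z] moves [x0] boundedly, its [phi] part coarsely stabilizes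
    both rays, with scales given by the two powers of 2. There are finitely many such parts, and for
    each the heights bound the exponents. *)
Let proper l : finite_pred (fun z => K (l *: x0 - x0 *m Phi z) /\ K (l *: (x0 *m Phi z) - x0)).
Proof.
pose mu := `|l| + 1; have mu0 : 0 < mu by rewrite ltr_wpDl.
have lmu : l <= mu by rewrite /mu; have := ler_norm l; lra.
have [L LP] := stab_finite mu0.
pose B := \sum_(g <- L) (`|mu * pair y a / pair (y *m g) a| +
   `|mu * pair (y *m g) a / pair y a|
   + `|mu * pair x f^T / pair x (f *m (invmx g)^T)^T|
   + `|mu * pair x (f *m (invmx g)^T)^T / pair x f^T|).
have [l1 l1P] := finite_preimage phi_inj (stab_finite mu0).
have [l2 l2P] := e_finite (Num.bound B).
exists [seq row_mx v p | v <- l1, p <- l2] => z [].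
rewrite /x0 PhiE; set w := lsubmx z; set p := rsubmx z.
rewrite /K !linearB !linearZ /= !row_mxKl !row_mxKr => -[h1 h2] [h3 h4].
have {}h1 := unit_cone_sub clD clZ ycl h1.
have {}h3 := unit_cone_sub clD clZ ycl h3.
have {}h2 := unit_cone_sub pdD pdZ fF h2.
have {}h4 := unit_cone_sub pdD pdZ fF h4.
have lm : 0 <= mu - l by lra.
have d1 := c1_gt0 z; have d2 := c2_gt0 z.
have i1 : 0 <= (c1 z)^-1 by rewrite invr_ge0 ltW.
have i2 : 0 <= (c2 z)^-1 by rewrite invr_ge0 ltW.
have n1 : c1 z != 0 by rewrite gt_eqF.
have n2 : c2 z != 0 by rewrite gt_eqF.
have stab : coarse_stab C W y f mu (phi w).
  exists (c1 z)^-1, (c2 z); split; rewrite ?invr_gt0 //.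
  - split.
      have -> : (mu / c1 z) *: y - y *m phi w =
          (c1 z)^-1 *: ((l *: y - c1 z *: (y *m phi w)) + (mu - l) *: y).
        by apply/rowP => j; rewrite !mxE; field.
      by apply: clZ => //; apply: clD => //; apply: clZ.
    have := clG (Gphi (- w)) h3; rewrite mulmxBl -!scalemxAl phiK => h.
    have -> : (mu / (c1 z)^-1) *: y - y *m invmx (phi w) =
        (l *: (c1 z *: y) - y *m phi (- w)) + ((mu - l) * c1 z) *: y.
      by rewrite phiV; apply/rowP => j; rewrite !mxE; field.
    by apply: clD => //; apply: clZ => //; rewrite mulr_ge0 // ltW.
  - have := PdG (Gphi w) h4; rewrite mulmxBl -!scalemxAl phiTK => h.
    have -> : (mu * c2 z) *: f - f *m (phi w)^T =
        (l *: (c2 z *: f) - f *m (phi w)^T) + ((mu - l) * c2 z) *: f.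
      by apply/rowP => j; rewrite !mxE; ring.
    by apply: pdD => //; apply: pdZ => //; rewrite mulr_ge0 // ltW.
  have -> : (mu / c2 z) *: f - f *m (invmx (phi w))^T =
      (c2 z)^-1 *: ((l *: f - c2 z *: (f *m (phi (- w))^T)) + (mu - l) *: f).
    by rewrite phiV; apply/rowP => j; rewrite !mxE; field.
  by apply: pdZ => //; apply: pdD => //; apply: pdZ.
have wl : w \in l1 by apply: l1P.
have gL : phi w \in L by apply: LP.
have hB : [/\ `|mu * pair y a / pair (y *m phi w) a| <= B,
    `|mu * pair (y *m phi w) a / pair y a| <= B,
    `|mu * pair x f^T / pair x (f *m (phi (- w))^T)^T| <= B
    & `|mu * pair x (f *m (phi (- w))^T)^T / pair x f^T| <= B].
  have q0 : 0 <= \sum_(g <- rem (phi w) L) (`|mu * pair y a / pair (y *m g) a| +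
     `|mu * pair (y *m g) a / pair y a|
     + `|mu * pair x f^T / pair x (f *m (invmx g)^T)^T|
     + `|mu * pair x (f *m (invmx g)^T)^T / pair x f^T|).
    by apply: sumr_ge0 => i _; rewrite !addr_ge0.
  rewrite /B (big_rem _ gL) /= phiV.
  set t1 := `|_|; set t2 := `|_|; set t3 := `|_|; set t4 := `|_|.
  have [t10 t20] : 0 <= t1 /\ 0 <= t2 by rewrite !normr_ge0.
  have [t30 t40] : 0 <= t3 /\ 0 <= t4 by rewrite !normr_ge0.
  by split; lra.
have [b1 b2 b3 b4] := hB.
have neC : exists v, C v by exists x.
have clpos v : v != 0 -> cl C v -> 0 < pair v a.
  move=> v0 hv; have [p1 p2] := action_cl_chart CA hv neC.
  rewrite lt_neqAle p1 andbT; apply/eqP => h; move/eqP: v0; apply; apply: nrm_eq0.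
  by apply/eqP; rewrite eq_le nrm_ge0 andbT; rewrite -h mulr0 in p2.
have Pdpos v : v != 0 -> Pd v -> 0 < pair x v^T.
  move=> v0 hv; have [c cc0 hc] := dual_nrm CA Cx.
  rewrite lt_neqAle hv.1 // andbT; apply/eqP => h; move/eqP: v0; apply; apply: nrm_eq0.
  by apply/eqP; rewrite eq_le nrm_ge0 andbT; have := hc _ hv.1; rewrite -h mulr0.
have pl : p \in l2.
  apply: l2P; split => [y0|f0].
  - have y1 := clpos _ y0 ycl.
    have yp0 : y *m phi w != 0 by apply: contra y0 => /eqP h; rewrite -(phiK w y) h mul0mx.
    have y2 := clpos _ yp0 (clG (Gphi w) ycl).
    have [k1 _] := action_cl_chart CA h1 neC; have [k3 _] := action_cl_chart CA h3 neC.
    rewrite pairBl !pairZl in k1; rewrite pairBl !pairZl in k3.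
    apply: exp2z_bound.
      apply: le_trans b1; apply: le_trans (ler_norm _).
      rewrite ler_pdivlMr // -/(c1 z).
      have : l * pair y a <= mu * pair y a by rewrite ler_wpM2r // ltW.
      lra.
    rewrite -invr_expz -/(c1 z); apply: le_trans b2; apply: le_trans (ler_norm _).
    rewrite ler_pdivlMr // mulrC ler_pdivrMr //.
    have : l * (c1 z * pair (y *m phi w) a) <= mu * (c1 z * pair (y *m phi w) a).
      by rewrite ler_wpM2r // mulr_ge0 // ltW.
    lra.
  - have y1 := Pdpos _ f0 fF.
    have yp0 : f *m (phi (- w))^T != 0.
      by apply: contra f0 => /eqP h; rewrite -(phiTK w f) h mul0mx.
    have y2 := Pdpos _ yp0 (PdG (Gphi (- w)) fF).
    have trZ c (v : 'rV[R]_N) : (c *: v)^T = c *: v^T by apply/matrixP => i j; rewrite !mxE.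
    have trB c d (v v' : 'rV[R]_N) : (c *: v - d *: v')^T = c *: v^T - d *: v'^T.
      by apply/matrixP => i j; rewrite !mxE.
    have k2 := h2.1 x Cx; have k4 := h4.1 x Cx.
    rewrite trB pairBr !pairZr in k2.
    rewrite -{2}[f]scale1r trB trZ scale1r pairBr !pairZr in k4.
    apply: exp2z_bound.
      apply: le_trans b3; apply: le_trans (ler_norm _).
      rewrite ler_pdivlMr // -/(c2 z).
      have : l * pair x f^T <= mu * pair x f^T by rewrite ler_wpM2r // ltW.
      lra.
    rewrite -invr_expz -/(c2 z); apply: le_trans b4; apply: le_trans (ler_norm _).
    rewrite ler_pdivlMr // mulrC ler_pdivrMr //.
    have : l * (c2 z * pair x (f *m (phi (- w))^T)^T) <= mu * (c2 z * pair x (f *m (phi (- w))^T)^T).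
      by rewrite ler_wpM2r // mulr_ge0 // ltW.
    lra.
by apply/allpairsP; exists (w, p); split => //; rewrite hsubmxK.
Qed.

(** Cocompactness gives a lattice element moving [x0] about as [g] does, so [g] times the inverse of
    its [phi] part coarsely stabilizes both rays. The finitely many coarse stabilizers thus
    represent all cosets. *)
Lemma lattice_finite_index : exists t : seq 'M[R]_N, forall g, G g ->
  exists2 h, h \in t & exists z, invmx h *m g = phi z.
Proof.
have Kx0 : K x0.
  rewrite /K /x0 row_mxKl row_mxKr; split; first exact: (unit_cone_unit (@cl0 _ _ C)).
  exact: (unit_cone_unit pd0).
have [l Hl] : exists l, forall v, K v -> exists z,
    K (l *: v - x0 *m Phi z) /\ K (l *: (x0 *m Phi z) - v).
  apply: (@lattice_cocompact _ _ _ Phi K (prod_space U U') x0 PhiD Phi0) => //.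
  - by move=> v [[h1 _] [h2 _]]; rewrite -[v]hsubmxK prod_spaceP.
  - move=> u v [h1 h2] [h3 h4]; rewrite /K !linearD /=; split.
      exact: (unit_coneD clD).
    exact: (unit_coneD pdD).
  - move=> c v cc0 [h1 h2]; rewrite /K !linearZ /=; split.
      exact: (unit_coneZ clZ).
    exact: (unit_coneZ pdZ).
  - move=> v [h1 h2].
    have [d1 d10 hd1] := unit_cone_open clD clZ ycl k0 yunit h1.
    have [d2 d20 hd2] := unit_cone_open pdD pdZ fF k'0 funit h2.
    exists (Num.min d1 d2); first by rewrite lt_min d10.
    move=> w /prod_space_sub[w1 w2]; rewrite lt_min => /andP[lt1 lt2]; split.
      by apply: hd1 => //; rewrite -linearB; apply: le_lt_trans lt1; rewrite [leRHS]nrm_sub lerDl nrm_ge0.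
    by apply: hd2 => //; rewrite -linearB; apply: le_lt_trans lt2; rewrite [leRHS]nrm_sub lerDr nrm_ge0.
  - by move=> v _; apply: Ksalient.
  - exact: leq_trans (dim_prod_space _ _) dims.
pose mu := `|l| + 1; have mu0 : 0 < mu by rewrite ltr_wpDl.
have lmu : 0 <= mu - l by rewrite /mu; have := ler_norm l; lra.
have [t tP] := stab_finite mu0; exists t => g Gg.
have ug := ca_unit CA Gg; have Gi := ca_inv CA Gg.
have [z] := Hl _ (Kact Gg Kx0).
rewrite /x0 PhiE !row_mxKl !row_mxKr; set w := lsubmx z.
rewrite /K !linearB !linearZ /= !row_mxKl !row_mxKr => -[[h1 h2] [h3 h4]].
have {}h1 := unit_cone_sub clD clZ ycl h1.
have {}h3 := unit_cone_sub clD clZ ycl h3.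
have {}h2 := unit_cone_sub pdD pdZ fF h2.
have {}h4 := unit_cone_sub pdD pdZ fF h4.
have d1 := c1_gt0 z; have d2 := c2_gt0 z.
have n1 : c1 z != 0 by rewrite gt_eqF.
have n2 : c2 z != 0 by rewrite gt_eqF.
have i1 : 0 <= (c1 z)^-1 by rewrite invr_ge0 ltW.
have i2 : 0 <= (c2 z)^-1 by rewrite invr_ge0 ltW.
have hV : invmx (g *m phi (- w)) = phi w *m invmx g.
  have u1 := ca_unit CA (Gphi (- w)).
  have E : g *m phi (- w) *m (phi w *m invmx g) = 1%:M.
    by rewrite -mulmxA (mulmxA (phi (- w))) -phiD addNr phi0 mul1mx mulmxV.
  by rewrite -[LHS]mulmx1 -E mulKmx // unitmx_mul ug.
exists (g *m phi (- w)); last by exists w; rewrite hV mulmxKV.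
apply: tP; split; first exact: (ca_mul CA).
exists (c1 z), (c2 z)^-1; split; rewrite ?invr_gt0 //.
- split.
    have := clG (Gphi (- w)) h3; rewrite mulmxBl -!scalemxAl phiK => h.
    have -> : (mu * c1 z) *: y - y *m (g *m phi (- w)) =
        (l *: (c1 z *: y) - y *m g *m phi (- w)) + ((mu - l) * c1 z) *: y.
      by rewrite mulmxA; apply/rowP => j; rewrite !mxE; ring.
    by apply: clD => //; apply: clZ => //; rewrite mulr_ge0 // ltW.
  have := clG Gi h1; rewrite mulmxBl -!scalemxAl mulmxK // => h.
  have -> : (mu / c1 z) *: y - y *m invmx (g *m phi (- w)) =
      (c1 z)^-1 *: ((l *: y - c1 z *: (y *m phi w *m invmx g)) + (mu - l) *: y).
    by rewrite hV mulmxA; apply/rowP => j; rewrite !mxE; field.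
  by apply: clZ => //; apply: clD => //; apply: clZ.
- have := PdG Gg h2; rewrite mulmxBl -!scalemxAl -mulmxA -trmx_mul mulmxV // trmx1 mulmx1 => h.
  have -> : (mu / c2 z) *: f - f *m (g *m phi (- w))^T =
      (c2 z)^-1 *: ((l *: f - c2 z *: (f *m (phi (- w))^T *m g^T)) + (mu - l) *: f).
    by rewrite trmx_mul mulmxA; apply/rowP => j; rewrite !mxE; field.
  by apply: pdZ => //; apply: pdD => //; apply: pdZ.
have := PdG (Gphi w) h4; rewrite mulmxBl -!scalemxAl phiTK => h.
have -> : (mu / (c2 z)^-1) *: f - f *m (invmx (g *m phi (- w)))^T =
    (l *: (c2 z *: f) - f *m (invmx g)^T *m (phi w)^T) + ((mu - l) * c2 z) *: f.
  by rewrite hV trmx_mul mulmxA; apply/rowP => j; rewrite !mxE; field.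
by apply: pdD => //; apply: pdZ => //; rewrite mulr_ge0 // ltW.
Qed.

End LatticeIndex.

(** * From the projective to the linear action *)

Section UnimodularLift.
Variables (R : realType) (n : nat).
Variables (Omega : 'rV[R]_n.+1 -> Prop) (Gamma : 'M[R]_n.+1 -> Prop).
Variables (a : 'cV[R]_n.+1) (M : R).
Hypothesis Omega_scale : forall v (c : R), Omega v -> c != 0 -> Omega (c *: v).
Hypothesis Omega_open : open_cone Omega.
Hypothesis chart : forall v, Omega v -> pair v a != 0.
Hypothesis convex : forall x y (t : R), Omega x -> Omega y -> pair x a = 1 ->
  pair y a = 1 -> 0 <= t -> t <= 1 -> Omega (t *: x + (1 - t) *: y).
Hypothesis bounded : forall v, Omega v -> pair v a = 1 -> forall i, `|v 0 i| <= M.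
Hypothesis GammaP : pgl_subgroup Gamma.
Hypothesis GammaO : forall g, Gamma g -> preserves Omega g.
Hypothesis discrete : discrete_pgl Gamma.
Variable x : 'rV[R]_n.+1.

Definition positive_half v := Omega v /\ 0 < pair v a.
Local Notation C := positive_half.
Hypothesis Cx : C x.

(** The determinant fixes the scale and the cone fixes the sign, so each class of [Gamma] has
    exactly one such representative. *)
Definition unimodular_lift (g : 'M[R]_n.+1) :=
  [/\ Gamma g, `|\det g| = 1 & forall v, C v -> C (v *m g)].

Lemma half_scale c v : 0 < c -> C v -> C (c *: v).
Proof. by move=> c0 [Ov av]; split; [apply: Omega_scale => //; lra|rewrite pairZl mulr_gt0]. Qed.

Lemma half_add v w : C v -> C w -> C (v + w).
Proof.
move=> [Ov av] [Ow aw]; split; last by rewrite pairDl addr_gt0.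
have s0 : pair v a + pair w a != 0 by rewrite gt_eqF // addr_gt0.
have v0 : pair v a != 0 by rewrite gt_eqF.
have w0 : pair w a != 0 by rewrite gt_eqF.
have -> : v + w = (pair v a + pair w a) *: ((pair v a / (pair v a + pair w a)) *: ((pair v a)^-1 *: v)
    + (1 - pair v a / (pair v a + pair w a)) *: ((pair w a)^-1 *: w)).
  by apply/rowP => j; rewrite !mxE; field; rewrite s0 v0 w0.
apply: Omega_scale s0; apply: convex.
- by apply: Omega_scale; rewrite ?invr_eq0.
- by apply: Omega_scale; rewrite ?invr_eq0.
- by rewrite pairZl mulVf.
- by rewrite pairZl mulVf.
- by rewrite divr_ge0 ?addr_ge0 // ltW.
by rewrite ler_pdivrMr ?addr_gt0 // mul1r lerDl ltW.
Qed.

Lemma half_open v : C v -> exists2 e, 0 < e & forall w, nrm (w - v) < e -> C w.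
Proof.
move=> [Ov av]; have [e [e0 he]] := Omega_open Ov.
have d0 : 0 < pair v a / (nrm a + 1) by rewrite divr_gt0 // ltr_wpDl // nrm_ge0.
exists (Num.min e (pair v a / (nrm a + 1))); first by rewrite lt_min e0.
move=> w; rewrite lt_min => /andP[h1 h2]; split.
  by apply: he => i; apply: le_lt_trans h1; have := entry_le_nrm (w - v) 0 i; rewrite !mxE.
have := pair_le (w - v) a; rewrite pairBl ler_norml => /andP[h3 _].
move: h2; rewrite ltr_pdivlMr; last by rewrite ltr_wpDl // nrm_ge0.
have := nrm_ge0 (w - v); nra.
Qed.

Lemma half_sign v : Omega v -> C v \/ C (- v).
Proof.
move=> Ov; have := chart Ov; rewrite neq_lt => /orP[h|h]; [right|by left].
by rewrite -scaleN1r; split; [apply: Omega_scale => //; rewrite oppr_eq0 oner_eq0|rewrite pairZl; lra].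
Qed.

Lemma half_chart v : C v -> 0 < pair v a /\ nrm v <= ((1 * n.+1)%:R * M) * pair v a.
Proof.
move=> [Ov av]; split => //; have v0 : pair v a != 0 by rewrite gt_eqF.
have -> : nrm v = nrm ((pair v a)^-1 *: v) * pair v a.
  by rewrite nrmZ gtr0_norm ?invr_gt0 // mulrAC mulVf // mul1r.
rewrite ler_wpM2r ?(ltW av) //; apply: nrm_le => i j; rewrite (ord1 i).
by apply: bounded; [apply: Omega_scale; rewrite ?invr_eq0|rewrite pairZl mulVf].
Qed.

Lemma half_asym v : C v -> C (- v) -> False.
Proof. by move=> [_ h1] [_]; rewrite pairNl; lra. Qed.

(** If the sign changed from [x] to [v], a positive combination of them would be sent to the zero
    set of [a], which misses [Omega]. *)
Lemma half_act g : Gamma g ->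
  (forall v, C v -> C (v *m g)) \/ (forall v, C v -> C (- (v *m g))).
Proof.
move=> /GammaO[_ Og]; have sgn (v : 'rV[R]_n.+1) : C v -> C (v *m g) \/ C (- (v *m g)).
  by move=> [Ov _]; apply: half_sign; rewrite -(Og v).
have [Cxg|Cxg] := sgn x Cx; [left|right] => v Cv.
  have [//|h] := sgn v Cv; exfalso.
  have [[_ p1] [_ p2]] := (Cxg, h); rewrite pairNl in p2.
  have q2 : 0 < - pair (v *m g) a by lra.
  have [Ou _] := half_add (half_scale q2 Cx) (half_scale p1 Cv).
  have /chart/eqP := (Og _).1 Ou; apply.
  by rewrite mulmxDl -!scalemxAl pairDl !pairZl; ring.
have [h|//] := sgn v Cv; exfalso.
have [[_ p1] [_ p2]] := (Cxg, h); rewrite pairNl in p1.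
have q1 : 0 < - pair (x *m g) a by lra.
have [Ou _] := half_add (half_scale q1 Cv) (half_scale p2 Cx).
have /chart/eqP := (Og _).1 Ou; apply.
by rewrite mulmxDl -!scalemxAl pairDl !pairZl; ring.
Qed.

Lemma Gamma_scale c g : c != 0 -> Gamma g -> Gamma (c *: g).
Proof. by case: GammaP => [_ [H [H' _]]] c0 Gg; rewrite -mul_scalar_mx; apply: H' => //; apply: H. Qed.

Lemma root_exists (r : R) : 0 < r -> exists2 c, 0 < c & c ^+ n.+1 = r.
Proof.
move=> r0; exists (expR (ln r / n.+1%:R)); first exact: expR_gt0.
by rewrite -expRM_natl mulrC divfK ?pnatr_eq0 // lnK // posrE.
Qed.

Lemma lift_exists g : Gamma g -> exists2 c, c != 0 & unimodular_lift (c *: g).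
Proof.
move=> Gg; have ug : g \in unitmx by case: GammaP => [H _]; apply: H.
have d0 : 0 < `|\det g|^-1 by rewrite invr_gt0 normr_gt0 -unitfE -unitmxE.
have [c c0 hc] := root_exists d0.
have nd : c ^+ n.+1 * `|\det g| = 1 by rewrite hc mulVf // -invr_eq0 gt_eqF.
have [h|h] := half_act Gg; [exists c|exists (- c)]; rewrite ?oppr_eq0 ?(gt_eqF c0) //.
  split; first by apply: Gamma_scale; rewrite ?gt_eqF.
    by rewrite detZ normrM normrX (gtr0_norm c0).
  by move=> v Cv; rewrite -scalemxAr; apply: half_scale => //; apply: h.
split; first by apply: Gamma_scale; rewrite ?oppr_eq0 ?gt_eqF.
  by rewrite detZ normrM normrX normrN (gtr0_norm c0).
by move=> v Cv; rewrite -scalemxAr scaleNr -scalerN; apply: half_scale => //; apply: h.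
Qed.

Lemma lift_unique g h : unimodular_lift g -> unimodular_lift h -> pequiv g h -> g = h.
Proof.
move=> [_ dg ag] [_ dh ah] [c [c0 E]].
have c1 : `|c| = 1.
  move: dg; rewrite E detZ normrM dh mulr1 normrX => /eqP.
  by rewrite pexpr_eq1 // => /eqP.
have := ag x Cx; rewrite E -scalemxAr.
have [cp|cn] := lerP 0 c; first by move: c1; rewrite ger0_norm // => ->; rewrite !scale1r.
move: c1; rewrite ltr0_norm // => c1; have -> : c = -1 by rewrite -c1 opprK.
by rewrite scaleN1r => /(half_asym (ah _ Cx)).
Qed.

Lemma lift_one : unimodular_lift 1%:M.
Proof.
split; [|by rewrite det1 normr1|by move=> v; rewrite mulmx1].
by case: GammaP => [_ [H _]]; apply: H; rewrite oner_eq0.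
Qed.

Lemma lift_mul g h : unimodular_lift g -> unimodular_lift h -> unimodular_lift (g *m h).
Proof.
move=> [Gg dg ag] [Gh dh ah]; split.
- by case: GammaP => [_ [_ [H _]]]; apply: H.
- by rewrite det_mulmx normrM dg dh mulr1.
by move=> v Cv; rewrite mulmxA; apply/ah/ag.
Qed.

Lemma lift_inv g : unimodular_lift g -> unimodular_lift (invmx g).
Proof.
move=> [Gg dg ag]; have [H [_ [_ Hi]]] := GammaP; split; first exact: Hi.
  by rewrite det_inv normfV dg invr1.
move=> v Cv; have [ug Og] := GammaO Gg.
have : Omega (v *m invmx g) by apply/Og; rewrite mulmxKV //; case: Cv.
move=> /half_sign[//|/ag]; rewrite mulNmx mulmxKV // => h.
by case: (half_asym Cv h).
Qed.

Lemma lift_action : convex_action C a ((1 * n.+1)%:R * M) unimodular_lift.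
Proof.
split.
- exact: half_add.
- exact: half_scale.
- exact: half_open.
- exact: half_chart.
- exact: lift_one.
- exact: lift_mul.
- exact: lift_inv.
- by move=> g [Gg _ _]; case: GammaP => [H _]; apply: H.
- by move=> g [].
- by move=> g v [_ _]; apply.
have [G1 _ _] := lift_one; have [e [e0 he]] := discrete G1; exists e => // g Lg h.
apply: lift_unique => //; first exact: lift_one.
have [Gg _ _] := Lg; apply: (he g 1) => //; first exact: oner_neq0.
move=> i j; apply: le_lt_trans h; rewrite mul1r.
by have := entry_le_nrm (g - 1%:M) i j; rewrite !mxE.
Qed.

(** The nonzero multiples of the subgroup form its full preimage; by uniqueness of lifts, [z] being
    different from 1 is not scalar. *)
Lemma lift_normal_abelian : normal_abelian unimodular_lift ->
  exists N, nontrivial_normal_abelian Gamma N.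
Proof.
move=> [A [AG A1 Amul Anorm [Acomm [z Az z1]]]].
pose N g := exists c h, [/\ c != 0, A h & g = c *: h].
have uA h : A h -> h \in unitmx by move=> /AG/(ca_unit lift_action).
exists N; split; [split; [|split; [|split]]|split; [|split; [|split]]].
- by move=> g [c [h [c0 Ah ->]]]; rewrite unitmxZ ?unitfE // uA.
- by move=> c c0; exists c, 1%:M; rewrite scalemx1.
- move=> _ _ [c [h [c0 Ah ->]]] [c' [h' [c'0 Ah' ->]]].
  exists (c * c'), (h *m h'); split; [exact: mulf_neq0|by have [] := Amul _ _ Ah Ah'|].
  by rewrite -scalemxAl -scalemxAr scalerA.
- move=> _ [c [h [c0 Ah ->]]]; exists c^-1, (invmx h).
  have [_ Ai] := Amul _ _ Ah Ah.
  by rewrite invr_eq0 invmxZ // unitmxZ ?unitfE // uA.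
- by move=> _ [c [h [c0 Ah ->]]]; apply: Gamma_scale => //; case: (AG _ Ah).
- move=> g _ Gg [c [h [c0 Ah ->]]]; have [d d0 Ld] := lift_exists Gg.
  exists c, (invmx (d *: g) *m h *m (d *: g)); split => //; first exact: Anorm.
  have ug : g \in unitmx by case: GammaP => [H _]; apply: H.
  have -> : invmx (d *: g) *m h *m (d *: g) = invmx g *m h *m g.
    rewrite invmxZ ?unitmxZ ?unitfE // -scalemxAr -!scalemxAl scalerA mulfV //.
    by rewrite scale1r.
  by rewrite -scalemxAr -scalemxAl.
- move=> _ _ [c [h [c0 Ah ->]]] [c' [h' [c'0 Ah' ->]]]; exists 1; split; first exact: oner_neq0.
  by rewrite scale1r -!scalemxAl -!scalemxAr !scalerA (Acomm _ _ Ah Ah') mulrC.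
exists z; split; first by exists 1, z; rewrite scale1r oner_neq0.
move=> sz; move/eqP: z1; apply; apply: lift_unique sz; [exact: AG|exact: lift_one].
Qed.

(** The invertible matrices commuting with [z] form a subgroup containing the scalars, so it
    contains [Gamma] once it contains the generators. *)
Lemma lift_generators : finitely_generated Gamma -> exists s : seq 'M[R]_n.+1,
  (forall g, g \in s -> unimodular_lift g) /\
  forall z, unimodular_lift z -> (forall g, g \in s -> z *m g = g *m z) ->
    forall g, unimodular_lift g -> z *m g = g *m z.
Proof.
move=> [s [sG gen]].
have [s' [s'L s's]] : exists s' : seq 'M[R]_n.+1, (forall g, g \in s' -> unimodular_lift g) /\
    forall g, g \in s -> exists2 c, c != 0 & c *: g \in s'.
  elim: s sG {gen} => [|g s IH] sG; first by exists [::].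
  have [|s' [h1 h2]] := IH; first by move=> h hs; apply: sG; rewrite inE hs orbT.
  have [c c0 Lc] := lift_exists (sG g (mem_head _ _)); exists (c *: g :: s'); split.
    by move=> h; rewrite inE => /predU1P[->//|/h1].
  move=> h; rewrite inE => /predU1P[->|/h2[d d0 hd]]; first by exists c => //; rewrite mem_head.
  by exists d => //; rewrite inE hd orbT.
exists s'; split => // z Lz zs g [Gg _ _].
have [||_ //] := gen (fun h => h \in unitmx /\ z *m h = h *m z) _ _ g Gg.
  split; [by move=> h []|split; [|split]].
  - by move=> c c0; rewrite unitmxE det_scalar unitrX ?unitfE //; split => //; rewrite mul_mx_scalar mul_scalar_mx.
  - by move=> h k [uh ch] [uk ck]; rewrite unitmx_mul uh uk mulmxA ch -mulmxA ck mulmxA.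
  move=> h [uh ch]; rewrite unitmx_inv uh; split => //.
  by rewrite -[LHS](mulKmx uh) (mulmxA h) -ch -mulmxA mulmxV // mulmx1.
move=> h hs; have [c c0 cs] := s's h hs; split.
  by case: GammaP => [H _]; apply: H; apply: sG.
by apply: (scalerI c0); rewrite scalemxAr zs // scalemxAl.
Qed.

(** A compact set in the open [Omega] has a uniform neighbourhood there, by a limit argument. A ball
    in [Omega] around a point of [C] stays in [C], since leaving it would cross the zero set of
    [a]. *)
Lemma lift_cocompact : compact_quotient Omega Gamma ->
  exists e b, 0 < e /\ cocompact_action C unimodular_lift e b.
Proof.
move=> [K [KO [[B KB] [Kcl cov]]]].
pose b := (1 * n.+1)%:R * B.
have Kb v : K v -> nrm v <= b by move=> Kv; apply: nrm_le => i j; rewrite (ord1 i); apply: KB.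
have [N HN] : exists N : nat, forall v w, K v -> nrm (w - v) < N.+1%:R^-1 -> Omega w.
  apply: contrapT => h.
  have P (N : nat) : exists p : 'rV[R]_n.+1 * 'rV[R]_n.+1,
      [/\ K p.1, nrm (p.2 - p.1) < N.+1%:R^-1 & ~ Omega p.2].
    apply: contrapT => h2; apply: h; exists N => v w Kv hw; apply: contrapT => nO.
    by apply: h2; exists (v, w).
  have [p pP] := choice P.
  have [L hL] : exists L, mlim (fun t => (p t).1) L.
    by apply: (mlim_ex (c := b)) => t; apply: Kb; case: (pP t).
  have KL : K L.
    apply: Kcl => e e0; have [t ht] := ev_ex (hL e e0); exists (p t).1; split; first by case: (pP t).
    by move=> i; apply: le_lt_trans ht; have := entry_le_nrm ((p t).1 - L) 0 i; rewrite !mxE.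
  have [e [e0 he]] := Omega_open (KO _ KL); have e2 : 0 < e / 2 by rewrite divr_gt0.
  have [t [ht1 ht2]] := ev_ex (ev_and (hL _ e2) (ev_small e2)).
  have [_ h1 h2] := pP t; apply: h2; apply: he => i.
  have := entry_le_nrm ((p t).2 - L) 0 i; rewrite !mxE => h2.
  apply: le_lt_trans h2 _; have {}h1 := lt_trans h1 ht2.
  have := nrmD ((p t).2 - (p t).1) ((p t).1 - L); rewrite addrA subrK; lra.
have e0 : 0 < N.+1%:R^-1 :> R by rewrite invr_gt0.
exists N.+1%:R^-1, b; split => //.
have tk (k : 'rV[R]_n.+1) : C k -> nrm k <= b ->
    (forall w, nrm (w - k) < N.+1%:R^-1 -> Omega w) -> thick C N.+1%:R^-1 b k.
  move=> Ck kb ball; split => // w hw; split; first exact: ball.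
  rewrite ltNge; apply/negP => pw; have [_ pk] := Ck.
  have d0 : 0 < pair k a - pair w a by lra.
  pose s := pair k a / (pair k a - pair w a).
  have s0 : 0 <= s by rewrite divr_ge0 // ltW.
  have s1 : s <= 1 by rewrite ler_pdivrMr // mul1r; lra.
  have /chart/eqP : Omega (k + s *: (w - k)).
    apply: ball; rewrite addrC addKr nrmZ ger0_norm //; apply: le_lt_trans hw.
    by rewrite ler_piMl // nrm_ge0.
  apply; rewrite pairDl pairZl pairBl /s.
  by field; rewrite gt_eqF.
move=> v Cv; have [g [w [c [Gg [Kw [c0 E]]]]]] := cov v Cv.1.
have [d d0 Ld] := lift_exists Gg; have [_ _ aL] := Ld.
have Ed : v = (c / d) *: (w *m (d *: g)) by rewrite -scalemxAr scalerA divfK.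
have cd0 : c / d != 0 by rewrite mulf_neq0 ?invr_eq0.
have [Cw|Cw] := half_sign (KO _ Kw).
  exists (d *: g), w, (c / d); split => //.
    by apply: tk => //; [exact: Kb|move=> w'; apply: HN].
  rewrite lt_neqAle eq_sym cd0 leNgt; apply/negP => cd.
  have cd' : 0 < - (c / d) by lra.
  have := half_scale cd' (aL _ Cw).
  by rewrite scaleNr -Ed => /(half_asym Cv).
exists (d *: g), (- w), (- (c / d)); split => //.
- apply: tk => //; first by rewrite nrmN; apply: Kb.
  move=> w' hw'; rewrite -[w']opprK -scaleN1r; apply: Omega_scale; rewrite ?oppr_eq0 ?oner_eq0 //.
  by apply: HN Kw _; rewrite -nrmN opprB opprK addrC; move: hw'; rewrite opprK addrC.
- rewrite lt_neqAle eq_sym oppr_eq0 cd0 leNgt; apply/negP => cd.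
  have cd' : 0 < c / d by lra.
  have := half_scale cd' (aL _ Cw).
  by rewrite mulNmx scalerN -Ed => /(half_asym Cv).
by rewrite mulNmx scaleNr scalerN opprK.
Qed.

End UnimodularLift.

(** * Groups preserving a proper subspace *)

Section InvariantSubspace.
Variables (R : realType) (n : nat) (C : 'rV[R]_n.+1 -> Prop) (a : 'cV[R]_n.+1) (m : R).
Variable G : 'M[R]_n.+1 -> Prop.
Hypothesis CA : convex_action C a m G.
Variable x : 'rV[R]_n.+1.
Hypothesis Cx : C x.
Variable s : seq 'M[R]_n.+1.
Hypothesis sG : forall g, g \in s -> G g.
Hypothesis gen : forall z, G z -> (forall g, g \in s -> z *m g = g *m z) ->
  forall g, G g -> z *m g = g *m z.
Implicit Types U W : {vspace 'rV[R]_n.+1}.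

Let cC : salient_cone C := action_salient CA (ex_intro _ x Cx).

Let proper_dim W : W != fullv -> (\dim W <= n)%N.
Proof.
move=> Wf; have h : \dim {: 'rV[R]_n.+1} = n.+1 by rewrite dimvf /dim /= mul1n.
have := dimvS (subvf W); rewrite h leq_eqVlt ltnS => /predU1P[e|//].
by case/eqP: Wf; apply/eqP; rewrite eqEdim subvf h e leqnn.
Qed.

(** The part of the closure of [C] lying in [U] is an invariant cone, and its span inherits
    invariance by minimality. *)
Lemma invariant_face U : (forall g u, G g -> u \in U -> u *m g \in U) ->
  ~ (forall u, u \in U -> cl C u -> u = 0) ->
  exists W y k, [/\ forall g u, G g -> u \in W -> u *m g \in W, y \in W /\ cl C y,
    0 <= k /\ (forall u, u \in W -> cl C ((k * nrm u) *: y - u)), y != 0 & (W <= U)%VS].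
Proof.
move=> UG nU; pose P u := u \in U /\ cl C u.
have [|u v [uU cu] [vU cv]|c v c0 [vU cv]|W [y [k [PW yW [yU cy] [k0 yunit] Wmin]]]] := @cone_span_unit R n.+1 P.
- by split; [exact: mem0v|exact: cl0].
- by split; [exact: memvD|exact: cl_add].
- by split; [exact: memvZ|exact: (cl_scale cC)].
exists W, y, k; split => //.
- move=> g u Gg uW; have : (W <= linfun (mulmxr g) @^-1: W)%VS.
    apply: Wmin => v [vU cv]; rewrite -memv_preim lfunE; apply: PW; split; first exact: UG.
    exact: (action_cl CA).
  by move=> /subvP/(_ u uW); rewrite -memv_preim lfunE.
- by split=> // u uW; have [] := yunit u uW.
- apply/eqP => y0; apply: nU => u uU cu; apply: (cone_salient cC) => //.
  by have [_] := yunit u (PW _ (conj uU cu)); rewrite y0 scaler0 add0r.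
by apply: Wmin => v [].
Qed.

(** Written as row vectors, the dual face is orthogonal to [U] for the standard scalar product;
    hence the bound on dimensions. *)
Lemma dual_span U : (forall g u, G g -> u \in U -> u *m g \in U) ->
  exists W f k, [/\ forall g u, G g -> u \in W -> u *m g^T \in W,
    f \in W /\ dual_face C U f, forall w, dual_face C U w -> w \in W,
    0 <= k /\ (forall w, w \in W -> dual_face C U ((k * nrm w) *: f - w))
    & (\dim U + \dim W <= n.+1)%N].
Proof.
move=> UG.
have [W [f [k [PW fW ff [k0 funit] Wmin]]]] :=
  cone_span_unit (@dual_face0 _ _ C U) (@dual_faceD _ _ C U) (@dual_faceZ _ _ C U).
have ann u w : u \in U -> w \in W -> u *m w^T = 0.
  move=> uU wW; have : (W <= lker (linfun (mulmxr u^T : 'rV[R]_n.+1 -> 'rV_1)))%VS.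
    apply: Wmin => v [_ hv]; rewrite memv_ker lfunE /=; apply/eqP.
    by rewrite [LHS]mx11_scalar -/(pair v u^T) pair_tr trmxK hv // raddf0.
  move=> /subvP/(_ w wW); rewrite memv_ker lfunE /= => /eqP h.
  by rewrite -[u]trmxK -trmx_mul h trmx0.
exists W, f, k; split => //.
  move=> g u Gg uW; have : (W <= linfun (mulmxr g^T) @^-1: W)%VS.
    apply: Wmin => v hv; rewrite -memv_preim lfunE; apply: PW.
    by apply: (dual_face_act CA) => // u'; apply: UG.
  by move=> /subvP/(_ u uW); rewrite -memv_preim lfunE.
have cap0 : (U :&: W = 0)%VS.
  apply/eqP; rewrite -subv0; apply/subvP => u /memv_capP[uU uW]; rewrite memv0.
  have /matrixP/(_ 0 0) := ann u u uU uW; rewrite !mxE => h.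
  apply/eqP/rowP => j; apply/eqP; rewrite mxE -sqrf_eq0; apply/eqP; rewrite expr2.
  have /psumr_eq0P : \sum_j u 0 j * u^T j 0 = 0 := h.
  by move=> /(_ _ j isT); rewrite mxE; apply => i _; rewrite mxE -expr2 sqr_ge0.
rewrite -dimv_disjoint_sum //; apply: leq_trans (dimvS (subvf _)) _.
by rewrite dimvf /dim /= mul1n.
Qed.

Lemma cocompact_normal_abelian e b U : 0 < e -> cocompact_action C G e b ->
  (forall g u, G g -> u \in U -> u *m g \in U) -> U != 0%VS -> U != fullv ->
  normal_abelian G.
Proof.
move=> e0 cc UG U0 Uf.
have UC u : u \in U -> ~ C u.
  by move=> uU Cu; apply: (cocompact_avoids_interior CA Cx UG e0 cc Uf uU Cu).
have nU : ~ (forall u, u \in U -> cl C u -> u = 0).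
  by apply: (cocompact_meets_closure CA Cx UG e0 cc (memv_pick U)); rewrite vpick0.
have [W [y [k [WG [yW cy] [k0 yunit] y0 WU]]]] := invariant_face UG nU.
apply: (cocompact_face_normal_abelian CA Cx WG yW cy yunit _ e0 cc y0 sG gen).
by move=> u /(subvP WU); apply: UC.
Qed.

Variable phi : 'rV[int]_(n - 1)%N -> 'M[R]_n.+1.
Hypothesis phiD : forall v w, phi (v + w) = phi v *m phi w.
Hypothesis phi0 : phi 0 = 1%:M.
Hypothesis Gphi : forall z, G (phi z).
Hypothesis phi_inj : injective phi.

Let bounded_finite1 (P : 'rV[int]_1 -> Prop) (B : nat) :
  (forall p, P p -> `|p 0 0| <= B%:Z) -> finite_pred P.
Proof.
move=> H; have [l lP] := @box_finite 1 B; exists l => p /H h.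
by apply: lP => i; rewrite ord1.
Qed.

(** If [U] meets [C], the face is all of [U] and the dual factor is taken to be 0; if [U] meets the
    closure of [C] only at 0, the face factor is 0; otherwise both are nonzero. The scalings number
    1, 1 and 2, which brings the rank up to the dimension in each case. *)
Lemma lattice_normal_abelian U : (forall g u, G g -> u \in U -> u *m g \in U) ->
  U != 0%VS -> U != fullv -> ~ normal_abelian G ->
  exists t : seq 'M[R]_n.+1, forall g, G g ->
  exists2 h, h \in t & exists z, invmx h *m g = phi z.
Proof.
move=> UG U0 Uf nab; have dU := proper_dim Uf.
have dU0 : (0 < \dim U)%N by rewrite lt0n dimv_eq0.
(* The subtraction is not truncated: a proper nonzero subspace forces [n >= 1]. *)
have rn : (n - 1 + 1 = n)%N by rewrite subnK //; apply: leq_trans dU0 dU.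
pose p00 (p : 'rV[int]_1) := p 0 0.
have p00D p q : p00 (p + q) = p00 p + p00 q by rewrite /p00 mxE.
have [[y yU Cy]|UC] := pselect (exists2 y, y \in U & C y).
  have y0 : y != 0.
    by apply/eqP => y0; have [] := ca_chart CA Cy; rewrite y0 pair0l ltxx.
  have [c cp hc] := order_unit cC Cy.
  pose k := c; have yunit u : u \in U -> cl C ((k * nrm u) *: y - u).
    move=> _; have := nrm_ge0 u; rewrite le_eqVlt => /predU1P[h|h].
      by rewrite -h (nrm_eq0 (esym h)) mulr0 scale0r subr0; apply: cl0.
    by apply: (cl_cone cC); apply: hc.
  apply: (@lattice_finite_index R n.+1 C a m G CA x Cx U U 0 y 0 k 0 UG UG _ yU _ (ltW cp) yunit
    _ _ _ _ (n - 1) 1 phi p00 p00 phiD phi0 Gphi phi_inj p00D p00D).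
  - by move=> g u _; rewrite !memv0 => /eqP ->; rewrite mul0mx.
  - exact: (cl_cone cC).
  - exact: mem0v.
  - exact: dual_face0.
  - by [].
  - by move=> w; rewrite memv0 => /eqP ->; rewrite scaler0 subr0; apply: dual_face0.
  - by move=> B; apply: (@bounded_finite1 _ B) => p [h _]; apply: h.
  - by rewrite dimv0 addn0 rn.
  by move=> mu mu0; apply: (interior_stab_finite CA).
have {}UC u : u \in U -> ~ C u by move=> uU Cu; apply: UC; exists u.
have [Ucl|Ucl] := pselect (forall u, u \in U -> cl C u -> u = 0).
  have [U' [f [k' [UG' [fU' ff] PU' [k'0 funit] dUU]]]] := dual_span UG.
  have [f0 [k0 [f0U hk0]]] := transversal_functional CA Cx Ucl.
  have f1U : (k0 *: f0)^T \in U'.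
    apply: PU'; split => v hv; rewrite trmxK pairZr.
      by apply: le_trans (nrm_ge0 v) (hk0 v hv).
    by rewrite f0U // mulr0.
  have hf v : C v -> nrm v <= (k' * nrm (k0 *: f0)^T) * pair v f^T.
    move=> Cv; apply: le_trans (hk0 v Cv) _; have [h _] := funit _ f1U.
    have := h v Cv; rewrite pair_tr trmxK pairBl pairZl -pair_tr -[f in pair f]trmxK -pair_tr.
    by rewrite pairZr subr_ge0.
  have fn0 : f != 0.
    apply/eqP => h; have := hf x Cx; rewrite h trmx0 pair0r mulr0 => h2.
    have x0 : x = 0 by apply: nrm_eq0; apply/eqP; rewrite eq_le h2 nrm_ge0.
    by have [] := ca_chart CA Cx; rewrite x0 pair0l ltxx.
  apply: (@lattice_finite_index R n.+1 C a m G CA x Cx U 0 U' 0 f 0 k' UG _ UG' _ _ _ _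
    fU' ff k'0 funit (n - 1) 1 phi p00 p00 phiD phi0 Gphi phi_inj p00D p00D).
  - by move=> g u _; rewrite !memv0 => /eqP ->; rewrite mul0mx.
  - exact: mem0v.
  - exact: cl0.
  - by [].
  - by move=> u; rewrite memv0 => /eqP ->; rewrite scaler0 subr0; apply: cl0.
  - by move=> B; apply: (@bounded_finite1 _ B) => p [_ h]; apply: h.
  - by rewrite dimv0 rn; move: dUU dU0; lia.
  by move=> mu mu0; apply: (dual_stab_finite CA Cx 0 mu0 ff hf).
have [W [y [k [WG [yW cy] [k0 yunit] y0 WU]]]] := invariant_face UG Ucl.
have WC u : u \in W -> ~ C u by move=> /(subvP WU); apply: UC.
have [U' [f [k' [UG' [fU' ff] PU' [k'0 funit] dUU]]]] := dual_span WG.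
(* If [f] were 0, the dual face would be 0 and [bipolar] at 0 would produce a point of [C] in
   [W]. *)
have fn0 : f != 0.
  apply/eqP => f0.
  have dual0 w : dual_face C W w -> w = 0.
    move=> hw; have [c c1 hc] := dual_nrm CA Cx; have [h _] := funit w (PU' w hw).
    apply: nrm_eq0; apply/eqP; rewrite eq_le nrm_ge0 andbT; apply: le_trans (hc w hw.1) _.
    have := h x Cx; rewrite f0 scaler0 add0r linearN pairNr oppr_ge0 => h2.
    by rewrite mulr_ge0_le0.
  have [|u uW] := @bipolar R n.+1 C a m G CA x Cx W 0 WC; last by rewrite add0r; apply: WC.
  move=> h hn hC hU; exfalso; move/eqP: hn; apply; apply: trmx_inj.
  by rewrite trmx0; apply: dual0; split=> v hv; rewrite trmxK; auto.
pose q0 (p : 'rV[int]_2) := p 0 0; pose q1 (p : 'rV[int]_2) := p 0 1.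
have q0D p q : q0 (p + q) = q0 p + q0 q by rewrite /q0 mxE.
have q1D p q : q1 (p + q) = q1 p + q1 q by rewrite /q1 mxE.
apply: (@lattice_finite_index R n.+1 C a m G CA x Cx W W U' y f k k' WG WG UG' yW cy k0 yunit
    fU' ff k'0 funit (n - 1) 2 phi q0 q1 phiD phi0 Gphi phi_inj q0D q1D).
- move=> B; have [l lP] := @box_finite 2 B; exists l => p [/(_ y0) h0 /(_ fn0) h1].
  apply: lP => i; case: i => [[|[|//]] hi].
    by have -> : Ordinal hi = 0 by apply: val_inj.
  by have -> : Ordinal hi = 1 by apply: val_inj.
- by apply: leq_trans dUU _; rewrite (_ : 2 = 1 + 1)%N // addnA rn addn1.
move=> mu mu0; apply: contrapT => inf; apply: nab.
exact: (face_stab_normal_abelian CA Cx WG yW cy yunit WC ff PU' k'0 funit mu0 sG gen inf).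
Qed.

End InvariantSubspace.

Theorem theorem0p2 (R : realType) (n : nat)
    (Omega : 'rV[R]_(n.+1) -> Prop) (Gamma : 'M[R]_(n.+1) -> Prop) :
  properly_convex_domain Omega ->
  pgl_subgroup Gamma ->
  (forall g, Gamma g -> preserves Omega g) ->
  finitely_generated Gamma ->
  discrete_pgl Gamma ->
  torsion_free_pgl Gamma ->
  ~ (exists N, nontrivial_normal_abelian Gamma N) ->
  (compact_quotient Omega Gamma \/
   exists G : 'M[R]_(n.+1) -> Prop,
     pgl_subgroup G /\ (forall g, G g -> Gamma g) /\
     iso_Zk (n - 1)%N G /\ infinite_index Gamma G) ->
  ~ (exists U : 'M[R]_(n.+1),
       (0 < \rank U)%N /\ (\rank U < n.+1)%N /\
       forall g, Gamma g -> (U *m g <= U)%MS).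
Proof.
move=> [[_ Oscale] [[x0 Ox0] [Oopen [a [Oa [Oconv [M Obd]]]]]]] GP GO fg disc _ nab Hyp [U [U1 [U2 UG]]].
have chart v : Omega v -> pair v a != 0 by apply: Oa.
have conv x y (t : R) : Omega x -> Omega y -> pair x a = 1 -> pair y a = 1 -> 0 <= t -> t <= 1 ->
    Omega (t *: x + (1 - t) *: y) by apply: Oconv.
have bdd v : Omega v -> pair v a = 1 -> forall i, `|v 0 i| <= M by apply: Obd.
have [x Cx] : exists x, positive_half Omega a x.
  by have [h|h] := half_sign Oscale chart Ox0; [exists x0|exists (- x0)].
have CA := lift_action Oscale Oopen chart conv bdd GP GO disc Cx.
have [s [sG gen]] := lift_generators Oscale chart conv GP GO Cx fg.
have nab1 : ~ normal_abelian (unimodular_lift Omega Gamma a).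
  by move=> /(lift_normal_abelian Oscale Oopen chart conv bdd GP GO disc Cx).
pose V := (linfun (mulmxr U : 'rV[R]_n.+1 -> 'rV_n.+1) @: fullv)%VS.
have VP (u : 'rV[R]_n.+1) : (u \in V) = (u <= U)%MS.
  apply/memv_imgP/idP => [[v _ ->]|/submxP[v ->]]; first by rewrite lfunE /= submxMl.
  by exists v; rewrite ?memvf // lfunE.
have VG g u : unimodular_lift Omega Gamma a g -> u \in V -> u *m g \in V.
  by move=> [Gg _ _]; rewrite !VP => h; apply: submx_trans (UG _ Gg); apply: submxMr.
have V0 : V != 0%VS.
  apply: contraTneq U1 => h; rewrite -leqNgt leqn0 mxrank_eq0; apply/eqP/row_matrixP => i.
  by apply/eqP; rewrite row0 -memv0 -h VP row_sub.
have Vf : V != fullv.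
  apply: contraTneq U2 => h; rewrite -leqNgt -[leqLHS](mxrank1 R); apply: mxrankS.
  by apply/row_subP => i; rewrite -VP h memvf.
case: Hyp => [cpt|[G [GP' [GG [[phi [phiG [phiD [phi_inj _]]]] inf]]]]].
  have [e [b [e0 cc]]] := lift_cocompact Oscale Oopen chart conv GP GO Cx cpt.
  exact: nab1 (cocompact_normal_abelian CA Cx sG gen e0 cc VG V0 Vf).
have lift z := lift_exists Oscale chart conv GP GO Cx (GG _ (phiG z)).
(* Uniqueness of lifts turns [phi], multiplicative only up to scalars, into a true homomorphism
   [psi]. *)
pose c z := s2val (cid2 (lift z)); pose psi z := c z *: phi z.
have c0 z : c z != 0 := s2valP (cid2 (lift z)).
have Lpsi z : unimodular_lift Omega Gamma a (psi z) := s2valP' (cid2 (lift z)).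
have uniq := lift_unique Cx.
have psiD v w : psi (v + w) = psi v *m psi w.
  apply: (uniq _ _ _ (Lpsi _)); first exact: (ca_mul CA).
  have [d [d0 E]] := phiD v w; exists (c (v + w) * d / (c v * c w)).
  rewrite !mulf_neq0 ?invr_eq0 ?mulf_neq0 //; split => //.
  by rewrite /psi E -!scalemxAl -!scalemxAr !scalerA; congr (_ *: _); field; rewrite !c0.
have psi0 : psi 0 = 1%:M.
  have u0 := ca_unit CA (Lpsi 0).
  by rewrite -[LHS](mulKmx u0) -psiD addr0 mulVmx.
have psi_inj : injective psi.
  move=> v w h; apply/eqP; rewrite -subr_eq0; apply/eqP/phi_inj.
  exists (c (v - w))^-1; rewrite invr_eq0 c0; split => //.
  have : psi (v - w) = 1%:M by rewrite psiD h -psiD subrr.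
  by move=> <-; rewrite scalerA mulVf // scale1r.
have [t Ht] := lattice_normal_abelian CA Cx sG gen psiD psi0 Lpsi psi_inj VG V0 Vf nab1.
(* Infinite index is tested on the list [t] of representatives: a lift of [g] differs from one of
   them by some [psi z], so [g] lies in its coset of [G], which contains the scalars. *)
have [g [Gg ng]] := inf t; have [d d0 Ld] := lift_exists Oscale chart conv GP GO Cx Gg.
have [h ht [z hz]] := Ht _ Ld; apply: (ng h ht).
have -> : invmx h *m g = (c z / d)%:M *m phi z.
  rewrite mul_scalar_mx mulrC -scalerA -/(psi z) -hz -scalemxAr scalerA mulVf //.
  by rewrite scale1r.
have [_ [H [H' _]]] := GP'; apply: H' => //; apply: H; rewrite mulf_neq0 ?invr_eq0 //.
Qed.
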